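(* Let $d\ge1$, $\nu=0$, $\epsilon>0$, and let $\psi_0\in\big(H^1\cap\mathcal F(H^1)\big)(\mathbb R^d)$, $\psi_0\not\equiv0$, $\varrho_0=|\psi_0|^2$, $j_0=\epsilon\,{\rm Im}(\bar\psi_0\nabla\psi_0)$. Let $(\sqrt\varrho,\sqrt\varrho u)$ be a global weak solution to the isothermal Korteweg system (K) with initial data $(\varrho_0,j_0)$ whose energy $$E(t)=\tfrac12\int_{\mathbb R^d}\big(\varrho|u|^2+\epsilon^2|\nabla\sqrt\varrho|^2\big)+\int_{\mathbb R^d}\varrho\log\varrho$$ is conserved for all $t\ge0$, and such that $(\sqrt R,\sqrt RU)$ defined by $$\sqrt\varrho(t,x)=\frac1{\tau(t)^{d/2}}\sqrt R\Big(t,\frac x{\tau(t)}\Big)\Big(\frac{\|\varrho_0\|_{L^1}}{\|\Gamma\|_{L^1}}\Big)^{1/2},$$ $$(\sqrt\varrho u)(t,x)=\frac1{\tau(t)^{1+d/2}}(\sqrt RU)\Big(t,\frac x{\tau(t)}\Big)\Big(\frac{\|\varrho_0\|_{L^1}}{\|\Gamma\|_{L^1}}\Big)^{1/2}+\frac{\dot\tau(t)}{\tau(t)}x\sqrt{\varrho(t,x)}$$ is a global weak solution to the rescaled system (RK) satisfying $\mathcal E(t)+\int_0^t\mathcal D(s)\,ds=\mathcal E(0)$ for all $t\ge0$, where $$\mathcal E=\tfrac1{2\tau^2}\int_{\mathbb R^d}\big(|\sqrt RU|^2+\epsilon^2|\nabla\sqrt R|^2\big)+\int_{\mathbb R^d}\big(R|y|^2+R\log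 R\big),\qquad\mathcal D=\frac{\dot\tau}{\tau^3}\int_{\mathbb R^d}\big(|\sqrt RU|^2+\epsilon^2|\nabla\sqrt R|^2\big).$$ Then, as $t\to\infty$, $$\int_{\mathbb R^d}\begin{pmatrix} 1 \\ y \\ |y|^2 \end{pmatrix}R(t,y)\,dy\to\int_{\mathbb R^d}\begin{pmatrix} 1 \\ y \\ |y|^2 \end{pmatrix}\Gamma(y)\,dy,\qquad R(t)\rightharpoonup\Gamma\ \text{ weakly in }L^1(\mathbb R^d).$$
   Context: $\mathcal F(H^1)=\{f\in L^2(\mathbb R^d):\int(1+|x|^2)|f(x)|^2dx<\infty\}$; $\Gamma(y)=e^{-|y|^2}$; $\tau\in C^\infty([0,\infty))$ is the global solution of $\ddot\tau=2/\tau$, $\tau(0)=1$, $\dot\tau(0)=0$. The isothermal Korteweg system (K) is formally $$\partial_t\varrho+{\rm div}(\varrho u)=0,\qquad\partial_t(\varrho u)+{\rm div}(\varrho u\otimes u)+\nabla\varrho=\tfrac{\epsilon^2}2\varrho\nabla\Big(\tfrac{\Delta\sqrt\varrho}{\sqrt\varrho}\Big).$$ Definition. A global weak solution to (K) with initial data $(\varrho_0,j_0)$ is a pair $(\sqrt\varrho,\sqrt\varrho u)$ such that, with $\varrho:=(\sqrt\varrho)^2$ and $j:=\sqrt\varrho\times\sqrt\varrho u$: (i) $\sqrt\varrho\in L^\infty_{\rm loc}(0,\infty;H^1(\mathbb R^d))$, $\sqrt\varrho u\in L^\infty_{\rm loc}(0,\infty;L^2(\mathbb R^d))$, $\sqrt\varrho\ge0$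 a.e., and $\sqrt\varrho u=0$ a.e. on $\{\varrho=0\}$. (ii) For every $T>0$, every $\varphi\in C_0^\infty([0,T)\times\mathbb R^d)$ and every $\eta\in C_0^\infty([0,T)\times\mathbb R^d;\mathbb R^d)$, $$\int_0^T\!\!\int_{\mathbb R^d}(\varrho\,\partial_t\varphi+j\cdot\nabla\varphi)\,dt\,dx+\int_{\mathbb R^d}\varrho_0\varphi(0)\,dx=0,$$ $$\int_0^T\!\!\int_{\mathbb R^d}\Big(j\cdot\partial_t\eta+(\sqrt\varrho u)\otimes(\sqrt\varrho u):\nabla\eta+\varrho\,{\rm div}\,\eta+\epsilon^2\nabla\sqrt\varrho\otimes\nabla\sqrt\varrho:\nabla\eta-\tfrac{\epsilon^2}4\varrho\,\Delta\,{\rm div}\,\eta\Big)dt\,dx+\int_{\mathbb R^d}j_0\cdot\eta(0)\,dx=0.$$ (iii) (Generalized irrotationality) For a.e. $t\ge0$, $\nabla\wedge j=2\nabla\sqrt\varrho\wedge(\sqrt\varrho u)$ in the sense of distributions. In $E(t)$, $\varrho|u|^2$ means $|\sqrt\varrho u|^2$. The rescaled system (RK) is formally $$\partial_tR+\tfrac1{\tau^2}{\rm div}(RU)=0,\qquad\partial_t(RU)+\tfrac1{\tau^2}{\rm div}(RU\otimes U)+2yR+\nabla R=\tfrac{\epsilon^2}{2\tau^2}R\nabla\Big(\tfrac{\Delta\sqrt R}{\sqrt R}\Big).$$ A global weak solution $(\sqrt R,\sqrt RU)$ to (RK) is defined in the same way: with $R=(\sqrt R)^2$, $J=\sqrt R\times\sqrt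 RU$, one requires $\sqrt R\in L^\infty_{\rm loc}(0,\infty;H^1(\mathbb R^d))$, $\sqrt RU\in L^\infty_{\rm loc}(0,\infty;L^2(\mathbb R^d))$, $\sqrt R\ge0$ a.e., $\sqrt RU=0$ a.e. on $\{R=0\}$; for every $T>0$, every $\varphi\in C_0^\infty([0,T)\times\mathbb R^d)$ and every $\eta\in C_0^\infty([0,T)\times\mathbb R^d;\mathbb R^d)$, $$\int_0^T\!\!\int\big(R\,\partial_t\varphi+\tfrac1{\tau^2}J\cdot\nabla\varphi\big)+\int R_0\varphi(0)=0,$$ $$\int_0^T\!\!\int\Big(J\cdot\partial_t\eta+\tfrac1{\tau^2}(\sqrt RU)\otimes(\sqrt RU):\nabla\eta-2R\,y\cdot\eta+R\,{\rm div}\,\eta+\tfrac{\epsilon^2}{\tau^2}\nabla\sqrt R\otimes\nabla\sqrt R:\nabla\eta-\tfrac{\epsilon^2}{4\tau^2}R\,\Delta\,{\rm div}\,\eta\Big)+\int J_0\cdot\eta(0)=0;$$ and $\nabla\wedge J=2\nabla\sqrt R\wedge(\sqrt RU)$ in distributions for a.e. $t\ge0$. Here $R_0=\varrho_0\|\Gamma\|_{L^1}/\|\varrho_0\|_{L^1}$ and $J_0=j_0\|\Gamma\|_{L^1}/\|\varrho_0\|_{L^1}$.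
   Formalization: The density R is taken in its time-continuous representative: t ↦ ∫R(t)φ is assumed continuous on [0,∞) for every test function φ; otherwise R could be altered on a null set of times, preserving the energy identities but breaking the limits. *)

(* Defs.v *)
From HB Require Import structures.
From mathcomp Require Import all_boot all_order all_algebra.
From mathcomp Require Import complex.
From mathcomp Require Import all_classical all_reals all_analysis.

Set Implicit Arguments.
Unset Strict Implicit.
Unset Printing Implicit Defensive.

Import Order.TTheory GRing.Theory Num.Theory.
Import numFieldNormedType.Exports.

Local Open Scope classical_set_scope.
Local Open Scope ring_scope.

Definition measure_rV_display : measure_display -> measure_display.
Proof. exact. Qed.

Section measurable_rV.
Context {R : realType} (n : nat).

(* The product sigma-algebra, as for n.-tuple R in the library. *)
Let coords : 'I_n -> 'rV[R]_n -> R := fun i x => x ord0 i.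

Let rV_set0 : g_sigma_preimage coords set0.
Proof. exact: sigma_algebra0. Qed.

Let rV_setC A : g_sigma_preimage coords A -> g_sigma_preimage coords (~` A).
Proof. exact: sigma_algebraC. Qed.

Let rV_bigcup (F : (set 'rV[R]_n)^nat) :
  (forall i, g_sigma_preimage coords (F i)) ->
  g_sigma_preimage coords (\bigcup_i (F i)).
Proof. exact: sigma_algebra_bigcup. Qed.

HB.instance Definition _ :=
  @isMeasurable.Build (measure_rV_display default_measure_display)
    'rV[R]_n (g_sigma_preimage coords) rV_set0 rV_setC rV_bigcup.

End measurable_rV.

Lemma measurable_coord (R : realType) n (i : 'I_n) :
  measurable_fun [set: 'rV[R]_n] (fun x : 'rV[R]_n => x ord0 i).
Proof.
move=> _ Y mY; rewrite setTI; apply: sub_sigma_algebra => /=.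
rewrite -bigcup_seq/=; exists i => /=; first by rewrite mem_index_enum.
by exists Y => //; rewrite setTI.
Qed.

Lemma measurable_fun_rVP d (T : measurableType d) (R : realType) n
    (f : T -> 'rV[R]_n) :
  measurable_fun [set: T] f <->
  forall i, measurable_fun [set: T] (fun x => f x ord0 i).
Proof.
split=> [mf i|mf]; first exact: (measurableT_comp (measurable_coord i) mf).
apply: (measurability (\big[setU/set0]_(i < n)
  preimage_set_system setT (fun x : 'rV[R]_n => x ord0 i) measurable)) => //.
move=> _ [B + <-]; rewrite -bigcup_seq => -[i _ [Y mY <-]].
by rewrite [X in _ @^-1` X]setTI; exact: mf.
Qed.

Section lebesgue_rV.
Context {R : realType}.

Definition cons_rV n (p : R * 'rV[R]_n) : 'rV[R]_n.+1 :=
  row_mx (p.1%:M : 'M[R]_1) p.2.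

Definition behead_rV n (x : 'rV[R]_n.+1) : 'rV[R]_n :=
  \row_i x ord0 (lift ord0 i).

Lemma cons_rV0 n (p : R * 'rV[R]_n) : cons_rV p ord0 ord0 = p.1.
Proof.
rewrite /cons_rV (_ : ord0 = lshift n (ord0 : 'I_1)); last exact: val_inj.
by rewrite (row_mxEl (p.1%:M : 'M[R]_1)) mxE.
Qed.

Lemma cons_rVS n (p : R * 'rV[R]_n) i :
  cons_rV p ord0 (lift ord0 i) = p.2 ord0 i.
Proof.
rewrite /cons_rV (_ : lift ord0 i = rshift 1 i); last exact: val_inj.
by rewrite (row_mxEr (p.1%:M : 'M[R]_1)).
Qed.

Lemma measurable_cons_rV n :
  measurable_fun [set: (R * 'rV[R]_n)%type] (@cons_rV n).
Proof.
apply/measurable_fun_rVP => i; have [j ->|->] := unliftP ord0 i.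
  under eq_fun do rewrite cons_rVS.
  exact: (measurableT_comp (measurable_coord j) measurable_snd).
by under eq_fun do rewrite cons_rV0; exact: measurable_fst.
Qed.

Lemma measurable_behead_rV n :
  measurable_fun [set: 'rV[R]_n.+1] (@behead_rV n).
Proof.
apply/measurable_fun_rVP => i; rewrite /behead_rV.
by under eq_fun do rewrite mxE; exact: measurable_coord.
Qed.

Section cons_measure.
Variables (n : nat) (m : {sigma_finite_measure set 'rV[R]_n -> \bar R}).

Definition cons_measure : set 'rV[R]_n.+1 -> \bar R :=
  pushforward (lebesgue_measure \x m)%E (@cons_rV n).

Let mcons A : measurable A -> measurable (@cons_rV n @^-1` A).
Proof. by move=> mA; rewrite -[X in measurable X]setTI; exact: measurable_cons_rV. Qed.

Let cons_measure0 : cons_measure set0 = 0%E.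
Proof. by rewrite /cons_measure /pushforward preimage_set0 measure0. Qed.

Let cons_measure_ge0 A : (0 <= cons_measure A)%E.
Proof. exact: (measure_ge0 (lebesgue_measure \x m)%E). Qed.

Let cons_measure_sigma_additive : semi_sigma_additive cons_measure.
Proof.
move=> F mF tF mUF; rewrite /cons_measure /pushforward preimage_bigcup.
apply: measure_semi_sigma_additive.
- by move=> k; exact: mcons.
- apply/trivIsetP => /= i j _ _ ij; rewrite -preimage_setI.
  by move/trivIsetP : tF => /(_ _ _ _ _ ij) ->//; rewrite preimage_set0.
- by rewrite -preimage_bigcup; exact: mcons.
Qed.

HB.instance Definition _ := isMeasure.Build _ _ _ cons_measure
  cons_measure0 cons_measure_ge0 cons_measure_sigma_additive.

Let cons_measure_sigma_finite : sigma_finite setT cons_measure.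
Proof.
have /sigma_finiteP[F [FT ndF Foo]] := sigma_finiteT (@lebesgue_measure R).
have /sigma_finiteP[G [GT ndG Goo]] := sigma_finiteT m.
pose H k := [set x : 'rV[R]_n.+1 | F k (x ord0 ord0) /\ G k (behead_rV x)].
exists H => [|k].
  apply/seteqP; split=> // x _.
  have [i _ Fi] : (\bigcup_k F k) (x ord0 ord0) by rewrite -FT.
  have [j _ Gj] : (\bigcup_k G k) (behead_rV x) by rewrite -GT.
  exists (maxn i j) => //; split.
    by move: Fi; exact/subsetPset/ndF/leq_maxl.
  by move: Gj; exact/subsetPset/ndG/leq_maxr.
have [mFk Fk] := Foo k; have [mGk Gk] := Goo k.
split.
  rewrite [H k](_ : _ = (fun x : 'rV[R]_n.+1 => x ord0 ord0) @^-1` F k `&`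
    @behead_rV n @^-1` G k)//.
  apply: measurableI; rewrite -[X in measurable X]setTI.
    exact: (measurable_coord ord0).
  exact: measurable_behead_rV.
rewrite /cons_measure /pushforward (_ : _ @^-1` _ = F k `*` G k).
  by rewrite product_measure1E// lte_mul_pinfty// ge0_fin_numE.
apply/seteqP; split=> -[a u]; rewrite /H/= cons_rV0 (_ : behead_rV _ = u)//.
all: by apply/rowP => l; rewrite mxE cons_rVS.
Qed.

HB.instance Definition _ := Measure_isSigmaFinite.Build _ _ _ cons_measure
  cons_measure_sigma_finite.

End cons_measure.

Fixpoint lebesgue_rV n : {sigma_finite_measure set 'rV[R]_n -> \bar R} :=
  match n with
  | 0 => \d_(0 : 'rV[R]_0)
  | n'.+1 => cons_measure (lebesgue_rV n')
  end.

End lebesgue_rV.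

(* C^oo: all iterated directional derivatives exist and are differentiable;
   in finite dimension this is the usual notion. *)
Definition smooth (R : realType) (V : normedModType R) (f : V -> R) : Prop :=
  forall (s : seq V) (x : V),
    differentiable (foldr (fun v (g : V -> R) => 'D_v g) f s) x.

Section function_spaces.
Context {R : realType} {d : nat}.
Local Notation E := 'rV[R]_d.
Local Notation mu := (lebesgue_rV d).
Implicit Types (f : E -> R) (F G : E -> E).

(* The library norm on 'rV[R]_d is the sup norm; |x|^2 is x \dot x. *)
Definition dotv (u v : E) : R := \sum_i u ord0 i * v ord0 i.

Definition coordf F (i : 'I_d) : E -> R := fun x => F x ord0 i.

Definition test_fun (phi : E -> R) : Prop :=
  smooth phi /\
  exists K : set E, compact K /\ forall x, ~ K x -> phi x = 0.

(* C_0^oo([0, T) x R^d): restrictions to t >= 0 of smooth functions on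
   R x R^d, the restriction having compact support in [0, T) x R^d. *)
Definition test_fun_time (T : R) (phi : R * E -> R) : Prop :=
  smooth phi /\
  exists K : set (R * E)%type, [/\ compact K,
    K `<=` `[0, T[ `*` setT &
    forall t x, 0 <= t -> ~ K (t, x) -> phi (t, x) = 0].

Definition partial (i : 'I_d) (phi : E -> R) : E -> R :=
  'D_(delta_mx ord0 i : E) phi.

Definition partial_t (phi : R * E -> R) : R * E -> R :=
  'D_((1, 0) : R * E) phi.

Definition partial_x (i : 'I_d) (phi : R * E -> R) : R * E -> R :=
  'D_((0, delta_mx ord0 i) : R * E) phi.

Definition loc_integrable f : Prop :=
  measurable_fun setT f /\
  forall K : set E, compact K -> mu.-integrable K (EFin \o f).

Definition is_weak_grad f G : Prop :=
  [/\ loc_integrable f, forall i, loc_integrable (coordf G i) &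
   forall i phi, test_fun phi ->
     \int[mu]_x (f x * partial i phi x) =
     - (\int[mu]_x (coordf G i x * phi x))].

(* A choice of the weak gradient, which is unique up to null sets; only its
   integrals over R^d at fixed time are used below. *)
Definition wgrad f : E -> E := xget (cst 0) [set G | is_weak_grad f G].

Definition L2v F : Prop := forall i, coordf F i \in Lfun mu 2%:E.

Definition H1 f : Prop :=
  f \in Lfun mu 2%:E /\ exists G, is_weak_grad f G /\ L2v G.

Definition normL1 f : R := fine ('N[mu]_1 [EFin \o f])%E.

(* Weak convergence in L^1 as t -> +oo, tested against L^oo = (L^1)'. *)
Definition weak_cvgL1 (f : R -> E -> R) (g : E -> R) : Prop :=
  [/\ forall t, 0 <= t -> f t \in Lfun mu 1,
      g \in Lfun mu 1 &
      forall h, h \in Lfun mu +oo%E ->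
        (\int[mu]_x (f t x * h x)) @[t --> +oo] --> (\int[mu]_x (g x * h x))].

Definition cRe (psi : E -> R[i]) : E -> R := fun x => complex.Re (psi x).
Definition cIm (psi : E -> R[i]) : E -> R := fun x => complex.Im (psi x).

Definition cH1 (psi : E -> R[i]) : Prop := H1 (cRe psi) /\ H1 (cIm psi).

Definition absC2 (psi : E -> R[i]) : E -> R :=
  fun x => Normc.normc (psi x) ^+ 2.

Definition cFH1 (psi : E -> R[i]) : Prop :=
  [/\ cRe psi \in Lfun mu 2%:E, cIm psi \in Lfun mu 2%:E &
      (fun x => (1 + dotv x x) * absC2 psi x) \in Lfun mu 1].

Definition cgrad (psi : E -> R[i]) (x : E) (i : 'I_d) : R[i] :=
  Complex (wgrad (cRe psi) x ord0 i) (wgrad (cIm psi) x ord0 i).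

Definition current (eps : R) (psi : E -> R[i]) : E -> E :=
  fun x => \row_i (eps * complex.Im (conjc (psi x) * cgrad psi x i)).

Definition Gauss : E -> R := fun y => expR (- dotv y y).

End function_spaces.

Notation "u \dot v" := (dotv u v) (at level 40, left associativity) : ring_scope.

(* One-sided at t = 0: only the values of f on [0, +oo) matter. *)
Definition deriv_ge0 (R : realType) (f : R -> R) (t l : R) : Prop :=
  h^-1 * (f (t + h) - f t) @[h --> within [set h | 0 <= t + h] 0^'] --> l.

(* dtau is the derivative of tau; smoothness on [0, +oo) follows from the
   equation. *)
Definition tau_solution (R : realType) (tau dtau : R -> R) : Prop :=
  [/\ tau 0 = 1, dtau 0 = 0 & forall t, 0 <= t ->
    [/\ 0 < tau t, deriv_ge0 tau t (dtau t) & deriv_ge0 dtau t (2 / tau t)]].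

(* Below s stands for the density factor (sqrt rho, resp. sqrt R), w for the
   momentum factor (sqrt rho u, resp. sqrt R U). *)
Section weak_solutions.
Context {R : realType} {d : nat}.
Local Notation E := 'rV[R]_d.
Local Notation mu := (lebesgue_rV d).
Local Notation leb := (@lebesgue_measure R).
Implicit Types (s : R -> E -> R) (w : R -> E -> E).

Definition density s (t : R) : E -> R := fun x => s t x ^+ 2.

Definition momentum s w (t : R) : E -> E := fun x => s t x *: w t x.

(* L^oo_loc in time is on [0, +oo), i.e. L^oo(0, T; .) for every T > 0, as
   required by the weak formulations. *)
Definition sol_regular s w : Prop :=
  [/\ measurable_fun [set z : R * E | 0 <= z.1] (fun z : R * E => s z.1 z.2),
      forall i, measurable_fun [set z : R * E | 0 <= z.1]
        (fun z : R * E => w z.1 z.2 ord0 i),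
      forall T, 0 < T -> exists C : R, {ae leb, forall t, 0 < t < T ->
        H1 (s t) /\
        (\int[mu]_x (s t x ^+ 2 + wgrad (s t) x \dot wgrad (s t) x)) <= C} &
      forall T, 0 < T -> exists C : R, {ae leb, forall t, 0 < t < T ->
        L2v (w t) /\ (\int[mu]_x (w t x \dot w t x)) <= C}].

Definition compatible s w : Prop :=
  {ae (leb \x mu)%E, forall z : R * E, 0 <= z.1 -> 0 <= s z.1 z.2} /\
  {ae (leb \x mu)%E, forall z : R * E, 0 <= z.1 ->
     density s z.1 z.2 = 0 -> w z.1 z.2 = 0}.

(* curl (s w) = 2 grad s /\ w, with (curl F)_ij = d_i F_j - d_j F_i and
   (a /\ b)_ij = a_i b_j - a_j b_i. *)
Definition irrotational s w : Prop :=
  {ae leb, forall t : R, 0 <= t ->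
    forall (i j : 'I_d) (phi : E -> R), test_fun phi ->
    - (\int[mu]_x (momentum s w t x ord0 j * partial i phi x -
                   momentum s w t x ord0 i * partial j phi x)) =
    \int[mu]_x (2 * (wgrad (s t) x ord0 i * w t x ord0 j -
                     wgrad (s t) x ord0 j * w t x ord0 i) * phi x)}.

Definition gradx (phi : R * E -> R) (z : R * E) : E :=
  \row_i partial_x i phi z.

Definition vcomp (eta : R * E -> E) (i : 'I_d) : R * E -> R :=
  fun z => eta z ord0 i.

Definition dt_vec (eta : R * E -> E) (z : R * E) : E :=
  \row_i partial_t (vcomp eta i) z.

Definition divx (eta : R * E -> E) : R * E -> R :=
  fun z => \sum_i partial_x i (vcomp eta i) z.

Definition lapx (phi : R * E -> R) : R * E -> R :=
  fun z => \sum_i partial_x i (partial_x i phi) z.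

(* a (x) a : grad eta *)
Definition tens_grad (a : E) (eta : R * E -> E) (z : R * E) : R :=
  \sum_i \sum_j a ord0 i * a ord0 j * partial_x j (vcomp eta i) z.

Definition test_vec_time (T : R) (eta : R * E -> E) : Prop :=
  forall i, test_fun_time T (vcomp eta i).

Definition weak_solution_K (eps : R) (rho0 : E -> R) (j0 : E -> E) s w : Prop :=
  let rho := density s in
  let j := momentum s w in
  [/\ sol_regular s w, compatible s w,
   forall T phi, 0 < T -> test_fun_time T phi ->
     (\int[leb]_(t in `]0, T[) (\int[mu]_x
        (rho t x * partial_t phi (t, x) + j t x \dot gradx phi (t, x))))
     + (\int[mu]_x (rho0 x * phi (0, x))) = 0,
   forall T eta, 0 < T -> test_vec_time T eta ->
     (\int[leb]_(t in `]0, T[) (\int[mu]_x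
        (j t x \dot dt_vec eta (t, x)
         + tens_grad (w t x) eta (t, x)
         + rho t x * divx eta (t, x)
         + eps ^+ 2 * tens_grad (wgrad (s t) x) eta (t, x)
         - eps ^+ 2 / 4 * rho t x * lapx (divx eta) (t, x))))
     + (\int[mu]_x (j0 x \dot eta (0, x))) = 0
   & irrotational s w].

Definition weak_solution_RK (eps : R) (tau : R -> R)
    (R0 : E -> R) (J0 : E -> E) s w : Prop :=
  let rho := density s in
  let J := momentum s w in
  [/\ sol_regular s w, compatible s w,
   forall T phi, 0 < T -> test_fun_time T phi ->
     (\int[leb]_(t in `]0, T[) (\int[mu]_y
        (rho t y * partial_t phi (t, y)
         + (tau t ^+ 2)^-1 * (J t y \dot gradx phi (t, y)))))
     + (\int[mu]_y (R0 y * phi (0, y))) = 0,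
   forall T eta, 0 < T -> test_vec_time T eta ->
     (\int[leb]_(t in `]0, T[) (\int[mu]_y
        (J t y \dot dt_vec eta (t, y)
         + (tau t ^+ 2)^-1 * tens_grad (w t y) eta (t, y)
         - 2 * rho t y * (y \dot eta (t, y))
         + rho t y * divx eta (t, y)
         + eps ^+ 2 / tau t ^+ 2 * tens_grad (wgrad (s t) y) eta (t, y)
         - eps ^+ 2 / (4 * tau t ^+ 2) * rho t y * lapx (divx eta) (t, y))))
     + (\int[mu]_y (J0 y \dot eta (0, y))) = 0
   & irrotational s w].

(* Elements of L^oo(0, T; X) are defined for almost every t only. Statements
   at every t, and limits as t -> +oo, refer to the representative of the
   density that is continuous in time with values in distributions, which
   exists by the continuity equation. *)
Definition weakly_continuous s : Prop :=
  forall phi : E -> R, test_fun phi ->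
    {within `[0, +oo[, continuous
      (fun t : R => \int[mu]_x (density s t x * phi x))}.

Definition kinetic (eps : R) s w (t : R) : R :=
  \int[mu]_x (w t x \dot w t x + eps ^+ 2 * (wgrad (s t) x \dot wgrad (s t) x)).

Definition energy (eps : R) s w (t : R) : R :=
  2^-1 * kinetic eps s w t + (\int[mu]_x (density s t x * ln (density s t x))).

(* Finiteness of every term at every time is part of conservation. *)
Definition energy_conserved (eps : R) s w : Prop :=
  forall t, 0 <= t ->
    [/\ H1 (s t), L2v (w t),
        (fun x => density s t x * ln (density s t x)) \in Lfun mu 1 &
        energy eps s w t = energy eps s w 0].

Definition pseudo_energy (eps : R) (tau : R -> R) s w (t : R) : R :=
  (2 * tau t ^+ 2)^-1 * kinetic eps s w t +
  (\int[mu]_y (density s t y * (y \dot y)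
               + density s t y * ln (density s t y))).

Definition dissipation (eps : R) (tau dtau : R -> R) s w (t : R) : R :=
  dtau t / tau t ^+ 3 * kinetic eps s w t.

Definition energy_dissipation (eps : R) (tau dtau : R -> R) s w : Prop :=
  forall t, 0 <= t ->
    [/\ H1 (s t), L2v (w t),
        (fun y => density s t y * (y \dot y)
                  + density s t y * ln (density s t y)) \in Lfun mu 1 &
        pseudo_energy eps tau s w t
        + (\int[leb]_(r in `[0, t]) dissipation eps tau dtau s w r)
        = pseudo_energy eps tau s w 0].

Definition rescaled (tau dtau : R -> R) (m : R) s w S W : Prop :=
  forall t, 0 <= t -> {ae mu, forall x : E,
    s t x = (tau t `^ (d%:R / 2))^-1 * S t ((tau t)^-1 *: x) * Num.sqrt m
    /\
    w t x = ((tau t `^ (1 + d%:R / 2))^-1 * Num.sqrt m) *: W t ((tau t)^-1 *: x)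
            + (dtau t / tau t * s t x) *: x}.

End weak_solutions.

(* Main.v *)
Require Import Defs.
From HB Require Import structures.
From mathcomp Require Import all_boot all_order all_algebra.
From mathcomp Require Import complex.
From mathcomp Require Import all_classical all_reals all_analysis.
From mathcomp Require Import measurable_realfun ess_sup_inf.
From mathcomp Require Import ring lra.
Set Implicit Arguments.
Unset Strict Implicit.
Unset Printing Implicit Defensive.

Import Order.TTheory GRing.Theory Num.Theory.
Import numFieldNormedType.Exports.
Local Open Scope classical_set_scope.
Local Open Scope ring_scope.

(** The identity E(t) + int D = E(0) makes the densities R(t) uniformly tight and
uniformly integrable (bounds on int |y|^2 R and int R ln R), and makes
int_0^oo (tau'/tau^3) (|sqrt R U|^2 + eps^2 |grad sqrt R|^2) finite. Testing the
continuity equation, t |-> int R(t) phi varies slowly: by Cauchy-Schwarz its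
increments over a time block are controlled by the dissipation of that block. By
pigeonhole [T, T^2] contains, among about tau'(T)^2 dyadic blocks, one whose dissipation is
small compared with tau'(T)^(-2); the momentum equation tested on it gives
int R (d_j psi - 2 y_j psi) -> 0. Every test function of one variable is, up to
its Gaussian mean, of the form k' - 2 x k (Stein's equation), so that, one
coordinate at a time, int R(t) prod_i f_i(y_i) -> int Gamma prod_i f_i. Tightness and
uniform integrability upgrade this to weak L^1 convergence and to the limits of int R
and int y R. For int |y|^2 R, lower semicontinuity leaves an upper bound to prove: in
the conserved energy of (K) the kinetic term contains tau'^2 |y|^2 R / 2 with
tau'^2 = 4 ln tau, while the change of variables in the entropy produces
- d ln tau int R; comparing the coefficients of ln tau gives
limsup int |y|^2 R <= (d/2) int Gamma = int |y|^2 Gamma. *)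

(** Two obstacles shape the argument. First, [wgrad] is chosen separately at each time, so nothing
    makes the time integrands of the weak equations measurable a priori: the equations are used only
    through pointwise two-sided bounds ([Rint_sandwich]), and measurability of [kinetic] is read off
    the energy identity. Second, the scaling is off by a logarithm. On a block of length L one has
    tau <= 7 L tau'(T), so the time derivative of the momentum costs tau'(T)^2 times the dissipation
    of the block, where tau'^2 = 4 ln tau; this loss is what the pigeonhole repairs. The return from
    the selected block to T loses nothing: with the Young weight m tau'(T) / tau(t) the remainder
    integrates to (ln tau(2 T^2) - ln tau(T)) / (m tau'(T)^2), at most a constant over m, and m is
    fixed before T. Finally, constants are not compactly supported, so Stein's equation compares
    each factor with a wide cutoff; mass conservation and tightness then fix the common constant. *)

Section smooth_calculus.
Context {R : realType}.

(** Smoothness quantifies over all finite lists of directions; a class of differentiable functions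
    stable under every directional derivative absorbs any such list. The smoothness proofs below
    exhibit such a class, directly or through [smooth_alg]. *)
Lemma smooth_ind (V : normedModType R) (P : (V -> R) -> Prop) :
  (forall g, P g -> (forall x, differentiable g x) /\ forall v, P ('D_v g)) ->
  forall f, P f -> smooth f.
Proof.
move=> Pd f Pf s x.
suff Ps : P (foldr (fun v (g : V -> R) => 'D_v g) f s) by have [+ _] := Pd _ Ps; apply.
by elim: s => //= v s ih; have [_] := Pd _ ih; apply.
Qed.

Lemma smooth_differentiable (V : normedModType R) (f : V -> R) x :
  smooth f -> differentiable f x.
Proof. by move=> /(_ [::]); exact. Qed.

Lemma smooth_derive (V : normedModType R) (f : V -> R) v :
  smooth f -> smooth ('D_v f).
Proof. by move=> sf s x; have := sf (rcons s v) x; rewrite -cats1 foldr_cat. Qed.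

Lemma smooth_derivable (V : normedModType R) (f : V -> R) x v :
  smooth f -> derivable f x v.
Proof. by move=> sf; apply/diff_derivable/smooth_differentiable. Qed.

Lemma smooth_continuous (V : normedModType R) (f : V -> R) :
  smooth f -> continuous f.
Proof. by move=> sf x; apply/differentiable_continuous/smooth_differentiable. Qed.

(** The class given to [smooth_ind] for sums, products and compositions together: the derivative of
    g o f is the product (g' o f) f', and that of a product is a sum of products, so the three
    constructions have to be closed at once. *)
Inductive smooth_alg (V : normedModType R) : (V -> R) -> Prop :=
| smooth_alg_base f : smooth f -> smooth_alg f
| smooth_alg_comp (g : R -> R) (f : V -> R) :
    smooth g -> smooth f -> smooth_alg (g \o f)
| smooth_alg_add f g : smooth_alg f -> smooth_alg g -> smooth_alg (f + g)
| smooth_alg_mul f g : smooth_alg f -> smooth_alg g -> smooth_alg (f * g).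

Lemma derive_compR (V : normedModType R) (g : R -> R) (f : V -> R) x v :
  differentiable g (f x) -> differentiable f x ->
  'D_v (g \o f) x = 'D_1 g (f x) * 'D_v f x.
Proof.
move=> dg df; rewrite deriveE; last exact: differentiable_comp.
rewrite diff_comp//= !deriveE//.
rewrite -[X in 'd g _ X = _]mulr1 -[_ * 1]/('d f x v *: (1 : R)) linearZ/=.
by rewrite mulrC.
Qed.

Lemma smooth_alg_smooth (V : normedModType R) (f : V -> R) :
  smooth_alg f -> smooth f.
Proof.
apply: smooth_ind => {}f; elim.
- move=> g sg; split=> [x|v]; first exact: smooth_differentiable.
  exact/smooth_alg_base/smooth_derive.
- move=> g h sg sh; split=> [x|v].
    by apply: differentiable_comp; exact: smooth_differentiable.
  rewrite (_ : 'D_v _ = ('D_1 g \o h) * 'D_v h).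
    apply: smooth_alg_mul; last exact/smooth_alg_base/smooth_derive.
    by apply: smooth_alg_comp => //; exact: smooth_derive.
  by apply/funext => x; apply: derive_compR; exact: smooth_differentiable.
- move=> g h _ [dg Dg] _ [dh Dh]; split=> [x|v]; first exact: differentiableD.
  rewrite (_ : 'D_v _ = 'D_v g + 'D_v h); first exact: smooth_alg_add.
  by apply/funext => x; rewrite deriveD//; exact: diff_derivable.
- move=> g h sg [dg Dg] sh [dh Dh]; split=> [x|v]; first exact: differentiableM.
  rewrite (_ : 'D_v _ = g * 'D_v h + h * 'D_v g).
    by apply: smooth_alg_add; exact: smooth_alg_mul.
  by apply/funext => x; rewrite deriveM//; exact: diff_derivable.
Qed.

Lemma smooth_cst (V : normedModType R) (c : R) : smooth (fun _ : V => c).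
Proof.
apply: (@smooth_ind V (fun f => exists c, f = cst c)); last by exists c.
move=> _ [k ->]; split=> [x|v]; first exact: differentiable_cst.
by exists 0; apply/funext => x; rewrite derive_cst.
Qed.

Lemma smoothD (V : normedModType R) (f g : V -> R) :
  smooth f -> smooth g -> smooth (fun x => f x + g x).
Proof.
by move=> sf sg; apply/(@smooth_alg_smooth _ (f + g))/smooth_alg_add; exact: smooth_alg_base.
Qed.

Lemma smoothM (V : normedModType R) (f g : V -> R) :
  smooth f -> smooth g -> smooth (fun x => f x * g x).
Proof.
by move=> sf sg; apply/(@smooth_alg_smooth _ (f * g))/smooth_alg_mul; exact: smooth_alg_base.
Qed.

Lemma smooth_compR (V : normedModType R) (g : R -> R) (f : V -> R) :
  smooth g -> smooth f -> smooth (fun x => g (f x)).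
Proof. by move=> sg sf; apply/(@smooth_alg_smooth _ (g \o f))/smooth_alg_comp. Qed.

Lemma smooth_prod (V : normedModType R) n (f : 'I_n -> V -> R) :
  (forall i, smooth (f i)) -> smooth (fun x => \prod_i f i x).
Proof.
move=> sf; elim: (index_enum _) => [|i s ih].
  by under eq_fun do rewrite big_nil; exact: smooth_cst.
under eq_fun do rewrite big_cons.
exact: smoothM (sf i) ih.
Qed.

Lemma derive_comp_affine (V W : normedModType R) (l L : V -> W) (f : W -> R) x v :
  is_diff x l L -> differentiable f (l x) ->
  'D_v (f \o l) x = 'D_(L v) f (l x).
Proof.
move=> dl df; have dlx : differentiable l x by case: dl.
rewrite deriveE; last exact: differentiable_comp.
by rewrite diff_comp//= diff_val deriveE.
Qed.

(** The differential [L] of [l] is the same at every point, so the derivative of g o l along v is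
    ('D_(L v) g) o l and keeps the form smooth o l. *)
Lemma smooth_comp_affine (V W : normedModType R) (l L : V -> W) (f : W -> R) :
  (forall x, is_diff x l L) -> smooth f -> smooth (f \o l).
Proof.
move=> dl sf.
apply: (@smooth_ind V (fun h => exists2 g, smooth g & h = g \o l)); last by exists f.
move=> _ [g sg ->]; split=> [x|v].
  apply: differentiable_comp; last exact: smooth_differentiable.
  by have [] := dl x.
exists ('D_(L v) g); first exact: smooth_derive.
by apply/funext => x; apply: derive_comp_affine => //; exact: smooth_differentiable.
Qed.

Lemma smooth_id : smooth (id : R -> R).
Proof.
apply: (@smooth_ind _ (fun f => f = id \/ exists c, f = cst c)); last by left.
move=> _ [->|[c ->]]; split=> [x|v]; [by []| |exact: differentiable_cst|].
  by right; exists v; apply/funext => x; rewrite derive_id.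
by right; exists 0; apply/funext => x; rewrite derive_cst.
Qed.

Lemma smooth_expR : smooth (@expR R).
Proof.
apply: (@smooth_ind _ (fun f => exists c, f = fun x => c * expR x)).
  move=> _ [c ->]; split=> [x|v].
    by apply/derivable1_diffP/derivableM.
  exists (c * v); apply/funext => x.
  rewrite deriveE; last by apply/derivable1_diffP/derivableM.
  rewrite diff1E; last by apply/derivable1_diffP/derivableM.
  rewrite derive1E deriveM// derive_cst scaler0 addr0 derive_val.
  by rewrite /GRing.scale/=; ring.
by exists 1; apply/funext => x; rewrite mul1r.
Qed.

Lemma is_diff_linear (V W : normedModType R) (L : V -> W) x :
  linear L -> continuous L -> is_diff x L L.
Proof.
move=> linL cL.
pose Lm := GRing.isLinear.Build _ _ _ _ _ linL.
pose LL : {linear _ -> _} := HB.pack L Lm.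
have -> : L = LL by [].
by apply: DiffDef; [exact/linear_differentiable|rewrite diff_lin].
Qed.

Lemma is_diff_fst (V W : normedModType R) (x : V * W) : is_diff x fst fst.
Proof. by apply: is_diff_linear => // ?; exact: cvg_fst. Qed.

Lemma is_diff_snd (V W : normedModType R) (x : V * W) : is_diff x snd snd.
Proof. by apply: is_diff_linear => // ?; exact: cvg_snd. Qed.

Lemma is_diff_coord n (i : 'I_n) (x : 'rV[R]_n) :
  is_diff x (fun y : 'rV[R]_n => y ord0 i) (fun y : 'rV[R]_n => y ord0 i).
Proof.
apply: is_diff_linear; first by move=> k u v; rewrite !mxE.
exact: coord_continuous.
Qed.

Lemma is_diff_affineR (a b x : R) :
  is_diff x (fun y : R => a * y + b) (fun y => a * y).
Proof.
have -> : (fun y : R => a * y) = (a *: id : R -> R) + 0.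
  by apply/funext => y; rewrite /GRing.add/= addr0.
by apply: (@is_diffD R _ _ (a *: id) (cst b)).
Qed.

Lemma smooth_coord n (i : 'I_n) (g : R -> R) : smooth g ->
  smooth (fun y : 'rV[R]_n => g (y ord0 i)).
Proof. by move=> sg; apply: (smooth_comp_affine (is_diff_coord i)). Qed.

Lemma smooth_affineR (a b : R) (g : R -> R) : smooth g ->
  smooth (fun y : R => g (a * y + b)).
Proof. by move=> sg; apply: (smooth_comp_affine (is_diff_affineR a b)). Qed.

Lemma smoothZ (V : normedModType R) (c : R) (f : V -> R) : smooth f ->
  smooth (fun x => c * f x).
Proof. by move=> sf; apply: smoothM => //; exact: smooth_cst. Qed.

Lemma smoothN (V : normedModType R) (f : V -> R) : smooth f ->
  smooth (fun x => - f x).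
Proof. by move=> sf; under eq_fun do rewrite -mulN1r; exact: smoothZ. Qed.

Lemma smoothB (V : normedModType R) (f g : V -> R) :
  smooth f -> smooth g -> smooth (fun x => f x - g x).
Proof. by move=> sf sg; apply: smoothD => //; exact: smoothN. Qed.

End smooth_calculus.

(** * The flat functions x^(-k) e^(-1/x) and their smoothness *)

Section flat.
Context {R : realType}.
Implicit Types (x : R) (k : nat).

(** The index k is there because the derivatives of e^(-1/x) stay in the span of this family:
    differentiating [flat k] gives [flat k.+2] minus k times [flat k.+1]. *)
Definition flat k x : R := if 0 < x then x^-1 ^+ k * expR (- x^-1) else 0.

Lemma flat_ge0 k x : 0 <= flat k x.
Proof.
rewrite /flat; case: ifPn => // x0.
by rewrite mulr_ge0 ?expR_ge0// exprn_ge0// invr_ge0 ltW.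
Qed.

Lemma flat_le0 k x : x <= 0 -> flat k x = 0.
Proof. by rewrite /flat ltNge => ->. Qed.

Lemma flat_gt0 k x : 0 < x -> 0 < flat k x.
Proof.
by move=> x0; rewrite /flat x0 mulr_gt0 ?expR_gt0// exprn_gt0// invr_gt0.
Qed.

Lemma flat0_le1 x : flat 0 x <= 1.
Proof.
rewrite /flat; case: ifPn => // x0; rewrite expr0 mul1r -[leRHS]expR0 ler_expR.
by rewrite oppr_le0 invr_ge0 ltW.
Qed.

(** The term of order k + 2 of the exponential series at u = 1/x gives u^(k+2) <= (k+2)! e^u. A
    quadratic bound is enough for differentiability at 0. *)
Lemma flat_le_sqr k x : flat k x <= (k.+2)`!%:R * x ^+ 2.
Proof.
rewrite /flat; case: ifPn => x0; last by rewrite mulr_ge0// ?sqr_ge0.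
have u0 : 0 < x^-1 by rewrite invr_gt0.
have : x^-1 ^+ k.+2 <= (k.+2)`!%:R * expR x^-1.
  rewrite -ler_pdivrMl ?ltr0n ?fact_gt0// mulrC.
  by apply: le_trans (expR_ge1Dxn k.+1 (ltW u0)); rewrite lerDr.
rewrite expRN -[k.+2]addn2 exprD => h.
rewrite ler_pdivrMr ?expR_gt0// -mulrA [_ ^+ 2 * _]mulrC mulrA.
rewrite -ler_pdivrMr ?exprn_gt0//.
by rewrite -exprVn.
Qed.

Lemma is_derive_flat k x :
  is_derive x (1 : R) (flat k) (flat k.+2 x - k%:R * flat k.+1 x).
Proof.
have [x0|x0|->] := ltgtP x 0.
- rewrite !flat_le0 ?mulr0 ?subr0; try exact: ltW.
  apply: (@near_eq_is_derive _ _ _ (cst 0)).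
    near=> y; rewrite flat_le0//; apply/ltW.
    by near: y; exact: lt_nbhsl.
- pose f : R -> R := (fun y => y^-1) ^+ k * (expR \o fun y => - y^-1).
  apply: (@near_eq_is_derive _ _ _ f).
    near=> y; rewrite /flat/f ifT ?mulrfctE ?exprfctE//.
    by near: y; exact: lt_nbhsr.
  rewrite /flat x0.
  have xn0 : x != 0 by rewrite gt_eqF.
  have dV : is_derive x (1 : R) (fun y : R => y^-1) (- x ^- 2).
    have := @is_deriveV _ id x 1 1 xn0 (is_derive_id _ _).
    by rewrite scaler1//= /GRing.scale/= mulr1.
  have dX := @is_deriveX R R _ k x 1 _ dV.
  have dE := @is_derive1_comp R expR (fun y : R => - y^-1) x _ _
    (is_derive_expR _) (is_deriveN dV).
  have := @is_deriveM R R _ _ x 1 _ _ dX dE.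
  move/is_derive_eq; apply.
  rewrite exprfctE /= /GRing.scale/= opprK.
  case: (k) => [|j]; first by rewrite /= !expr0 !mul0r subr0 -exprVn; ring.
  by rewrite /= -!exprVn !exprS; ring.
(* At 0 the difference quotient is at most (k+2)! |h|, so the derivative is 0. *)
- rewrite !flat_le0 ?mulr0 ?subr0//.
  have cv : h^-1 *: (flat k (h + 0) - flat k 0) @[h --> 0^'] --> (0 : R).
    rewrite flat_le0//; under eq_fun do rewrite subr0 addr0.
    apply/cvgr0Pnorm_lt => e e0; near=> h.
    have h0 : h != 0 by near: h; exact: nbhs_dnbhs_neq.
    rewrite normrZ normfV (ger0_norm (flat_ge0 _ _)).
    rewrite mulrC ltr_pdivrMr ?normr_gt0//.
    apply: le_lt_trans (flat_le_sqr _ _) _.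
    rewrite -real_normK ?num_real// expr2 mulrA ltr_pM2r ?normr_gt0//.
    rewrite mulrC -ltr_pdivlMr ?ltr0n ?fact_gt0//.
    near: h; apply: dnbhs0_lt; rewrite divr_gt0// ?ltr0n ?fact_gt0//.
  have cv' : h^-1 *: ((flat k \o shift 0) (h *: 1) - flat k 0) @[h --> 0^'] --> (0 : R).
    by under eq_fun do rewrite /= /GRing.scale/= mulr1.
  apply: DeriveDef; first by apply/cvg_ex; exists 0.
  by apply/cvg_lim.
Unshelve. all: by end_near. Qed.

Inductive flat_span : (R -> R) -> Prop :=
| flat_span_base k : flat_span (flat k)
| flat_span_add f g c : flat_span f -> flat_span g -> flat_span (fun x => f x + c * g x).

Lemma smooth_flat k : smooth (flat k).
Proof.
apply: (@smooth_ind _ _ flat_span); last exact: flat_span_base.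
move=> g.
suff : flat_span g -> exists2 g', flat_span g' & forall x, is_derive x (1:R) g (g' x).
  move=> h sg; have [g' sg' dg] := h sg; split => [x|v].
    by apply/derivable1_diffP; have [] := dg x.
  (* [flat_span] has no constructor for scalar multiples; v g' is written as g' + (v - 1) g'. *)
  rewrite (_ : 'D_v g = fun x => g' x + (v - 1) * g' x); first exact: flat_span_add.
  apply/funext => x; have df : differentiable g x.
    by apply/derivable1_diffP; have [] := dg x.
  rewrite deriveE// diff1E// derive1E (@derive_val _ _ _ _ _ _ _ (dg x)).
  by rewrite /GRing.scale/=; ring.
elim=> [j|f h c _ [f' sf' df] _ [h' sh' dh]].
  exists (fun x => flat j.+2 x + - j%:R * flat j.+1 x).
    by apply: flat_span_add; exact: flat_span_base.
  by move=> x; rewrite mulNr; exact: is_derive_flat.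
exists (fun x => f' x + c * h' x); first exact: flat_span_add.
move=> x; have := is_deriveD (df x) (is_deriveZ c (dh x)).
by move/is_derive_eq; apply.
Qed.

Lemma cvg_flat0 x : (fun n => flat 0 (n.+1%:R * x)) @ \oo --> ((0 < x)%R%:R : R).
Proof.
have [x0|x0] := ltP 0 x; last first.
  rewrite (_ : (fun _ => _) = cst 0); first exact: cvg_cst.
  by apply/funext => n; rewrite flat_le0// pmulr_rle0.
rewrite [X in X @ _ --> _](_ : _ = fun n => expR (- (n.+1%:R^-1 * x^-1))); last first.
  by apply/funext => n; rewrite /flat pmulr_rgt0// x0 expr0 mul1r invfM.
rewrite -[1%:R](@expR0 R) -oppr0 -(mul0r x^-1).
apply: continuous_cvg; first exact: continuous_expR.
by apply: cvgN; apply: cvgMl; exact: cvg_harmonic.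
Qed.

End flat.

(** * Test functions: in one variable, as products over coordinates, as products with a function of
    time *)

Section test_functions.
Context {R : realType} {d : nat}.
Local Notation E := 'rV[R]_d.

Definition test1 (f : R -> R) : Prop :=
  smooth f /\ exists B : R, forall x, B <= `|x| -> f x = 0.

Lemma test1M f g : smooth f -> test1 g -> test1 (fun x => f x * g x).
Proof.
move=> sf [sg [B gB]]; split; first exact: smoothM.
by exists B => x /gB ->; rewrite mulr0.
Qed.

Lemma derive_eq0_out (V : normedModType R) (K : set V) (f : V -> R) v :
  closed K -> (forall x, ~ K x -> f x = 0) -> forall x, ~ K x -> 'D_v f x = 0.
Proof.
move=> cK fK x nKx; rewrite (@near_eq_derive _ _ _ _ (cst 0)) ?derive_cst//.
have : nbhs x (~` K) by apply: open_nbhs_nbhs; split => //; exact: closed_openC.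
by apply: filterS => y nKy /=; exact: fK.
Qed.

Lemma test_fun_partial (phi : E -> R) i : test_fun phi -> test_fun (partial i phi).
Proof.
move=> [sp [K [cK pK]]]; split; first exact: smooth_derive.
exists K; split => //; apply: derive_eq0_out => //.
exact: compact_closed.
Qed.

Lemma test_funM (h phi : E -> R) : smooth h -> test_fun phi ->
  test_fun (fun x => h x * phi x).
Proof.
move=> sh [sp [K [cK pK]]]; split; first exact: smoothM.
by exists K; split => // x /pK ->; rewrite mulr0.
Qed.

Lemma test_funD (phi psi : E -> R) : test_fun phi -> test_fun psi ->
  test_fun (fun x => phi x + psi x).
Proof.
move=> [sp [K [cK pK]]] [sq [L [cL qL]]]; split; first exact: smoothD.
exists (K `|` L); split; first exact: compactU.
by move=> x /not_orP[/pK -> /qL ->]; rewrite addr0.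
Qed.

Lemma test_funZ (phi : E -> R) c : test_fun phi -> test_fun (fun x => c * phi x).
Proof. by move=> tp; apply: test_funM => //; exact: smooth_cst. Qed.

Lemma test_fun0 : test_fun (fun _ : E => 0 : R).
Proof. by split; [exact: smooth_cst|exists set0; split => //; exact: compact0]. Qed.

Lemma test_fun_bounded (phi : E -> R) : test_fun phi ->
  exists2 C : R, 0 <= C & forall x, `|phi x| <= C.
Proof.
move=> [sp [K [cK pK]]].
have [K0|/eqP/set0P K0] := pselect (K = set0).
  by exists 0 => // x; rewrite pK ?normr0// K0; case.
have cp : {within K, continuous (fun x => `|phi x|)}.
  apply: continuous_subspaceT => x; apply: continuous_comp.
    exact: smooth_continuous.
  exact: norm_continuous.
have [c Kc hc] := compact_EVT_max K0 cK cp.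
exists `|phi c| => // x; have [Kx|nKx] := pselect (K x).
  by apply: hc; rewrite inE.
by rewrite pK// normr0.
Qed.

Definition prodf (f : 'I_d -> R -> R) (y : E) : R := \prod_i f i (y ord0 i).

Definition upd (f : 'I_d -> R -> R) (j : 'I_d) (g : R -> R) : 'I_d -> R -> R :=
  fun i => if i == j then g else f i.

Lemma prodf_upd f j g y :
  prodf (upd f j g) y = g (y ord0 j) * \prod_(i | i != j) f i (y ord0 i).
Proof.
rewrite /prodf (bigD1 j)//= /upd eqxx; congr (_ * _).
by apply: eq_bigr => i /negPf ->.
Qed.

Lemma upd_id f j : upd f j (f j) = f.
Proof. by apply/funext => i; rewrite /upd; case: eqP => // ->. Qed.

Lemma smooth_prodf f : (forall i, smooth (f i)) -> smooth (prodf f).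
Proof. by move=> sf; apply: smooth_prod => i; exact: smooth_coord. Qed.

Lemma test_prodf f : (forall i, test1 (f i)) -> test_fun (prodf f).
Proof.
move=> tf; split; first by apply: smooth_prodf => i; case: (tf i).
have /choice[B fB] : forall i, exists B : R, forall x, B <= `|x| -> f i x = 0.
  by move=> i; case: (tf i).
exists [set y : E | forall i, `[- `|B i|, `|B i|]%classic (y ord0 i)]; split.
  apply: (@rV_compact R d (fun i => `[- `|B i|, `|B i|]%classic)) => i.
  exact: segment_compact.
move=> y /existsNP[i Bi]; rewrite /prodf (bigD1 i)//= fB ?mul0r//.
rewrite leNgt; apply/negP => yB; apply: Bi.
rewrite /= in_itv/= -ler_norml.
by rewrite (le_trans (ltW yB))// ler_norm.
Qed.

Lemma partial_prodf f j : (forall i, smooth (f i)) ->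
  partial j (prodf f) = prodf (upd f j ('D_1 (f j))).
Proof.
move=> sf; apply/funext => y; rewrite prodf_upd /partial.
pose g (y : E) := f j (y ord0 j).
pose h (y : E) := \prod_(i | i != j) f i (y ord0 i).
have -> : prodf f = g * h.
  by apply/funext => z; rewrite /prodf (bigD1 j).
have sg : smooth g by exact: smooth_coord.
have sh : smooth h.
  rewrite /h; elim: (index_enum _) => [|i s ih].
    by under eq_fun do rewrite big_nil; exact: smooth_cst.
  under eq_fun do rewrite big_cons.
  by case: (i != j) => //; apply: smoothM => //; exact: smooth_coord.
rewrite deriveM; try exact: smooth_derivable.
(* The remaining factors do not involve coordinate j, so the difference quotient is identically
   0. *)
have -> : 'D_(delta_mx ord0 j) h y = 0.
  rewrite /derive.
  apply/cvg_lim => //; apply: cvg_near_cst; apply: nearW => t.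
  rewrite (_ : (h \o _) _ = h y) ?subrr ?scaler0//.
  by apply: eq_bigr => i ij; rewrite /shift !mxE (negPf ij) andbF mulr0 add0r.
rewrite scaler0 add0r /g.
rewrite (derive_comp_affine _ (is_diff_coord j y)); last exact: smooth_differentiable.
by rewrite mxE !eqxx mulrC.
Qed.

Lemma updE f j g : upd f j g j = g.
Proof. by rewrite /upd eqxx. Qed.

Lemma upd_upd f j g h : upd (upd f j g) j h = upd f j h.
Proof. by apply/funext => i; rewrite /upd; case: (i == j). Qed.

Definition tensor (th : R -> R) (psi : E -> R) : R * E -> R :=
  fun z => th z.1 * psi z.2.

Lemma smooth_tensor th psi : smooth th -> smooth psi -> smooth (tensor th psi).
Proof.
move=> st sp; apply: smoothM.
- exact: (smooth_comp_affine (@is_diff_fst _ _ _) st).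
- exact: (smooth_comp_affine (@is_diff_snd _ _ _) sp).
Qed.

(** [test_fun_time] only looks at t >= 0, so [th] need not vanish near 0; this is how the initial
    data enter the weak equations. *)
Lemma test_fun_time_tensor T th psi (b : R) : smooth th -> test_fun psi -> b < T ->
  (forall t, b < t -> th t = 0) -> test_fun_time T (tensor th psi).
Proof.
move=> st [sp [K [cK pK]]] bT tb; split; first exact: smooth_tensor.
exists (`[0, b]%classic `*` K); split.
- by apply: compact_setX => //; exact: segment_compact.
- move=> [t x]/= [/=]; rewrite !in_itv/= => /andP[t0 tb'] _; split => //=.
  by rewrite t0 (le_lt_trans tb').
- move=> t x t0 nK; rewrite /tensor/=; have [tb'|tb'] := leP t b; last by rewrite tb// mul0r.
  by rewrite pK ?mulr0// => Kx; apply: nK; split => //=; rewrite in_itv/= t0.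
Qed.

Lemma derive_tensor th psi v z : smooth th -> smooth psi ->
  'D_v (tensor th psi) z = th z.1 * 'D_(v.2) psi z.2 + psi z.2 * 'D_(v.1) th z.1.
Proof.
move=> st sp.
have -> : tensor th psi = (th \o fst) * (psi \o snd) by [].
have s1 : smooth (th \o @fst R E) by exact: (smooth_comp_affine (@is_diff_fst _ _ _) st).
have s2 : smooth (psi \o @snd R E) by exact: (smooth_comp_affine (@is_diff_snd _ _ _) sp).
rewrite deriveM; [|exact: smooth_derivable..].
rewrite (derive_comp_affine _ (is_diff_fst z)); last exact: smooth_differentiable.
by rewrite (derive_comp_affine _ (is_diff_snd z)); last exact: smooth_differentiable.
Qed.

Lemma partial_t_tensor th psi : smooth th -> smooth psi ->
  partial_t (tensor th psi) = tensor ('D_1 th) psi.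
Proof.
move=> st sp; apply/funext => z; rewrite /partial_t derive_tensor//=.
by rewrite derive0 mulr0 add0r mulrC.
Qed.

Lemma partial_x_tensor i th psi : smooth th -> smooth psi ->
  partial_x i (tensor th psi) = tensor th (partial i psi).
Proof.
move=> st sp; apply/funext => z; rewrite /partial_x derive_tensor//=.
by rewrite derive0 mulr0 addr0.
Qed.

End test_functions.

(** * Lebesgue integration on the line and on row vectors *)

Section real_integration.
Context d (T : measurableType d) (R : realType) (mu : {measure set T -> \bar R}).
Implicit Types (D : set T) (f g h : T -> R).
Local Notation itg D f := (mu.-integrable D (fun x => (f x)%:E)).

Lemma itg_meas D f : itg D f -> measurable_fun D f.
Proof. by move=> /measurable_int /measurable_EFinP. Qed.

Lemma itgD D f g : measurable D -> itg D f -> itg D g -> itg D (fun x => f x + g x).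
Proof. by move=> mD ? ?; under eq_fun do rewrite EFinD; exact: integrableD. Qed.

Lemma itgB D f g : measurable D -> itg D f -> itg D g -> itg D (fun x => f x - g x).
Proof. by move=> mD ? ?; under eq_fun do rewrite EFinB; exact: integrableB. Qed.

Lemma itgZ D f c : measurable D -> itg D f -> itg D (fun x => c * f x).
Proof. by move=> mD ?; under eq_fun do rewrite EFinM; exact: integrableZl. Qed.

Lemma itg_sum D n (f : 'I_n -> T -> R) : measurable D ->
  (forall i, itg D (f i)) -> itg D (fun x => \sum_i f i x).
Proof.
move=> mD fi; under eq_fun do rewrite -sumEFin.
by apply: integrable_sum.
Qed.

Lemma Rint_sum D n (f : 'I_n -> T -> R) : measurable D ->
  (forall i, itg D (f i)) ->
  \int[mu]_(x in D) (\sum_i f i x) = \sum_i \int[mu]_(x in D) f i x.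
Proof.
move=> mD fi; rewrite /Rintegral; under eq_integral do rewrite -sumEFin.
rewrite integral_sum// -sum_fine//.
by move=> i _; apply: integrable_fin_num.
Qed.

Lemma itg_le D f g : measurable D -> measurable_fun D f ->
  (forall x, D x -> `|f x| <= g x) -> itg D g -> itg D f.
Proof.
move=> mD mf fg ig; apply: le_integrable ig => //; first exact/measurable_EFinP.
by move=> x Dx /=; rewrite lee_fin (le_trans (fg _ Dx))// ler_norm.
Qed.

Lemma itg_bM D h f C : measurable D -> measurable_fun D h ->
  (forall x, D x -> `|h x| <= C) -> itg D f -> itg D (fun x => h x * f x).
Proof.
move=> mD mh hC fi; apply: (@itg_le _ _ (fun x => C * `|f x|)) => //.
- by apply: measurable_funM => //; exact: itg_meas.
- by move=> x Dx; rewrite normrM ler_wpM2r// hC.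
- by apply: itgZ => //; exact: integrable_norm.
Qed.

Lemma itg_abs D f : itg D f -> itg D (fun x => `|f x|).
Proof. exact: integrable_norm. Qed.

Lemma Rint_abs_le D f g : measurable D -> itg D f -> itg D g ->
  (forall x, D x -> `|f x| <= g x) ->
  `|\int[mu]_(x in D) f x| <= \int[mu]_(x in D) g x.
Proof.
move=> mD fi gi fg; apply: le_trans (le_normr_Rintegral mD fi) _.
by apply: le_Rintegral => //; exact: itg_abs.
Qed.

Lemma Rint_cvg D (f_ : nat -> T -> R) f g : measurable D ->
  (forall n, measurable_fun D (f_ n)) ->
  (forall x, D x -> f_ n x @[n --> \oo] --> f x) ->
  itg D g -> (forall n x, D x -> `|f_ n x| <= g x) ->
  itg D f /\ (\int[mu]_(x in D) f_ n x @[n --> \oo] --> \int[mu]_(x in D) f x).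
Proof.
move=> mD mf ff gi fg.
have mfl : measurable_fun D f by exact: (measurable_fun_cvg mf).
have [|||||fi _ cf] := @dominated_convergence _ _ _ mu D mD
  (fun n x => (f_ n x)%:E) (fun x => (f x)%:E) (fun x => (g x)%:E).
- by move=> n; exact/measurable_EFinP.
- exact/measurable_EFinP.
- by apply: aeW => x Dx; apply: cvg_EFin; [exact: nearW|exact: ff].
- exact: gi.
- by apply: aeW => x n Dx; rewrite lee_fin fg.
split => //.
have fin : (\int[mu]_(x in D) (f x)%:E)%E \is a fin_num by exact: integrable_fin_num.
by apply: fine_cvg; rewrite fineK.
Qed.

Lemma Rint_ae_eq D f g : measurable D -> measurable_fun D f -> measurable_fun D g ->
  {ae mu, forall x, D x -> f x = g x} ->
  \int[mu]_(x in D) f x = \int[mu]_(x in D) g x.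
Proof.
move=> mD mf mg fg; congr fine; apply: ae_eq_integral => //; try exact/measurable_EFinP.
by move: fg; apply: filterS => x /= fg Dx; rewrite fg.
Qed.

(** The integral of a nonnegative function is a supremum over the simple functions below it, so
    monotonicity needs no measurability. This serves [Rint_sandwich] and the dissipation integral,
    before measurability in time is established. *)
Lemma ge0_le_integral_nonmeas D (f g : T -> \bar R) :
  (forall x, D x -> 0 <= f x)%E -> (forall x, D x -> f x <= g x)%E ->
  (\int[mu]_(x in D) f x <= \int[mu]_(x in D) g x)%E.
Proof.
move=> f0 fg.
have g0 x : D x -> (0 <= g x)%E by move=> Dx; apply: le_trans (fg _ Dx); exact: f0.
rewrite integral_mkcond [leRHS]integral_mkcond !ge0_integralTE.
- apply: le_ereal_sup => _ [h hf <-]; exists h => // x.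
  apply: le_trans (hf x) _; rewrite !patchE; case: ifPn => // /set_mem; exact: fg.
- by move=> x; rewrite patchE; case: ifPn => // /set_mem; exact: g0.
- by move=> x; rewrite patchE; case: ifPn => // /set_mem; exact: f0.
Qed.

Lemma Rint_le_supp A B (f g : T -> R) : measurable B -> itg B g ->
  (forall t, A t -> 0 <= f t) -> (forall t, B t -> 0 <= g t) ->
  (forall t, A t -> B t -> f t <= g t) -> (forall t, A t -> ~ B t -> f t = 0) ->
  \int[mu]_(t in A) f t <= \int[mu]_(t in B) g t.
Proof.
move=> mB iB f0 g0 fg fs.
have le : (\int[mu]_(t in A) (f t)%:E <= \int[mu]_(t in B) (g t)%:E)%E.
  rewrite integral_mkcond [leRHS]integral_mkcond; apply: ge0_le_integral_nonmeas => t _.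
    by rewrite patchE; case: ifPn => // /set_mem At; rewrite lee_fin f0.
  rewrite !patchE; case: ifPn => [/set_mem At|_]; case: ifPn => [/set_mem Bt|/negP Bt] //.
  - by rewrite lee_fin fg.
  - by rewrite fs// => Bt'; apply: Bt; exact: mem_set.
  - by rewrite lee_fin g0.
have Bfin : (\int[mu]_(t in B) (g t)%:E)%E \is a fin_num by exact: integrable_fin_num.
rewrite /Rintegral fine_le// ge0_fin_numE; last by apply: integral_ge0 => t At; rewrite lee_fin f0.
by apply: le_lt_trans le _; rewrite ltey_eq Bfin.
Qed.

(* [F] need not be measurable: its integral is a difference of lower integrals. *)
Lemma Rint_sandwich D F f g : measurable D -> itg D f -> itg D g ->
  (forall x, D x -> `|F x - f x| <= g x) ->
  `|\int[mu]_(x in D) F x - \int[mu]_(x in D) f x| <= 2 * \int[mu]_(x in D) g x.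
Proof.
move=> mD fi gi Ffg.
(* [key] compares positive parts and loses one integral of [g]; it is used for [F] and for its
   opposite, hence the factor 2. *)
suff key (F' f' : T -> R) : itg D f' -> (forall x, D x -> `|F' x - f' x| <= g x) ->
    let p := fun x => Num.max (F' x) 0 in let q := fun x => Num.max (f' x) 0 in
    (\int[mu]_(x in D) (p x)%:E \is a fin_num)%E /\
    `|\int[mu]_(x in D) p x - \int[mu]_(x in D) q x| <= \int[mu]_(x in D) g x.
  have [p1 p2] := key _ _ fi Ffg.
  have fNi : itg D (fun x => - f x).
    by under eq_fun do rewrite -mulN1r; exact: itgZ.
  have [|q1 q2] := key (fun x => - F x) (fun x => - f x) fNi.
    by move=> x Dx; rewrite -opprD normrN Ffg.
  have dec (h : T -> R) : \int[mu]_(x in D) h x =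
      fine (\int[mu]_(x in D) (Num.max (h x) 0)%:E -
            \int[mu]_(x in D) (Num.max (- h x) 0)%:E)%E.
    rewrite /Rintegral integralE; congr (fine (_ - _)); apply: eq_integral => x _.
      by rewrite funeposE EFin_max.
    by rewrite funenegE EFin_max.
  have maxi (h : T -> R) : itg D h -> itg D (fun x => Num.max (h x) 0).
    move=> hi; apply: (itg_le mD _ _ (itg_abs hi)).
      by apply: measurable_maxr => //; exact: itg_meas.
    move=> x Dx; rewrite ger0_norm ?le_max ?lexx ?orbT//.
    by rewrite ge_max ler_norm normr_ge0.
  have ffin := integrable_fin_num mD (maxi _ fi).
  have fNfin := integrable_fin_num mD (maxi _ fNi).
  rewrite (dec F) (dec f) (fineB p1 q1) (fineB ffin fNfin).
  have arith (a b c e i : R) : `|a - b| <= i -> `|c - e| <= i ->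
      `|(a - c) - (b - e)| <= 2 * i.
    by rewrite !ler_norml => /andP[? ?] /andP[? ?]; apply/andP; split; lra.
  exact: arith p2 q2.
move=> {F f fi Ffg} f'i F'f' p q.
have g0 x : D x -> 0 <= g x by move=> /F'f'; apply: le_trans.
have qi : itg D q.
  apply: (itg_le mD _ _ (itg_abs f'i)).
    by apply: measurable_maxr => //; exact: itg_meas.
  move=> x Dx; rewrite ger0_norm ?le_max ?lexx ?orbT//.
  by rewrite ge_max ler_norm normr_ge0.
have pq x : D x -> p x <= q x + g x /\ q x - g x <= p x.
  move=> Dx; have := F'f' _ Dx; have := g0 _ Dx; rewrite /p /q ler_norml.
  have [?|?] := leP (F' x) 0; have [?|?] := leP (f' x) 0;
    by move=> ? /andP[? ?]; split; lra.
have p0 x : 0 <= p x by rewrite le_max lexx orbT.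
have q0 x : 0 <= q x by rewrite le_max lexx orbT.
have lp : (\int[mu]_(x in D) (p x)%:E <= \int[mu]_(x in D) (q x + g x)%:E)%E.
  apply: ge0_le_integral_nonmeas => x Dx; rewrite lee_fin//.
  by case: (pq _ Dx).
have qgi := itgD mD qi gi.
have pfin : (\int[mu]_(x in D) (p x)%:E \is a fin_num)%E.
  rewrite ge0_fin_numE; last by apply: integral_ge0 => x _; rewrite lee_fin.
  by apply: le_lt_trans lp _; rewrite ltey_eq integrable_fin_num.
split => //.
pose r x := Num.max (q x - g x) 0.
have ri : itg D r.
  apply: (itg_le mD _ _ qi).
    by apply: measurable_maxr => //; apply: measurable_funB; exact: itg_meas.
  move=> x Dx.
  have -> : `|r x| = r x by rewrite ger0_norm// le_max lexx orbT.
  by rewrite /r ge_max q0 andbT; have := g0 _ Dx; lra.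
have lr : (\int[mu]_(x in D) (r x)%:E <= \int[mu]_(x in D) (p x)%:E)%E.
  apply: ge0_le_integral_nonmeas => x Dx; rewrite lee_fin.
    by rewrite le_max lexx orbT.
  by rewrite /r ge_max (p0 x) andbT; case: (pq _ Dx).
have lp' : \int[mu]_(x in D) p x <= \int[mu]_(x in D) q x + \int[mu]_(x in D) g x.
  by rewrite -RintegralD// fine_le// integrable_fin_num.
have lr' : \int[mu]_(x in D) q x - \int[mu]_(x in D) g x <= \int[mu]_(x in D) p x.
  rewrite -RintegralB//; apply: (@le_trans _ _ (\int[mu]_(x in D) r x)).
    apply: le_Rintegral => //; first exact: itgB.
    by move=> x Dx; rewrite /r le_max lexx.
  by rewrite fine_le// integrable_fin_num.
by rewrite ler_norml; apply/andP; split; lra.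
Qed.

End real_integration.

Section lebesgue_rV_theory.
Context {R : realType}.

Lemma measurable_scale_rV d (c : R) : measurable_fun [set: 'rV[R]_d] (fun x => c *: x).
Proof.
apply/measurable_fun_rVP => i; under eq_fun do rewrite mxE.
by apply: measurable_funM => //; exact: measurable_coord.
Qed.

(** The sigma-algebra is the one generated by the coordinates. Rounding each coordinate down to a
    multiple of 1/(n+1) gives measurable maps with countably many values, and f is the pointwise
    limit of its compositions with them. *)
Lemma measurable_fun_continuous_rV d (f : 'rV[R]_d -> R) :
  continuous f -> measurable_fun setT f.
Proof.
move=> cf.
pose k n (x : 'rV[R]_d) : 'rV[int]_d := \row_i Num.floor (x ord0 i * n.+1%:R).
pose g n (v : 'rV[int]_d) : 'rV[R]_d := \row_i ((v ord0 i)%:~R / n.+1%:R).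
apply: (@measurable_fun_cvg _ _ _ _ (fun n x => f (g n (k n x)))).
  move=> n _ Y mY; rewrite setTI.
  pose A (v : 'rV[int]_d) := [set x | k n x = v] `&` [set x | Y (f (g n v))].
  (* The union runs over the grid points, enumerated through [unpickle]; a number that codes no grid
     point contributes the empty set. *)
  rewrite (_ : _ @^-1` Y = \bigcup_m (if unpickle m is Some v then A v else set0)).
    apply: bigcup_measurable => m _.
    case: (unpickle m) => [v|]; last exact: measurable0.
    apply: measurableI; last first.
      have [h|h] := pselect (Y (f (g n v))).
        by rewrite (_ : [set x | _] = setT)//; apply/seteqP; split.
      by rewrite (_ : [set x | _] = set0)//; apply/seteqP; split.
    rewrite (_ : [set x | _] = \bigcap_(i in [set: 'I_d])
      ((fun x : 'rV[R]_d => x ord0 i * n.+1%:R) @^-1`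
         `[(v ord0 i)%:~R, (v ord0 i + 1)%:~R[%classic)).
      apply: fin_bigcap_measurable => [|i _]; first exact: finite_finset.
      rewrite -[X in measurable X]setTI.
      have : measurable_fun [set: 'rV[R]_d] (fun x => x ord0 i * n.+1%:R).
        by apply: measurable_funM => //; exact: measurable_coord.
      by apply => //; exact: measurable_itv.
    apply/seteqP; split => x /=.
      move=> <- i _ /=; rewrite in_itv/= mxE.
      by rewrite floor_le_tmp ?num_real//= floorD1_gt ?num_real.
    move=> h; apply/rowP => i; rewrite mxE; have := h i Logic.I.
    by rewrite /= in_itv/= => hi; apply: floor_def.
  apply/seteqP; split => x /=.
    by move=> Yx; exists (pickle (k n x)) => //; rewrite pickleK.
  by move=> [m _]; case: (unpickle m) => // v [/= -> ].
move=> x _; apply: continuous_cvg; first exact: cf.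
apply/cvgrPdist_lt => e e0; near=> n.
rewrite /Num.Def.normr/= mx_normrE; apply/bigmax_ltP; split => //= -[a i] _ /=.
rewrite ord1 !mxE.
have n0 : 0 < n.+1%:R :> R by rewrite ltr0n.
have -> : x ord0 i - (Num.floor (x ord0 i * n.+1%:R))%:~R / n.+1%:R =
   (x ord0 i * n.+1%:R - (Num.floor (x ord0 i * n.+1%:R))%:~R) / n.+1%:R.
  by rewrite mulrBl mulfK// gt_eqF.
rewrite normrM [X in _ * X]ger0_norm ?invr_ge0 ?ltW//.
apply: (@le_lt_trans _ _ n.+1%:R^-1); last by near: n; exact: (near_infty_natSinv_lt (PosNum e0)).
rewrite ler_piMl ?invr_ge0 ?ltW//.
rewrite ger0_norm ?subr_ge0 ?floor_le_tmp ?num_real//.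
rewrite ltrBlDl.
by have := floorD1_gt (x ord0 i * n.+1%:R); rewrite intrD.
Unshelve. all: by end_near. Qed.

Lemma ge0_integral_cons_rV d (f : 'rV[R]_d.+1 -> \bar R) :
  measurable_fun setT f -> (forall x, 0 <= f x)%E ->
  (\int[lebesgue_rV d.+1]_x f x =
   \int[lebesgue_measure]_a \int[lebesgue_rV d]_u f (cons_rV (a, u)))%E.
Proof.
move=> mf f0.
transitivity (\int[pushforward (@lebesgue_measure R \x lebesgue_rV d)%E (@cons_rV R d)]_x f x)%E.
  by [].
rewrite ge0_integral_pushforward//=; last exact: measurable_cons_rV.
rewrite preimage_setT fubini_tonelli1//=.
by apply: measurableT_comp => //; exact: measurable_cons_rV.
Qed.

Lemma measurable_consl d (f : 'rV[R]_d.+1 -> \bar R) a :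
  measurable_fun setT f -> measurable_fun setT (fun u : 'rV[R]_d => f (cons_rV (a, u))).
Proof.
move=> mf.
apply: (measurableT_comp (f := fun p => f (cons_rV p)) _ (measurable_pair1 a)).
by apply: measurableT_comp => //; exact: measurable_cons_rV.
Qed.

Lemma measurable_int_cons d (f : 'rV[R]_d.+1 -> \bar R) :
  measurable_fun setT f -> (forall x, 0 <= f x)%E ->
  measurable_fun setT (fun a : R => \int[lebesgue_rV d]_u f (cons_rV (a, u)))%E.
Proof.
move=> mf f0.
apply: (@measurable_fun_fubini_tonelli_F _ _ _ _ _ _ (fun p => f (cons_rV p))) => //.
by apply: measurableT_comp => //; exact: measurable_cons_rV.
Qed.

(** c times the image of Lebesgue measure under multiplication by c gives ]a, b] the mass c (b/c -
    a/c) = b - a, so uniqueness identifies it with Lebesgue measure. *)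
Lemma ge0_integral_scale1 (c : R) (f : R -> \bar R) : 0 < c ->
  measurable_fun setT f -> (forall x, 0 <= f x)%E ->
  (\int[@lebesgue_measure R]_x f x =
   c%:E * \int[@lebesgue_measure R]_x f (c * (x : R))%R)%E.
Proof.
move=> c0 mf f0.
pose phi : R -> measurableTypeR R := fun x => c * x.
have mphi : measurable_fun setT phi by exact: mulrl_measurable.
pose nu : {measure set (measurableTypeR R) -> \bar R} :=
  measure_function_pushforward__canonical__measure_function_Measure (@lebesgue_measure R) mphi.
transitivity (\int[mscale (NngNum (ltW c0)) nu]_x f x)%E.
  apply: eq_measure_integral => A mA _.
  apply: lebesgue_measure_unique => //= _ [[a b]] _ <-.
  rewrite /mscale /= /pushforward.
  rewrite (_ : phi @^-1` _ = `]a / c, b / c]%classic); last first.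
    apply/seteqP; split => x; rewrite /phi/= !in_itv/=.
      by rewrite ltr_pdivrMr// ler_pdivlMr// ![_ * c]mulrC.
    by rewrite ltr_pdivrMr// ler_pdivlMr// ![_ * c]mulrC.
  rewrite !lebesgue_measure_itv/= !lte_fin ltr_pM2r ?invr_gt0//.
  case: ifPn => ab; last by rewrite mule0.
  by rewrite -!EFinB -EFinM; congr EFin; field; rewrite gt_eqF.
rewrite ge0_integral_mscale//=.
by rewrite ge0_integral_pushforward//= preimage_setT.
Qed.

(** One factor c per coordinate by Tonelli; in dimension 0 there is a single point and c^0 = 1. *)
Lemma ge0_integral_scale d (c : R) (f : 'rV[R]_d -> \bar R) : 0 < c ->
  measurable_fun setT f -> (forall x, 0 <= f x)%E ->
  (\int[lebesgue_rV d]_x f x = (c ^+ d)%:E * \int[lebesgue_rV d]_x f (c *: x))%E.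
Proof.
move=> c0; elim: d f => [|d ih] f mf f0.
  rewrite expr0 mul1e; apply: eq_integral => x _.
  by congr f; apply/matrixP => i [].
have mfc : measurable_fun setT (fun x : 'rV[R]_d.+1 => f (c *: x)).
  by apply: measurableT_comp => //; exact: measurable_scale_rV.
rewrite !ge0_integral_cons_rV//.
rewrite (ge0_integral_scale1 c0); last 2 first.
- exact: measurable_int_cons mf _.
- by move=> a; exact: integral_ge0.
rewrite exprS EFinM -muleA; congr (_ * _)%E.
rewrite -ge0_integralZl//; last 3 first.
- exact: (measurable_int_cons mfc).
- by move=> a _; exact: integral_ge0.
- by rewrite lee_fin exprn_ge0// ltW.
apply: eq_integral => a _; rewrite ih//; last exact: measurable_consl.
congr (_ * _)%E; apply: eq_integral => u _; congr f.
apply/rowP => i; rewrite [RHS]mxE; have [j ->|->] := unliftP ord0 i.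
  by rewrite !cons_rVS mxE.
by rewrite !cons_rV0.
Qed.

Lemma measurable_prodf d (f : 'I_d -> R -> R) : (forall i, measurable_fun setT (f i)) ->
  measurable_fun setT (prodf f).
Proof.
move=> mf; rewrite /prodf.
elim: (index_enum _) => [|i s ih].
  by under eq_fun do rewrite big_nil; exact: measurable_cst.
under eq_fun do rewrite big_cons.
apply: measurable_funM => //.
exact: (measurableT_comp (mf i) (measurable_coord i)).
Qed.

Lemma ge0_integral_prodf d (f : 'I_d -> R -> R) :
  (forall i, measurable_fun setT (f i)) -> (forall i x, 0 <= f i x) ->
  (\int[lebesgue_rV d]_x (prodf f x)%:E =
   \prod_i \int[lebesgue_measure]_x (f i x)%:E)%E.
Proof.
elim: d f => [|d ih] f mf f0.
  rewrite big_ord0 /= (eq_integral (cst 1%E)); last first.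
    by move=> x _; rewrite /prodf big_ord0.
  rewrite integral_cst// mul1e.
  by rewrite /= diracT.
have p0 (x : 'rV[R]_d.+1) : 0 <= prodf f x by rewrite prodr_ge0.
rewrite ge0_integral_cons_rV//; last first.
  by apply/measurable_EFinP; exact: measurable_prodf.
have E a u : (prodf f (cons_rV (a, u)))%:E =
    ((f ord0 a)%:E * (prodf (fun i => f (lift ord0 i)) u)%:E)%E.
  rewrite /prodf big_ord_recl cons_rV0 EFinM; congr (_ * _%:E)%E.
  by apply: eq_bigr => i _; rewrite cons_rVS.
have pl0 (u : 'rV[R]_d) : 0 <= prodf (fun i => f (lift ord0 i)) u by rewrite prodr_ge0.
under eq_integral do under eq_integral do rewrite E.
under eq_integral => a _.
  rewrite ge0_integralZl ?lee_fin//; last 2 first.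
  - by apply/measurable_EFinP; apply: measurable_prodf.
  - by move=> x _; rewrite lee_fin.
  rewrite ih//.
  over.
rewrite big_ord_recl.
rewrite ge0_integralZr//.
- by apply/measurable_EFinP; exact: mf.
- by move=> x _; rewrite lee_fin.
- by rewrite prode_ge0// => i _; apply: integral_ge0 => x _; rewrite lee_fin.
Qed.

End lebesgue_rV_theory.

Section bump.
Context {R : realType}.
Implicit Types (a b x : R) (n : nat).

(** Positive exactly on ]a, b[. As n grows the two flat factors tend to the indicators of x > a and
    x < b, so products of bumps approximate indicators of open boxes. *)
Definition bump n a b x : R :=
  flat 0 (n.+1%:R * (x - a)) * flat 0 (n.+1%:R * (b - x)).

Lemma bump_ge0 n a b x : 0 <= bump n a b x.
Proof. by rewrite mulr_ge0// flat_ge0. Qed.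

Lemma bump_le1 n a b x : bump n a b x <= 1.
Proof. by rewrite mulr_ile1 ?flat_ge0 ?flat0_le1. Qed.

Lemma bump_out n a b x : ~~ (a < x < b) -> bump n a b x = 0.
Proof.
rewrite negb_and -!leNgt /bump => /orP[xa|bx].
  by rewrite flat_le0 ?mul0r// pmulr_rle0// subr_le0.
by rewrite mulrC flat_le0 ?mul0r// pmulr_rle0// subr_le0.
Qed.

Lemma bump_gt0 n a b x : a < x < b -> 0 < bump n a b x.
Proof.
by move=> /andP[ax xb]; rewrite mulr_gt0// flat_gt0// mulr_gt0// subr_gt0.
Qed.

Lemma smooth_bump n a b : smooth (bump n a b).
Proof.
apply: smoothM.
  under eq_fun do rewrite mulrBr.
  exact: (@smooth_affineR _ _ _ (flat 0)) (smooth_flat 0).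
under eq_fun do rewrite mulrBr addrC -mulNr.
exact: (@smooth_affineR _ _ _ (flat 0)) (smooth_flat 0).
Qed.

Lemma test1_bump n a b : test1 (bump n a b).
Proof.
split; first exact: smooth_bump.
exists (Num.max `|a| `|b|) => x; rewrite ge_max => /andP[ax bx].
apply: bump_out; apply/negP => /andP[xa xb].
have := ler_norm b; have := ler_norm (- a); rewrite normrN.
by have [x0|x0] := leP 0 x;
  [move: bx; rewrite (ger0_norm x0)|move: ax; rewrite (ltr0_norm x0)]; lra.
Qed.

Lemma cvg_bump a b x : bump n a b x @[n --> \oo] --> ((a < x < b)%R%:R : R).
Proof.
rewrite -mulnb natrM; apply: cvgM.
  by have := @cvg_flat0 _ (x - a); rewrite subr_gt0.
by have := @cvg_flat0 _ (b - x); rewrite subr_gt0.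
Qed.

End bump.

(** * A functional monotone class theorem on row vectors *)

Section bounded_measurable_ind.
Context {R : realType} {d : nat}.
Local Notation E := 'rV[R]_d.

Lemma cvg_prodf (f_ : nat -> 'I_d -> R -> R) (f : 'I_d -> R -> R) (x : E) :
  (forall i, f_ n i (x ord0 i) @[n --> \oo] --> f i (x ord0 i)) ->
  prodf (f_ n) x @[n --> \oo] --> prodf f x.
Proof.
move=> ff; rewrite /prodf; elim: (index_enum _) => [|i s ih].
  by rewrite big_nil; under eq_fun do rewrite big_nil; exact: cvg_cst.
rewrite big_cons; under eq_fun do rewrite big_cons.
exact: cvgM (ff i) ih.
Qed.

Lemma prodf_ge0 (f : 'I_d -> R -> R) (x : E) :
  (forall i x, 0 <= f i x) -> 0 <= prodf f x.
Proof. by move=> f0; rewrite prodr_ge0. Qed.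

Lemma prodf_le1 (f : 'I_d -> R -> R) (x : E) :
  (forall i x, 0 <= f i x <= 1) -> prodf f x <= 1.
Proof.
by move=> f0; rewrite /prodf; apply: prodr_ile1 => i _.
Qed.

Definition obox (a b : 'I_d -> R) : set E :=
  [set x | forall i, a i < x ord0 i < b i].

Lemma indic_obox a b (x : E) :
  \1_(obox a b) x = prodf (fun i y => ((a i < y < b i)%R%:R : R)) x.
Proof.
rewrite indicE; have [h|h] := pselect (obox a b x).
  by rewrite mem_set// /prodf big1// => i _; rewrite h.
rewrite memNset//; move/existsNP : h => [i /negP/negPf hi].
by rewrite /prodf (bigD1 i)//= hi mul0r.
Qed.

Lemma measurable_obox a b : measurable (obox a b).
Proof.
rewrite (_ : obox a b = \bigcap_(i in [set: 'I_d])
  ((fun x : E => x ord0 i) @^-1` `]a i, b i[%classic)).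
  apply: fin_bigcap_measurable => [|i _]; first exact: finite_finset.
  by rewrite -[X in measurable X]setTI; exact: measurable_coord.
apply/seteqP; split => x /=.
  by move=> h i _ /=; rewrite in_itv/= h.
by move=> h i; have := h i Logic.I; rewrite /= in_itv.
Qed.

Let G : set (set E) := [set A | exists a b, A = obox a b].

(** A half-space x_i > r is the union of the open boxes with side ]r, n[ in direction i and ]-n, n[
    in the others, so the boxes generate the coordinate sigma-algebra. *)
Lemma measurable_rV_obox : @measurable _ E = <<s G >>.
Proof.
apply/seteqP; split; last first.
  apply: smallest_sub; first exact: sigma_algebra_measurable.
  by move=> _ [a [b ->]]; exact: measurable_obox.
pose T := g_sigma_algebraType G.
apply: smallest_sub; first exact: smallest_sigma_algebra.
move=> A; rewrite -bigcup_seq/= => -[i _ [Y mY <-]].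
have : measurable_fun setT (fun x : T => (x : E) ord0 i).
  apply: (measurability _ (RGenOInfty.measurableE R)) => _ [_ [r ->] <-]; rewrite setTI.
  rewrite (_ : _ @^-1` _ = \bigcup_n
    (obox (fun j => if j == i then r else - n%:R) (fun=> n%:R) : set T)).
    apply: bigcup_measurable => n _; apply: sub_sigma_algebra.
    by eexists; eexists.
  apply/seteqP; split => x /=; rewrite in_itv/= andbT.
    move=> rx.
    pose M := \big[Num.max/0]_j `|(x : E) ord0 j|.
    exists (Num.truncn M).+1 => // j.
    have xM : `|(x : E) ord0 j| < (Num.truncn M).+1%:R.
      apply: (@le_lt_trans _ _ M); first exact: (le_bigmax_cond _ (fun j => `|(x : E) ord0 j|)).
      exact: truncnS_gt.
    move: xM; rewrite ltr_norml => /andP[xM1 xM2].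
    by case: (j =P i) => [ji|_]; rewrite ?ji ?rx//= ?xM1 ?xM2// -ji.
  by move=> [n _] /(_ i); rewrite eqxx => /andP[].
by move=> /(_ measurableT _ mY).
Qed.

Context (P : (E -> R) -> Prop)
  (P_bump : forall n a b, P (prodf (fun i => bump n (a i) (b i))))
  (P_lin : forall (f g : E -> R) (c C : R),
    measurable_fun setT f -> (forall x, `|f x| <= C) ->
    measurable_fun setT g -> (forall x, `|g x| <= C) ->
    P f -> P g -> P (fun x => f x + c * g x))
  (P_lim : forall (f_ : nat -> E -> R) (f : E -> R) (C : R),
    (forall n, measurable_fun setT (f_ n)) ->
    (forall n x, `|f_ n x| <= C) -> (forall x, f_ n x @[n --> \oo] --> f x) ->
    (forall n, P (f_ n)) -> P f).

Let norm_indic (A : set E) x : `|\1_A x| <= 1 :> R.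
Proof. by rewrite indicE; case: (_ \in _); rewrite ?normr1 ?normr0. Qed.

Let P_obox a b : P \1_(obox a b).
Proof.
apply: (P_lim (f_ := fun n => prodf (fun i => bump n (a i) (b i))) (C := 1)) => //.
- move=> n; apply: measurable_prodf => i.
  apply: continuous_measurable_fun; apply: smooth_continuous; exact: smooth_bump.
- move=> n x; rewrite ger0_norm; first by apply: prodf_le1 => i y; rewrite bump_ge0 bump_le1.
  by apply: prodf_ge0 => i y; exact: bump_ge0.
- by move=> x; rewrite indic_obox; apply: cvg_prodf => i; exact: cvg_bump.
Qed.

Let P_T : P \1_setT.
Proof.
apply: (P_lim (f_ := fun n => \1_(obox (fun=> - n%:R) (fun=> n%:R))) (C := 1)) => //.
- by move=> n; apply: measurable_indic; exact: measurable_obox.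
- move=> x; apply: cvg_near_cst.
  pose M := \big[Num.max/0]_j `|x ord0 j|.
  exists (Num.truncn M).+1 => // n /= Mn.
  rewrite indicT indicE mem_set// => j /=.
  rewrite -ltr_norml; apply: (@lt_le_trans _ _ (Num.truncn M).+1%:R); last by rewrite ler_nat.
  apply: (@le_lt_trans _ _ M); first exact: (le_bigmax_cond _ (fun j => `|x ord0 j|)).
  exact: truncnS_gt.
Qed.

(** Dynkin's argument: open boxes are stable under intersection, and the measurable sets whose
    indicator satisfies [P] are stable under complement and disjoint countable union, the partial
    unions being bounded and pointwise convergent. *)
Lemma bounded_measurable_indic A : measurable A -> P \1_A.
Proof.
move=> mA.
have P_C B : measurable B -> P \1_B -> P \1_(~` B).
  move=> mB PB.
  rewrite (_ : \1_(~` B) = fun x => \1_setT x + (-1) * \1_B x).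
    by apply: (@P_lin _ _ _ (1)) => //; exact: measurable_indic.
  apply/funext => x; rewrite !indicE in_setC in_setT/=.
  by case: (x \in B); rewrite /= ?mulr1 ?mulr0 ?addr0 ?subrr.
apply: (dynkin_induction measurable_rV_obox (P := fun A => P \1_A)) => //.
- move=> _ _ [a1 [b1 ->]] [a2 [b2 ->]].
  exists (fun i => Num.max (a1 i) (a2 i)), (fun i => Num.min (b1 i) (b2 i)).
  apply/seteqP; split => x /=.
    by move=> [h1 h2] i; rewrite gt_max lt_min; have /andP[-> ->] := h1 i; have /andP[-> ->] := h2 i.
  move=> h; split => i; have := h i; rewrite gt_max lt_min => /andP[/andP[? ?] /andP[? ?]].
    by apply/andP.
  by apply/andP.
- by move=> _ [a [b ->]].
- move=> F mF tF PF.
  pose U n := \big[setU/set0]_(i < n) F i.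
  have mU n : measurable (U n) by exact: bigsetU_measurable.
  apply: (P_lim (f_ := fun n => \1_(U n)) (C := 1)) => //.
  + move=> x; apply: cvg_near_cst.
    have [[k _ Fkx]|nF] := pselect ((\bigcup_k F k) x).
      exists k.+1 => // n /= kn; rewrite !indicE !mem_set//; first by exists k.
      by rewrite /U -bigcup_mkord; exists k.
    exists 0 => // n _; rewrite !indicE !memNset//.
    by rewrite /U -bigcup_mkord => -[k _ Fk]; apply: nF; exists k.
  + elim => [|n ih].
      by rewrite /U big_ord0 -setCT; exact: P_C.
    rewrite (_ : \1_(U n.+1) = fun x => \1_(U n) x + 1 * \1_(F n) x).
      by apply: (@P_lin _ _ _ (1)) => //; exact: measurable_indic.
    apply/funext => x; rewrite mul1r /U big_ord_recr/= -/(U n).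
    rewrite !indicE in_setU.
    have [Fx|Fx] := pselect (F n x); last by rewrite (memNset Fx) orbF addr0.
    rewrite (mem_set Fx) orbT (memNset (A := U n)) ?add0r// /U -bigcup_mkord => -[k /= kn Fk].
    have := (trivIsetP.1 tF) k n Logic.I Logic.I; rewrite lt_eqF// => /(_ isT) /seteqP[+ _].
    by move=> /(_ x); apply.
- by rewrite -measurable_rV_obox.
Qed.

(** Functional monotone class theorem, used once for the uniqueness of weak gradients and once for
    weak convergence. Indicators yield functions with values in [0, 1] through binary expansions,
    and an affine change yields the rest. *)
Lemma bounded_measurable_ind (f : E -> R) (C : R) :
  measurable_fun setT f -> (forall x, `|f x| <= C) -> P f.
Proof.
have unit_case (g : E -> R) : measurable_fun setT g -> (forall x, 0 <= g x <= 1) -> P g.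
  move=> mg g01.
  pose c n : R := 2^-1 ^+ n.+1.
  (* Greedy binary expansion of g: at each stage the next digit is added where it still fits, so 0
     <= g - h_n <= 2^(-n), and h_n is a finite combination of indicators. *)
  pose h := fix h n : E -> R := if n is m.+1 then
    fun x => h m x + c m * \1_[set x | c m <= g x - h m x] x else fun=> 0.
  have mh n : measurable_fun setT (h n).
    elim: n => [|n ih] /=; first exact: measurable_cst.
    apply: measurable_funD => //; apply: measurable_funM => //.
    apply: measurable_indic.
    rewrite -[X in measurable X]setTI; apply: measurable_fun_ler => //.
    exact: measurable_funB.
  have hb n x : 0 <= g x - h n x <= 2^-1 ^+ n.
    elim: n => [|n /andP[ih1 ih2]] /=; first by rewrite expr0 subr0.
    have E2 : 2^-1 ^+ n = c n + c n.
      by rewrite /c exprS; field.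
    rewrite indicE; have [hc|hc] := pselect (c n <= g x - h n x).
      rewrite mem_set// mulr1; move: ih2; rewrite E2 -/(c n); move: hc; lra.
    rewrite memNset// mulr0 addr0 ih1/= -/(c n); apply/ltW.
    by rewrite ltNge; apply/negP.
  have hb1 n x : `|h n x| <= 1.
    have /andP[h1 h2] := hb n x; have /andP[g1 g2] := g01 x.
    have hn0 : 0 <= h n x.
      by elim: n {h1 h2} => //= n ih; rewrite addr_ge0// mulr_ge0// ?exprn_ge0// indicE.
    rewrite ger0_norm//; lra.
  apply: (P_lim (f_ := h) (C := 1)) => //.
    move=> x; apply/cvgrPdist_le => e e0.
    have : 2^-1 ^+ n @[n --> \oo] --> (0 : R).
      by apply: cvg_expr; rewrite ger0_norm ?invr_ge0// invf_lt1// ltr1n.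
    move/cvgr0Pnorm_le => /(_ _ e0); apply: filterS => n hn.
    have /andP[h1 h2] := hb n x.
    rewrite ger0_norm// (le_trans h2)//.
    by apply: le_trans hn; exact: ler_norm.
  elim => [|n ih] /=.
    rewrite (_ : (fun=> 0) = fun x => \1_setT x + (-1) * \1_setT x).
      by apply: (@P_lin _ _ _ (1)) => //; exact: measurable_indic.
    by apply/funext => x; rewrite mulN1r subrr.
  have mA : measurable [set x | c n <= g x - h n x].
    rewrite -[X in measurable X]setTI; apply: measurable_fun_ler => //.
    exact: measurable_funB.
  by apply: (@P_lin _ _ _ (1)) => //; exact: bounded_measurable_indic.
move=> mf fC.
have C0 : 0 <= C by apply: le_trans (fC 0).
pose K := C + C + 1.
have K0 : 0 < K by rewrite /K; lra.
pose g (x : E) : R := (f x + C) / K.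
have mg : measurable_fun setT g.
  by apply: measurable_funM => //; exact: measurable_funD.
have g01 x : 0 <= g x <= 1.
  have := fC x; rewrite ler_norml => /andP[? ?].
  rewrite /g; apply/andP; split; first by apply: divr_ge0; [lra|exact: ltW].
  by rewrite ler_pdivrMr// mul1r /K; lra.
have Pg := unit_case _ mg g01.
have Pk : P (fun x => K * g x).
  (* [P_lin] only provides f + c g, so K g is reached from the zero function g - g. *)
  rewrite (_ : (fun x => _) = fun x => (g x + (-1) * g x) + K * g x).
    apply: (@P_lin _ _ _ (1)) => //.
    - by under eq_fun do rewrite mulN1r subrr; exact: measurable_cst.
    - by move=> x; rewrite mulN1r subrr normr0.
    - by move=> x; have /andP[? ?] := g01 x; rewrite ger0_norm.
    - apply: (@P_lin _ _ _ (1)) => //; by move=> x; have /andP[? ?] := g01 x; rewrite ger0_norm.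
  by apply/funext => x; rewrite mulN1r subrr add0r.
rewrite (_ : f = fun x => K * g x + (- C) * \1_setT x).
  apply: (@P_lin _ _ _ (K + 1)) => //.
  - exact: measurable_funM.
  - move=> x; have /andP[? ?] := g01 x.
    rewrite normrM (ger0_norm (ltW K0)) ger0_norm//.
    by rewrite (@le_trans _ _ K) ?lerDl// ler_piMr// ltW.
  - by move=> x; rewrite (le_trans (norm_indic _ _))// lerDr ltW.
by apply/funext => x; rewrite indicT/= mulr1 /g mulrC divfK ?gt_eqF// addrK.
Qed.

End bounded_measurable_ind.

(** * Weak gradients and one-variable calculus *)

Section weak_gradient.
Context {R : realType} {d : nat}.
Local Notation E := 'rV[R]_d.
Local Notation mu := (lebesgue_rV d).
Local Notation itg f := (mu.-integrable setT (fun x => (f x)%:E)).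

Lemma test_fun_measurable (phi : E -> R) : test_fun phi -> measurable_fun setT phi.
Proof. by move=> [sp _]; apply: measurable_fun_continuous_rV; exact: smooth_continuous. Qed.

Definition cbox (M : R) : set E := [set x | forall i, - M <= x ord0 i <= M].

Lemma compact_cbox M : compact (cbox M).
Proof.
rewrite (_ : cbox M = [set x : E | forall i, `[- M, M]%classic (x ord0 i)]).
  apply: (@rV_compact R d (fun=> `[- M, M]%classic)) => _; exact: segment_compact.
by apply/seteqP; split => x /= h i; have := h i; rewrite /= in_itv.
Qed.

Lemma measurable_cbox M : measurable (cbox M).
Proof.
rewrite (_ : cbox M = \bigcap_(i in [set: 'I_d])
  ((fun x : E => x ord0 i) @^-1` `[- M, M]%classic)).
  apply: fin_bigcap_measurable => [|i _]; first exact: finite_finset.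
  by rewrite -[X in measurable X]setTI; exact: measurable_coord.
apply/seteqP; split => x /=.
  by move=> h i _ /=; rewrite in_itv/= h.
by move=> h i; have := h i Logic.I; rewrite /= in_itv.
Qed.

Lemma test_fun_cbox (phi : E -> R) : test_fun phi ->
  exists M, forall x, ~ cbox M x -> phi x = 0.
Proof.
move=> [_ [K [cK pK]]].
have [M [Mr hM]] := compact_bounded cK.
exists (M + 1) => x nx; apply: pK => Kx; apply: nx => i.
have := hM (M + 1) _ x Kx; rewrite ltrDl => /(_ ltr01) /= xM.
rewrite -ler_norml; apply: le_trans xM.
rewrite [leRHS]/Num.Def.normr/= mx_normrE.
exact: (le_bigmax_cond _ (fun ij : 'I_1 * 'I_d => `|x ij.1 ij.2|) (j := (ord0, i))).
Qed.

Definition cbox_integrable (g : E -> R) : Prop :=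
  measurable_fun setT g /\ forall M, mu.-integrable (cbox M) (fun x => (g x)%:E).

Lemma loc_integrable_cbox (g : E -> R) : loc_integrable g -> cbox_integrable g.
Proof. by move=> [mg ig]; split => // M; apply: ig; exact: compact_cbox. Qed.

Lemma cbox_integrableB (g h : E -> R) : cbox_integrable g -> cbox_integrable h ->
  cbox_integrable (fun x => g x - h x).
Proof.
move=> [mg ig] [mh ih]; split; first exact: measurable_funB.
by move=> M; apply: itgB => //; exact: measurable_cbox.
Qed.

Lemma cbox_integrable_test (g phi : E -> R) : cbox_integrable g -> test_fun phi ->
  itg (fun x => g x * phi x).
Proof.
move=> [mg ig] tp; have [M hM] := test_fun_cbox tp.
have [C C0 hC] := test_fun_bounded tp.
rewrite (_ : (fun x => _) = (fun x => (g x * phi x)%:E) \_ (cbox M)); last first.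
  apply/funext => x; rewrite patchE; case: ifPn => // /negP nx.
  by rewrite hM ?mulr0// => h; apply: nx; rewrite inE.
apply/(integrable_mkcond _ (measurable_cbox M)).
under eq_fun do rewrite mulrC.
apply: (@itg_bM _ _ _ _ _ _ _ C); [exact: measurable_cbox| |by []|].
- exact: measurable_funTS (test_fun_measurable tp).
- exact: ig.
Qed.

(** A bump times [chi n] is again a test function, so the integrable function h = g [chi n] is
    orthogonal to all product bumps, hence by the monotone class theorem to every bounded measurable
    function, in particular to its own sign. *)
Lemma du_bois_reymond (g : E -> R) : cbox_integrable g ->
  (forall phi, test_fun phi -> \int[mu]_x (g x * phi x) = 0) ->
  {ae mu, forall x, g x = 0}.
Proof.
move=> lg g0; have [mg _] := lg.
pose chi n : E -> R := prodf (fun=> bump 0 (- n%:R) n%:R).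
have tchi n : test_fun (chi n) by apply: test_prodf => i; exact: test1_bump.
have gchi n : itg (fun x => g x * chi n x) by exact: cbox_integrable_test.
(* Each point lies where [chi n] is positive once n is large, and there the product vanishes only
   with g. *)
suff ae0 n : {ae mu, forall x, g x * chi n x = 0}.
  have := ae_foralln ae0; apply: filterS => x /= h.
  pose M := \big[Num.max/0]_j `|x ord0 j|.
  have := h (Num.truncn M).+1; move/eqP; rewrite mulf_eq0 => /orP[/eqP//|].
  suff /gt_eqF -> : 0 < chi (Num.truncn M).+1 x by [].
  apply: prodr_gt0 => i _; apply: bump_gt0; rewrite -ltr_norml.
  apply: (@le_lt_trans _ _ M); first exact: (le_bigmax_cond _ (fun j => `|x ord0 j|)).
  exact: truncnS_gt.
set h := fun x => g x * chi n x.
have ih : itg h by exact: gchi.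
have mh := itg_meas ih.
have P (f : E -> R) (C : R) : measurable_fun setT f -> (forall x, `|f x| <= C) ->
    \int[mu]_x (f x * h x) = 0.
  apply: (bounded_measurable_ind (P := fun f => \int[mu]_x (f x * h x) = 0)).
  - move=> k a b; rewrite -[RHS](g0 (fun x => prodf (fun i => bump k (a i) (b i)) x * chi n x)).
      by apply: eq_Rintegral => x _; rewrite /h mulrCA.
    apply: test_funM => //; apply: smooth_prodf => i; exact: smooth_bump.
  - move=> f1 f2 c C' mf1 f1C mf2 f2C i1 i2.
    under eq_Rintegral do rewrite mulrDl -mulrA.
    have j1 : itg (fun x => f1 x * h x) by apply: (@itg_bM _ _ _ _ _ _ _ C').
    have j2 : itg (fun x => f2 x * h x) by apply: (@itg_bM _ _ _ _ _ _ _ C').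
    rewrite RintegralD//; last exact: itgZ.
    by rewrite RintegralZl// i1 i2 mulr0 addr0.
  - move=> f_ f' C' mf_ f_C cf f_0.
    have [] := @Rint_cvg _ _ _ mu setT (fun k x => f_ k x * h x) (fun x => f' x * h x)
      (fun x => C' * `|h x|) measurableT.
    + by move=> k; exact: measurable_funM.
    + by move=> x _; apply: cvgM; [exact: cf|exact: cvg_cst].
    + by apply: itgZ => //; exact: itg_abs.
    + by move=> k x _; rewrite normrM ler_wpM2r.
    move=> _; under eq_fun do rewrite f_0; move=> h0.
    by apply/esym; apply: (cvg_unique _ _ h0) => //; exact: cvg_cst.
pose s x : R := if 0 <= h x then 1 else -1.
have ms : measurable_fun setT s.
  apply: measurable_fun_ifT => //; exact: measurable_fun_ler.
have s1 x : `|s x| <= 1 by rewrite /s; case: ifP; rewrite ?normrN normr1.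
have sh x : s x * h x = `|h x|.
  rewrite /s; have [h0|h0] := leP 0 (h x).
    by rewrite mul1r ger0_norm.
  by rewrite mulN1r ltr0_norm.
have := P _ _ ms s1; under eq_Rintegral do rewrite sh.
move=> I0.
have : (\int[mu]_x `|(h x)%:E| = 0)%E.
  have fin : (\int[mu]_x (`|h x|)%:E)%E \is a fin_num.
    by apply: integrable_fin_num => //; exact: itg_abs.
  by rewrite -[LHS](fineK fin); congr EFin.
move/(ae_eq_integral_abs mu measurableT) => H.
have /H : measurable_fun setT (fun x => (h x)%:E) by exact/measurable_EFinP.
by apply: filterS => x /= /(_ Logic.I) [].
Qed.

Lemma Lfun2_meas (f : E -> R) : f \in Lfun mu 2%:E -> measurable_fun setT f.
Proof. by move=> /sub_Lfun_mfun; rewrite inE. Qed.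

Lemma Lfun2_sqr (f : E -> R) : f \in Lfun mu 2%:E -> itg (fun x => f x ^+ 2).
Proof. exact: Lfun2_integrable_sqr. Qed.

Lemma Lfun2_mul (f g : E -> R) : f \in Lfun mu 2%:E -> g \in Lfun mu 2%:E ->
  itg (fun x => f x * g x).
Proof. by move=> hf hg; have /Lfun1_integrable := Lfun2_mul_Lfun1 hf hg. Qed.

(** [H1] provides some weak gradient in L^2, whereas [wgrad] is a chosen one. By [du_bois_reymond]
    the two agree almost everywhere, so the chosen one is square integrable too. *)
Lemma H1_wgrad (f : E -> R) : H1 f -> is_weak_grad f (wgrad f) /\
  forall i, itg (fun x => wgrad f x ord0 i ^+ 2).
Proof.
move=> [f2 [G [wG G2]]].
have ww : is_weak_grad f (wgrad f) by apply: (xgetPex (cst 0)); exists G.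
split => // i.
have [lf lG hG] := wG; have [_ lw hw] := ww.
have mw := (lw i).1.
have G2i := Lfun2_sqr (G2 i).
suff ae0 : {ae mu, forall x, coordf (wgrad f) i x - coordf G i x = 0}.
  apply/integrableP; split.
    by apply/measurable_EFinP; apply: (measurable_funX 2).
  have /integrableP[_] := G2i; apply: le_lt_trans.
  apply: ae_ge0_le_integral => //.
  - by apply: measurableT_comp => //; apply/measurable_EFinP; apply: (measurable_funX 2).
  - apply: measurableT_comp => //; apply/measurable_EFinP; apply: (measurable_funX 2).
    exact: (lG i).1.
  - by move: ae0; apply: filterS => x /= /eqP; rewrite subr_eq0 => /eqP wx _; rewrite -wx.
apply: du_bois_reymond.
  by apply: cbox_integrableB; exact: loc_integrable_cbox.
move=> phi tp.
under eq_Rintegral do rewrite mulrBl.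
rewrite RintegralB//; [|by apply: cbox_integrable_test => //; exact: loc_integrable_cbox..].
by move: (hw i phi tp); rewrite hG// => /oppr_inj ->; rewrite subrr.
Qed.

End weak_gradient.

Section calculus1.
Context {R : realType}.
Local Notation leb := (@lebesgue_measure R).
Local Notation itg1 f := (leb.-integrable setT (fun x => (f x)%:E)).

Lemma is_derive1_derive (F : R -> R) x f v : is_derive x (1 : R) F f ->
  differentiable F x /\ 'D_v F x = v * f.
Proof.
move=> dF; have dFx : differentiable F x.
  by apply/derivable1_diffP; have [] := dF.
split => //; rewrite deriveE// diff1E// derive1E (@derive_val _ _ _ _ _ _ _ dF).
by [].
Qed.

Lemma smooth_primitive (F f : R -> R) : smooth f ->
  (forall x, is_derive x (1 : R) F (f x)) -> smooth F.
Proof.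
move=> sf dF.
apply: (@smooth_ind _ _ (fun g => g = F \/ smooth g)); last by left.
move=> g [->|sg]; split=> [x|v].
- by have [] := is_derive1_derive 1 (dF x).
- right; rewrite (_ : 'D_v F = fun x => v * f x); first exact: smoothZ.
  by apply/funext => x; have [_ ->] := is_derive1_derive v (dF x).
- exact: smooth_differentiable.
- by right; exact: smooth_derive.
Qed.

Lemma smooth_is_derive (f : R -> R) x : smooth f -> is_derive x (1 : R) f ('D_1 f x).
Proof. by move=> sf; apply: derivableP; exact: smooth_derivable. Qed.

Lemma Rint_FTC (F f : R -> R) (a b : R) : a < b ->
  (forall x, is_derive x (1 : R) F (f x)) -> continuous f ->
  \int[leb]_(x in `[a, b]) f x = F b - F a.
Proof.
move=> ab dF cf.
have cF x : {for x, continuous F}.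
  by apply: differentiable_continuous; have [] := is_derive1_derive 1 (dF x).
rewrite /Rintegral (continuous_FTC2 (F := F) ab).
- by [].
- exact: continuous_subspaceT.
- split.
  + by move=> x _; have [] := dF x.
  + by apply: cvg_at_right_filter; exact: cF.
  + by apply: cvg_at_left_filter; exact: cF.
- by move=> x _; rewrite derive1E (@derive_val _ _ _ _ _ _ _ (dF x)).
Qed.

Lemma itg1_continuous (f : R -> R) (a b : R) : continuous f ->
  leb.-integrable `[a, b] (fun x => (f x)%:E).
Proof.
move=> cf; apply: continuous_compact_integrable; first exact: segment_compact.
exact: continuous_subspaceT.
Qed.

Lemma itg1_cst (a b c : R) : leb.-integrable `[a, b] (fun _ => c%:E).
Proof. by apply: itg1_continuous => x; exact: cst_continuous. Qed.

Lemma smooth_bounded_itv (f : R -> R) (a b : R) : smooth f ->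
  exists C, forall x, a <= x <= b -> `|f x| <= C.
Proof.
move=> sf; have [ab|ab] := leP a b; last first.
  by exists 0 => x /andP[ax xb]; have := le_lt_trans (le_trans ax xb) ab; rewrite ltxx.
have cf : {within `[a, b], continuous (fun x => `|f x|)}.
  apply: continuous_subspaceT => x; apply: continuous_comp.
    exact: smooth_continuous.
  exact: norm_continuous.
have [c _ hc] := EVT_max ab cf.
by exists `|f c| => x xab; apply: hc; rewrite in_itv.
Qed.

Lemma Rint_oo_cc (f : R -> R) (a b : R) : leb.-integrable `[a, b] (fun x => (f x)%:E) ->
  \int[leb]_(x in `]a, b[) f x = \int[leb]_(x in `[a, b]) f x.
Proof.
move=> fi; rewrite Rintegral_itv_obnd_cbnd; last first.
  by apply: integrableS fi => //; exact: subset_itv_oo_cc.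
rewrite Rintegral_itv_bndo_bndc//; apply: integrableS fi => //.
by move=> x; rewrite /= !in_itv/= => /andP[-> /ltW ->].
Qed.

Lemma is_derive_affineR (f g : R -> R) (c k x : R) : (forall y, is_derive y (1 : R) f (g y)) ->
  is_derive x (1 : R) (fun x => f (c * x + k)) (c * g (c * x + k)).
Proof.
move=> df; have := @is_derive1_comp _ f (fun x => c * x + k) x _ _ (df _)
  (is_deriveD (is_deriveZ c (is_derive_id x 1)) (is_derive_cst k x 1)).
by move/is_derive_eq; apply; rewrite addr0 /GRing.scale/= mulr1 mulrC.
Qed.

Lemma Rint_supp (f : R -> R) (a b : R) : (forall x, ~~ (a <= x <= b) -> f x = 0) ->
  \int[leb]_(x in `[a, b]) f x = \int[leb]_x f x.
Proof.
move=> f0; rewrite Rintegral_mkcond; apply: eq_Rintegral => x _.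
rewrite patchE; case: ifPn => // /negP xab; rewrite f0//.
by apply/negP => h; apply: xab; rewrite inE/= in_itv.
Qed.

Lemma itg1_supp (f : R -> R) (a b : R) : continuous f ->
  (forall x, ~~ (a <= x <= b) -> f x = 0) -> itg1 f.
Proof.
move=> cf f0; apply/integrableP; split.
  by apply/measurable_EFinP; exact: continuous_measurable_fun.
have /integrableP[_] := itg1_continuous a b cf; rewrite integral_mkcond.
apply: le_lt_trans; rewrite le_eqVlt; apply/orP; left; apply/eqP.
apply: eq_integral => x _; rewrite patchE; case: ifPn => // /negP xab.
rewrite f0; first by rewrite abse0.
by apply/negP => h; apply: xab; rewrite inE/= in_itv.
Qed.

Lemma test1_supp (f : R -> R) : test1 f ->
  exists2 B : R, 0 < B & forall x, ~~ (- B < x < B) -> f x = 0.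
Proof.
move=> [_ [B fB]]; exists (`|B| + 1); first by rewrite ltr_pwDr.
move=> x; rewrite -ltr_norml -leNgt => Bx; apply: fB.
by have := ler_norm B; lra.
Qed.

Lemma itg1_test1 (f : R -> R) : test1 f -> itg1 f.
Proof.
move=> tf; have [B B0 hB] := test1_supp tf; have [sf _] := tf.
apply: (@itg1_supp _ (- B) B); first exact: smooth_continuous.
by move=> x h; apply: hB; apply: contra h => /andP[/ltW -> /ltW ->].
Qed.

(** Starting the integral at b - 1 keeps every x >= b strictly right of the lower endpoint, as the
    fundamental theorem requires; for x < b the primitive is locally 0. *)
Lemma is_derive_primitive (g : R -> R) (b : R) : continuous g ->
  (forall x, x <= b -> g x = 0) ->
  forall x, is_derive x (1 : R) (fun x => \int[leb]_(t in `[b - 1, x]) g t) (g x).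
Proof.
move=> cg hb x; have [xb|xb] := leP b x.
  have x1 : x < x + 1 by rewrite ltrDl.
  have bx : b - 1 < x by lra.
  have [d1 d2] := @continuous_FTC1_closed _ g (b - 1) x (x + 1) x1
    (itg1_continuous _ _ cg) bx (cg x).
  apply: DeriveDef; first exact: d1.
  by rewrite -derive1E d2.
rewrite hb ?ltW//.
apply: (@near_eq_is_derive _ _ _ (cst 0)); near=> y.
have yb : y < b by near: y; exact: lt_nbhsl.
rewrite /= Rintegral_mkcond (_ : _ \_ _ = cst 0).
  by rewrite /Rintegral integral0.
apply/funext => t; rewrite patchE; case: ifPn => //=; rewrite inE/= in_itv/= => /andP[_ ty].
by rewrite hb// (le_trans ty (ltW yb)).
Unshelve. all: by end_near. Qed.

(** The primitive is 0 left of the support and, right of it, equals the total integral, which is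
    0. *)
Lemma test1_primitive (g : R -> R) : test1 g -> \int[leb]_x g x = 0 ->
  exists2 F, test1 F & 'D_1 F = g.
Proof.
move=> tg g0; have [B B0 hB] := test1_supp tg; have [sg _] := tg.
have cg := smooth_continuous sg.
pose F x := \int[leb]_(t in `[- B - 1, x]) g t.
have dF x : is_derive x (1 : R) F (g x).
  apply: is_derive_primitive => // y yB.
  by rewrite hB// negb_and -leNgt yB.
exists F; last by apply/funext => x; rewrite (@derive_val _ _ _ _ _ _ _ (dF x)).
split; first exact: (smooth_primitive sg dF).
exists (B + 2) => x; rewrite ler_normr => /orP[Bx|xB].
  rewrite /F Rint_supp//.
  by move=> y h; apply: hB; apply: contra h => /andP[h1 h2]; apply/andP; split; lra.
rewrite /F Rintegral_mkcond (_ : _ \_ _ = cst 0).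
  by rewrite /Rintegral integral0.
apply/funext => t; rewrite patchE; case: ifPn => //=; rewrite inE/= in_itv/= => /andP[h1 h2].
by lra.
Qed.

Definition gaussc (c x : R) : R := expR (- (c * x ^+ 2)).

Lemma smooth_gaussc c : smooth (gaussc c).
Proof.
apply: (@smooth_compR _ _ expR); first exact: smooth_expR.
apply: smoothN; apply: smoothZ; under eq_fun do rewrite expr2.
by apply: smoothM; exact: smooth_id.
Qed.

Lemma is_derive_gaussc c x : is_derive x (1 : R) (gaussc c) (- (2 * c * x) * gaussc c x).
Proof.
have d2 : is_derive x (1 : R) (fun y : R => - (c * y ^+ 2)) (- (2 * c * x)).
  have := is_deriveN (is_deriveZ c (@is_deriveX _ _ id 2 x 1 1 (is_derive_id _ _))).
  move/is_derive_eq; apply.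
  by rewrite /GRing.scale/= mulr1 expr1; ring.
have := @is_derive1_comp R expR (fun y : R => - (c * y ^+ 2)) x _ _ (is_derive_expR _) d2.
by move/is_derive_eq; apply; rewrite mulrC.
Qed.

Lemma itg1_gauss1 : itg1 (gaussc 1).
Proof.
have := @integrableT_gauss R; apply: eq_integrable => // x _ /=.
by rewrite /gaussc mul1r.
Qed.

Lemma itg1_gaussc c : 0 < c -> itg1 (gaussc c).
Proof.
move=> c0.
have mg k : measurable_fun setT (gaussc k).
  by apply: continuous_measurable_fun; apply: smooth_continuous; exact: smooth_gaussc.
apply/integrableP; split; first by apply/measurable_EFinP; exact: mg.
under eq_integral do rewrite abse_EFin ger0_norm ?expR_ge0//.
have sc0 : 0 < (Num.sqrt c)^-1 by rewrite invr_gt0 sqrtr_gt0.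
rewrite (ge0_integral_scale1 sc0); last 2 first.
- by apply/measurable_EFinP; exact: mg.
- by move=> x; rewrite lee_fin expR_ge0.
rewrite lte_mul_pinfty ?lee_fin ?(ltW sc0)//.
under eq_integral => x _.
  rewrite (_ : gaussc c _ = gaussc 1 x); first over.
  rewrite /gaussc exprMn exprVn sqr_sqrtr ?(ltW c0)// mulrA divff ?gt_eqF//.
exact: integrable_lty itg1_gauss1.
Qed.

(** From u <= e^u with u = c x^2 / 2: half of the Gaussian decay absorbs the factor x^2. *)
Lemma sqr_gaussc_le (c x : R) : 0 < c -> x ^+ 2 * gaussc c x <= 2 / c * gaussc (c / 2) x.
Proof.
move=> c0.
have : c / 2 * x ^+ 2 <= expR (c / 2 * x ^+ 2).
  by apply: le_trans (expR_ge1Dx _); rewrite lerDr.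
have -> : gaussc c x = gaussc (c / 2) x * gaussc (c / 2) x.
  by rewrite /gaussc -expRD; congr expR; field.
move=> h; rewrite mulrA ler_wpM2r ?expR_ge0//.
rewrite /gaussc expRN ler_pdivrMr ?expR_gt0//.
apply: (@le_trans _ _ (2 / c * (c / 2 * x ^+ 2))).
  by rewrite (_ : 2 / c * _ = x ^+ 2)//; field; rewrite gt_eqF.
by rewrite ler_wpM2l// divr_ge0// ltW.
Qed.

Lemma itg1_sqr_gaussc c : 0 < c -> itg1 (fun x => x ^+ 2 * gaussc c x).
Proof.
move=> c0; apply: (itg_le measurableT _ _ (itgZ (2 / c) measurableT (itg1_gaussc (divr_gt0 c0 (ltr0Sn R 1))))).
  apply: measurable_funM; first exact: measurable_funX.
  by apply: continuous_measurable_fun; apply: smooth_continuous; exact: smooth_gaussc.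
move=> x _; rewrite (ger0_norm (mulr_ge0 (sqr_ge0 _) (expR_ge0 _))).
exact: sqr_gaussc_le.
Qed.

(** (2 x^2 - 1) e^(-x^2) is the derivative of -x e^(-x^2), so its integral over [-N, N] is -2 N
    e^(-N^2), of size at most 2 / N, and tends to 0. *)
Lemma int_sqr_gauss : \int[leb]_x (x ^+ 2 * gaussc 1 x) = 2^-1 * \int[leb]_x gaussc 1 x.
Proof.
pose f x : R := 2 * (x ^+ 2 * gaussc 1 x) - gaussc 1 x.
have i1 := itg1_gauss1; have i2 := itg1_sqr_gaussc (@ltr01 R).
have fi : itg1 f by apply: itgB => //; exact: itgZ.
have smf : smooth f.
  apply: smoothB; last exact: smooth_gaussc.
  apply: smoothZ; apply: smoothM; last exact: smooth_gaussc.
  by under eq_fun do rewrite expr2; apply: smoothM; exact: smooth_id.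
suff : \int[leb]_x f x = 0.
  rewrite RintegralB//; last exact: itgZ.
  by rewrite RintegralZl//; lra.
have cf := smooth_continuous smf.
have e n : \int[leb]_x ((f \_ `[- n.+1%:R, n.+1%:R]) x) = - (2 * (n.+1%:R * gaussc 1 n.+1%:R)).
  have dF (x : R) : is_derive x (1 : R) (fun x => - (x * gaussc 1 x)) (f x).
    have := is_deriveN (@is_deriveM _ _ id (gaussc 1) x 1 _ _ (is_derive_id _ _) (is_derive_gaussc 1 x)).
    by move/is_derive_eq; apply; rewrite /f /GRing.scale/=; ring.
  have n0 : - n.+1%:R < n.+1%:R :> R by rewrite (@lt_trans _ _ 0)// oppr_lt0 ltr0n.
  by rewrite -Rintegral_mkcond (Rint_FTC n0 dF cf) /gaussc sqrrN; ring.
have [|||_ cv] := @Rint_cvg _ _ _ leb setT (fun n => f \_ `[- n.+1%:R, n.+1%:R]) f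
  (fun x => `|f x|) measurableT _ _ (itg_abs fi).
- move=> n; apply/(measurable_restrictT _ (measurable_itv _)).
  by apply: measurable_funTS; exact: continuous_measurable_fun.
- move=> x _; apply: cvg_near_cst; exists (Num.truncn `|x|).+1 => // n /= xn.
  rewrite patchE mem_set//= in_itv/= -ler_norml (le_trans (ltW (truncnS_gt _)))//.
  by rewrite ler_nat (leq_trans xn).
- by move=> n x _; rewrite patchE; case: ifP; rewrite ?normr0.
move: cv; under eq_fun do rewrite e.
move=> cv; apply: (cvg_unique _ cv) => //.
apply/cvgr0Pnorm_lt => eps eps0; near=> n.
have n0 : 0 < n.+1%:R :> R by rewrite ltr0n.
rewrite normrN ger0_norm ?mulr_ge0 ?expR_ge0 ?ltW//.
apply: (@le_lt_trans _ _ (2 * n.+1%:R^-1)).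
  rewrite ler_pM2l// -(ler_pM2r n0) mulVf ?gt_eqF//.
  rewrite /gaussc expRN mul1r mulrAC ler_pdivrMr ?expR_gt0// mul1r -expr2.
  by apply: le_trans (expR_ge1Dx _); rewrite lerDr.
rewrite -ltr_pdivlMl// mulrC.
by near: n; exact: (near_infty_natSinv_lt (PosNum (divr_gt0 eps0 (ltr0Sn R 1)))).
Unshelve. all: by end_near. Qed.

End calculus1.

(** * The Gaussian, tightness and weak convergence *)

Section gauss_rV.
Context {R : realType} {d : nat}.
Local Notation E := 'rV[R]_d.
Local Notation mu := (lebesgue_rV d).
Local Notation leb := (@lebesgue_measure R).
Local Notation itg f := (mu.-integrable setT (fun x => (f x)%:E)).

Lemma itg_prodf (f : 'I_d -> R -> R) :
  (forall i, measurable_fun setT (f i)) -> (forall i x, 0 <= f i x) ->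
  (forall i, leb.-integrable setT (fun x => (f i x)%:E)) ->
  itg (prodf f) /\ \int[mu]_y prodf f y = \prod_i \int[leb]_x f i x.
Proof.
move=> mf f0 fi.
have fin i : (\int[leb]_x (f i x)%:E)%E \is a fin_num by exact: integrable_fin_num.
have I : (\int[mu]_y (prodf f y)%:E = (\prod_i \int[leb]_x f i x)%:E)%E.
  rewrite ge0_integral_prodf//.
  rewrite (eq_bigr (fun i => (\int[leb]_x f i x)%:E)%E); last first.
    by move=> i _; rewrite /Rintegral fineK.
  by elim/big_ind2 : _ => // x1 x2 y1 y2 -> ->; rewrite EFinM.
split; last by rewrite /Rintegral I.
apply/integrableP; split; first by apply/measurable_EFinP; exact: measurable_prodf.
under eq_integral do rewrite abse_EFin ger0_norm ?prodf_ge0//.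
by rewrite I ltry.
Qed.

Definition sqn (y : E) : R := dotv y y.

Lemma sqnE y : sqn y = \sum_i y ord0 i ^+ 2.
Proof. by rewrite /sqn /dotv; apply: eq_bigr => i _; rewrite expr2. Qed.

Lemma sqn_ge0 y : 0 <= sqn y.
Proof. by rewrite sqnE sumr_ge0// => i _; exact: sqr_ge0. Qed.

Lemma coord_le_sqn (y : E) i : y ord0 i ^+ 2 <= sqn y.
Proof.
rewrite sqnE (bigD1 i)//= lerDl sumr_ge0// => j _; exact: sqr_ge0.
Qed.

Lemma measurable_sqn : measurable_fun setT sqn.
Proof.
rewrite (_ : sqn = fun y => \sum_i y ord0 i ^+ 2); last exact/funext/sqnE.
elim: (index_enum _) => [|i s ih].
  by under eq_fun do rewrite big_nil; exact: measurable_cst.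
under eq_fun do rewrite big_cons.
apply: measurable_funD => //; apply: measurable_funX; exact: measurable_coord.
Qed.

Lemma expR_sqn c y : expR (- (c * sqn y)) = prodf (fun=> gaussc c) y.
Proof.
rewrite sqnE mulr_sumr -sumrN expR_sum.
by apply: eq_bigr => i _.
Qed.

Lemma GaussE (y : E) : Gauss y = prodf (fun=> gaussc 1) y.
Proof. by rewrite -expR_sqn mul1r. Qed.

Lemma measurable_gaussc c : measurable_fun setT (@gaussc R c).
Proof. by apply: continuous_measurable_fun; apply: smooth_continuous; exact: smooth_gaussc. Qed.

Lemma itg_expR_sqn c : 0 < c -> itg (fun y => expR (- (c * sqn y))).
Proof.
move=> c0; rewrite (_ : (fun y => _) = fun y => (prodf (fun=> gaussc c) y)%:E).
  apply: (itg_prodf _ _ _).1 => i; first exact: measurable_gaussc.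
  - by move=> x; exact: expR_ge0.
  - exact: itg1_gaussc.
by apply/funext => y; rewrite expR_sqn.
Qed.

Lemma Gauss_ge0 (y : E) : 0 <= Gauss y.
Proof. exact: expR_ge0. Qed.

Lemma itg_Gauss : itg (@Gauss R d).
Proof.
rewrite (_ : (fun y => _) = fun y : E => (expR (- (1 * sqn y)))%:E).
  exact: itg_expR_sqn.
by apply/funext => y; rewrite mul1r.
Qed.

Lemma measurable_Gauss : measurable_fun setT (@Gauss R d).
Proof. exact: (itg_meas itg_Gauss). Qed.

Lemma int_gauss1_gt0 : 0 < \int[leb]_x (@gaussc R 1 x).
Proof.
rewrite (_ : \int[leb]_x _ = Num.sqrt pi); first by rewrite sqrtr_gt0 pi_gt0.
have e : (\int[leb]_x (gaussc 1 x)%:E = (Num.sqrt pi)%:E)%E.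
  rewrite -integralT_gauss; apply: eq_integral => x _.
  by rewrite /gaussc mul1r.
by rewrite /Rintegral e.
Qed.

Lemma itg_prodf_Gauss (f : 'I_d -> R -> R) :
  (forall i, measurable_fun setT (f i)) -> (forall i x, 0 <= f i x) ->
  (forall i, leb.-integrable setT (fun x => (f i x * gaussc 1 x)%:E)) ->
  itg (fun y => prodf f y * Gauss y) /\
  \int[mu]_y (prodf f y * Gauss y) = \prod_i \int[leb]_x (f i x * gaussc 1 x).
Proof.
move=> mf f0 fi.
have e y : prodf f y * Gauss y = prodf (fun i x => f i x * gaussc 1 x) y.
  by rewrite GaussE /prodf -big_split.
under eq_fun do rewrite e; under eq_Rintegral do rewrite e.
apply: itg_prodf => //.
- by move=> i; apply: measurable_funM => //; exact: measurable_gaussc.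
- by move=> i x; rewrite mulr_ge0// expR_ge0.
Qed.

Lemma int_Gauss : \int[mu]_y (Gauss y : R) = (\int[leb]_x gaussc 1 x) ^+ d.
Proof.
have [||_] := @itg_prodf (fun=> gaussc 1) (fun i => measurable_gaussc 1).
- by move=> i x; exact: expR_ge0.
- by move=> i; exact: itg1_gauss1.
rewrite prodr_const card_ord => <-.
by apply: eq_Rintegral => y _; rewrite GaussE.
Qed.

Lemma int_Gauss_gt0 : 0 < \int[mu]_y (Gauss y : R).
Proof. by rewrite int_Gauss exprn_gt0// int_gauss1_gt0. Qed.

Lemma int_sqr_Gauss j : itg (fun y : E => y ord0 j ^+ 2 * Gauss y) /\
  \int[mu]_y ((y : E) ord0 j ^+ 2 * Gauss (y : E)) = 2^-1 * \int[mu]_y (Gauss y : R).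
Proof.
(* Writing y_j^2 as a product over all coordinates makes the product formula applicable. *)
pose f : 'I_d -> R -> R := fun i x => if i == j then x ^+ 2 else 1.
have e (y : E) : y ord0 j ^+ 2 = prodf f y.
  rewrite /prodf (bigD1 j)//= /f eqxx big1 ?mulr1// => i /negPf ->//.
have h1 : forall i, measurable_fun setT (f i).
  by move=> i; rewrite /f; case: (i == j); [exact: measurable_funX|exact: measurable_cst].
have h2 : forall i x, 0 <= f i x by move=> i x; rewrite /f; case: (i == j); rewrite ?sqr_ge0.
have h3 : forall i, leb.-integrable setT (fun x => (f i x * gaussc 1 x)%:E).
  move=> i; rewrite /f; case: (i == j); first exact: itg1_sqr_gaussc.
  by under eq_fun do rewrite mul1r; exact: itg1_gauss1.
have [i1 i2] := itg_prodf_Gauss h1 h2 h3.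
under eq_fun do rewrite e; under eq_Rintegral do rewrite e.
split; [exact: i1|rewrite i2 int_Gauss].
rewrite (bigD1 j)//= /f eqxx int_sqr_gauss -mulrA; congr (_ * _).
rewrite -[in RHS](card_ord d) -prodr_const [RHS](bigD1 j)//=; congr (_ * _).
apply: eq_bigr => i /negPf ->; by apply: eq_Rintegral => x _; rewrite mul1r.
Qed.

Lemma int_sqn_Gauss : itg (fun y => sqn y * Gauss y) /\
  \int[mu]_y (sqn y * Gauss y) = d%:R / 2 * \int[mu]_y (Gauss y : R).
Proof.
have e (y : E) : sqn y * Gauss y = \sum_i (y ord0 i ^+ 2 * Gauss y).
  by rewrite sqnE mulr_suml.
under eq_fun do rewrite e; under eq_Rintegral do rewrite e.
split; first by apply: itg_sum => // i; have [] := int_sqr_Gauss i.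
rewrite Rint_sum//; last by move=> i; have [] := int_sqr_Gauss i.
under eq_bigr do rewrite (int_sqr_Gauss _).2.
by rewrite sumr_const card_ord -[LHS]mulr_natl mulrA.
Qed.

End gauss_rV.

(** * Densities with bounded entropy and second moment *)

Section tight_densities.
Context {R : realType} {d : nat}.
Local Notation E := 'rV[R]_d.
Local Notation mu := (lebesgue_rV d).
Local Notation itg f := (mu.-integrable setT (fun x => (f x)%:E)).

Lemma ln_ge1BV (u : R) : 0 < u -> 1 - u^-1 <= ln u.
Proof.
move=> u0; have := expR_ge1Dx (- ln u).
by rewrite expRN lnK ?posrE//; lra.
Qed.

(** This is ln u >= 1 - 1/u at u = x e^c. It is used with c = |y|^2 / 2, where e^(-c) is
    integrable. *)
Lemma xlnx_ge (x c : R) : 0 <= x -> - expR (- c) <= x * ln x + x * c.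
Proof.
rewrite le_eqVlt => /predU1P[<-|x0].
  by rewrite !mul0r addr0 oppr_le0 expR_ge0.
have ec : 0 < expR c by exact: expR_gt0.
have u0 : 0 < x * expR c by rewrite mulr_gt0.
have := ln_ge1BV u0; rewrite lnM ?posrE// expRK invfM => h.
have : x * (1 - x^-1 * (expR c)^-1) <= x * (ln x + c) by rewrite ler_pM2l.
rewrite mulrBr mulr1 mulrA divff ?gt_eqF// mul1r mulrDr expRN; lra.
Qed.

(** A nonnegative substitute for r ln r + r |y|^2: the positive part of r ln r prevents
    concentration and the second moment prevents escape to infinity, so one bound on the integral
    gives both. *)
Definition entpos (r : E -> R) (y : E) : R :=
  Num.max (r y * ln (r y)) 0 + r y * sqn y / 2.

Lemma entpos_ge0 r y : 0 <= r y -> 0 <= entpos r y.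
Proof.
by move=> r0; rewrite addr_ge0 ?le_max ?lexx ?orbT// divr_ge0// mulr_ge0// sqn_ge0.
Qed.

(* The negative part of [r ln r] is absorbed by half of the second moment. *)
Lemma entpos_le r (y : E) : 0 <= r y ->
  entpos r y <= (r y * sqn y + r y * ln (r y)) + expR (- (2^-1 * sqn y)).
Proof.
move=> r0; rewrite /entpos.
have h := xlnx_ge (2^-1 * sqn y) r0.
have q0 : 0 <= r y * sqn y by rewrite mulr_ge0// sqn_ge0.
have e0 : 0 <= expR (- (2^-1 * sqn y)) by exact: expR_ge0.
have hq : r y * (2^-1 * sqn y) = r y * sqn y / 2 by ring.
rewrite hq in h.
by case: (leP (r y * ln (r y)) 0) => ?; lra.
Qed.

Record tight (C : R) (r : E -> R) : Prop := Tight {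
  tight_ge0 : forall y, 0 <= r y;
  tight_itg : itg r;
  tight_ent : itg (entpos r);
  tight_le : \int[mu]_y entpos r y <= C }.

Lemma tight_sqn_itg C r : tight C r -> itg (fun y => r y * sqn y).
Proof.
move=> [r0 ir ie _]; apply: (itg_le measurableT _ _ (itgZ 2 measurableT ie)).
  by apply: measurable_funM; [exact: itg_meas ir|exact: measurable_sqn].
move=> y _; rewrite ger0_norm ?mulr_ge0 ?sqn_ge0// /entpos mulrDr.
have : 0 <= Num.max (r y * ln (r y)) 0 by rewrite le_max lexx orbT.
lra.
Qed.

Lemma tight_sqn_le C r : tight C r -> \int[mu]_y (r y * sqn y) <= 2 * C.
Proof.
move=> tr; have [r0 ir ie le] := tr; have iq := tight_sqn_itg tr.
apply: (@le_trans _ _ (2 * \int[mu]_y entpos r y)); last by rewrite ler_pM2l.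
rewrite -RintegralZl//; apply: le_Rintegral => //; first exact: itgZ.
move=> y _; rewrite /entpos mulrDr.
have : 0 <= Num.max (r y * ln (r y)) 0 by rewrite le_max lexx orbT.
lra.
Qed.

Lemma itg_cbox (M : R) : itg (\1_(cbox M) : E -> R).
Proof.
pose f : 'I_d -> R -> R := fun=> \1_(`[- M, M]%classic).
have mI : measurable (`[- M, M]%classic : set R) by exact: measurable_itv.
have mf i : measurable_fun setT (f i) by exact: measurable_indic.
rewrite (_ : (fun x => _) = fun x => (prodf f x)%:E).
  apply: (itg_prodf mf _ _).1 => i; first by move=> x; rewrite /f indicE.
  exact: integrable_indic_itv.
apply/funext => x; congr EFin; rewrite indicE /prodf.
have [h|h] := pselect (cbox M x).
  rewrite mem_set// big1// => i _; rewrite /f indicE mem_set//= in_itv/=; exact: h.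
rewrite memNset//; move/existsNP : h => [i hi].
rewrite (bigD1 i)//= /f indicE memNset ?mul0r//= in_itv/=; exact: hi.
Qed.

(** Where r <= K inside the cube, r f <= K f. Outside the cube |y|^2 >= B^2, so r <= (2 / B^2)
    [entpos r]. Where r > K, r <= r ln r / ln K. *)
Lemma tight_split C r (f : E -> R) (K B : R) : tight C r ->
  1 < K -> 0 < B -> measurable_fun setT f -> (forall y, 0 <= f y <= 1) ->
  \int[mu]_y (r y * f y) <=
  K * \int[mu]_y (f y * \1_(cbox B) y) + (2 / B ^+ 2 + (ln K)^-1) * C.
Proof.
move=> tr K1 B0 mf f01; have [r0 ir ie le] := tr.
have lK : 0 < ln K by rewrite ln_gt0.
have if1 : itg (fun y => f y * \1_(cbox B) y).
  apply: (@itg_bM _ _ _ _ _ _ _ 1) => //; last exact: itg_cbox.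
  by move=> y _; have /andP[? ?] := f01 y; rewrite ger0_norm.
apply: (@le_trans _ _ (\int[mu]_y (K * (f y * \1_(cbox B) y) + (2 / B ^+ 2 + (ln K)^-1) * entpos r y))).
  apply: le_Rintegral => //.
  - under eq_fun do rewrite mulrC.
    apply: (@itg_bM _ _ _ _ _ _ _ 1) => //.
    by move=> y _; have /andP[? ?] := f01 y; rewrite ger0_norm.
  - by apply: itgD => //; exact: itgZ.
  move=> y _; have /andP[f0 f1] := f01 y.
  have ry := r0 y.
  have E0 := entpos_ge0 ry.
  have c1 : 0 <= 2 / B ^+ 2 by rewrite divr_ge0// sqr_ge0.
  have c2 : 0 <= (ln K)^-1 by rewrite invr_ge0 ltW.
  have rf : r y * f y <= r y by rewrite ler_piMr.
  have i0 : 0 <= K * (f y * \1_(cbox B) y) by rewrite !mulr_ge0 ?indicE//; lra.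
  have m0 : 0 <= Num.max (r y * ln (r y)) 0 by rewrite le_max lexx orbT.
  have q0 : 0 <= r y * sqn y / 2 by rewrite divr_ge0// mulr_ge0// sqn_ge0.
  rewrite mulrDl.
  have [rK|rK] := leP (r y) K; last first.
    have : r y <= (ln K)^-1 * entpos r y.
      rewrite ler_pdivlMl// mulrC.
      apply: (@le_trans _ _ (r y * ln (r y))).
        by rewrite ler_wpM2l// ler_ln ?posrE//; lra.
      by rewrite /entpos; have := le_max (r y * ln (r y)) (r y * ln (r y)) 0; rewrite lexx/=; lra.
    have := mulr_ge0 c1 E0; lra.
  have [By|By] := pselect (cbox B y).
    rewrite indicE mem_set// mulr1.
    have : r y * f y <= K * f y by rewrite ler_wpM2r.
    have := mulr_ge0 c1 E0; have := mulr_ge0 c2 E0; lra.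
  move/existsNP : By => [i /negP hi].
  have Bi : B ^+ 2 <= sqn y.
    apply: le_trans (coord_le_sqn y i).
    rewrite -[y ord0 i ^+ 2]real_normK ?num_real// lerXn2r ?nnegrE ?(ltW B0)//.
    by move: hi; rewrite -ler_norml -ltNge => /ltW.
  have : r y <= 2 / B ^+ 2 * entpos r y.
    apply: (@le_trans _ _ (2 / B ^+ 2 * (r y * sqn y / 2))).
      rewrite (_ : 2 / B ^+ 2 * _ = r y * (sqn y / B ^+ 2)); last by field; rewrite gt_eqF.
      by rewrite ler_peMr// ler_pdivlMr ?exprn_gt0// mul1r.
    by rewrite ler_wpM2l// /entpos lerDr.
  have := mulr_ge0 c2 E0; lra.
rewrite RintegralD//; [|exact: itgZ..].
rewrite !RintegralZl// lerD2l ler_wpM2l// addr_ge0 ?invr_ge0 ?(ltW lK)//.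
by rewrite divr_ge0// sqr_ge0.
Qed.

Lemma tight_C_ge0 C r : tight C r -> 0 <= C.
Proof.
move=> [r0 _ _]; apply: le_trans; apply: Rintegral_ge0 => y _.
exact: entpos_ge0.
Qed.

Lemma tight_bounded_itg C (r f : E -> R) (D : R) : tight C r -> measurable_fun setT f ->
  (forall y, `|f y| <= D) -> itg (fun y => r y * f y).
Proof.
move=> [r0 ir _ _] mf fD; under eq_fun do rewrite mulrC.
by apply: (@itg_bM _ _ _ _ _ _ _ D).
Qed.

(** Uniformity over all densities with the same [C] is the point: it lets the index n be fixed
    before t in the limit arguments. *)
Lemma tight_unif_cvg0 C (f_ : nat -> E -> R) : 
  (forall n, measurable_fun setT (f_ n)) -> (forall n y, 0 <= f_ n y <= 1) ->
  (forall y, f_ n y @[n --> \oo] --> (0 : R)) ->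
  forall e, 0 < e -> \forall n \near \oo, forall r, tight C r ->
    \int[mu]_y (r y * f_ n y) <= e.
Proof.
move=> mf f01 cf e e0.
have [C0|C0] := leP 0 C; last first.
  by apply: nearW => n r tr; have := tight_C_ge0 tr; lra.
(* K and B below are such that 1 / ln K = 2 / B^2 = e'. The last two terms of [tight_split] then
   take two thirds of e, and dominated convergence on the cube takes the third one. *)
pose e' := e / (3 * (C + 1)).
have C1 : 0 < C + 1 by lra.
have e'0 : 0 < e' by rewrite divr_gt0// mulr_gt0.
pose K := expR e'^-1.
have K1 : 1 < K by rewrite -[X in X < _](@expR0 R) ltr_expR invr_gt0.
have lnK : (ln K)^-1 = e' by rewrite /K expRK invrK.
pose B := Num.sqrt (2 / e').
have B0 : 0 < B by rewrite sqrtr_gt0 divr_gt0.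
have B2 : 2 / B ^+ 2 = e'.
  rewrite /B sqr_sqrtr; last by rewrite divr_ge0// ltW.
  by field; rewrite gt_eqF.
have [||||_ cI] := @Rint_cvg _ _ _ mu setT (fun n y => f_ n y * \1_(cbox B) y)
  (fun y => 0 * \1_(cbox B) y) (\1_(cbox B)) measurableT.
- by move=> n; apply: measurable_funM => //; apply: measurable_indic; exact: measurable_cbox.
- by move=> y _; apply: cvgM; [exact: cf|exact: cvg_cst].
- exact: itg_cbox.
- move=> n y _; have /andP[f0 f1] := f01 n y.
  by rewrite normrM !ger0_norm ?indicE// ler_piMl.
have {}cI : \int[mu]_y (f_ n y * \1_(cbox B) y) @[n --> \oo] --> (0 : R).
  move: cI; under [X in _ --> X -> _]eq_Rintegral do rewrite mul0r.
  by rewrite /Rintegral integral0.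
have eK : 0 < e / (3 * K) by rewrite divr_gt0// mulr_gt0// (lt_trans _ K1).
move/cvgr0Pnorm_le : cI => /(_ _ eK); apply: filterS => n hn r tr.
apply: le_trans (tight_split tr K1 B0 (mf n) (f01 n)) _.
rewrite B2 lnK.
have h1 : K * \int[mu]_y (f_ n y * \1_(cbox B) y) <= e / 3.
  have K0 : 0 < K by lra.
  rewrite -ler_pdivlMl// (le_trans (ler_norm _))// (le_trans hn)//.
  by rewrite (_ : e / (3 * K) = K^-1 * (e / 3))//; field; rewrite gt_eqF.
have h2 : (e' + e') * C <= 2 * (e / 3).
  have -> : e / 3 = e' * (C + 1) by rewrite /e'; field; rewrite gt_eqF.
  have : e' * C <= e' * (C + 1) by rewrite ler_pM2l// lerDl.
  lra.
lra.
Qed.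

(** Dividing |f_n - f| by 2 D + 1 brings it into [0, 1] and reduces the claim to
    [tight_unif_cvg0]. *)
Lemma tight_unif_cvg C (f_ : nat -> E -> R) f (D : R) :
  (forall n, measurable_fun setT (f_ n)) -> (forall n y, `|f_ n y| <= D) ->
  (forall y, f_ n y @[n --> \oo] --> f y) ->
  forall e, 0 < e -> \forall n \near \oo, forall r, tight C r ->
    `|\int[mu]_y (r y * f_ n y) - \int[mu]_y (r y * f y)| <= e.
Proof.
move=> mf fD cf e e0.
have mfl : measurable_fun setT f.
  by apply: (measurable_fun_cvg mf) => y _; exact: cf.
have D0 : 0 <= D by apply: le_trans (fD 0 0).
have fD' y : `|f y| <= D.
  have cn : `|f_ n y| @[n --> \oo] --> `|f y| by apply: cvg_norm; exact: cf.
  rewrite -(cvg_lim _ cn)//; apply: limr_le; first exact: cvgP cn.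
  by apply: nearW => n; exact: fD.
pose K := D + D + 1.
have K0 : 0 < K by rewrite /K; lra.
pose g n y := `|f_ n y - f y| / K.
have mg n : measurable_fun setT (g n).
  apply: measurable_funM => //; apply: measurableT_comp => //.
  exact: measurable_funB.
have g01 n y : 0 <= g n y <= 1.
  rewrite /g divr_ge0 ?(ltW K0)//= ler_pdivrMr// mul1r.
  apply: le_trans (ler_normB _ _) _; rewrite /K.
  by have := fD n y; have := fD' y; lra.
have cg y : g n y @[n --> \oo] --> (0 : R).
  rewrite -[0](mul0r K^-1); apply: cvgMl.
  by apply/norm_cvg0P; rewrite -[0](subrr (f y)); apply: cvgB => //; exact: cvg_cst.
have := tight_unif_cvg0 C mg g01 cg (divr_gt0 e0 K0).
apply: filterS => n hn r tr; have := hn r tr.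
have [r0 ir _ _] := tr.
have i1 : itg (fun y => r y * f_ n y) by exact: tight_bounded_itg tr (mf n) (fD n).
have i2 : itg (fun y => r y * f y) by exact: tight_bounded_itg tr mfl fD'.
have i3 : itg (fun y => r y * g n y).
  apply: (tight_bounded_itg tr (mg n) (D := 1)) => y.
  by have /andP[? ?] := g01 n y; rewrite ger0_norm.
rewrite ler_pdivlMr// -RintegralZr// => le.
rewrite -RintegralB//; apply: le_trans le.
apply: Rint_abs_le => //.
- exact: itgB.
- by under eq_fun do rewrite mulrC; exact: itgZ.
- by move=> y _; rewrite -mulrBr normrM (ger0_norm (r0 y)) /g -mulrA divfK ?gt_eqF.
Qed.

End tight_densities.

(** * From product bumps to weak L^1 convergence and convergence of moments *)

Section weak_convergence.
Context {R : realType} {d : nat}.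
Local Notation E := 'rV[R]_d.
Local Notation mu := (lebesgue_rV d).
Local Notation itg f := (mu.-integrable setT (fun x => (f x)%:E)).
Context (C : R) (rt : R -> E -> R) (ht : forall t, 0 <= t -> tight C (rt t)).

Lemma near_pinfty_ge0 : \forall t \near (+oo : set_system R), 0 <= t.
Proof. by apply: nbhs_pinfty_ge; rewrite num_real. Qed.

(** Monotone class argument. In its limit step the error of replacing f by f_n is small uniformly in
    t by [tight_unif_cvg], so n is fixed before t tends to infinity. *)
Lemma weak_cvg_bounded :
  (forall n (a b : 'I_d -> R),
    \int[mu]_y (rt t y * prodf (fun i => bump n (a i) (b i)) y) @[t --> +oo] -->
    \int[mu]_y (Gauss y * prodf (fun i => bump n (a i) (b i)) y)) ->
  forall (f : E -> R) (D : R), measurable_fun setT f -> (forall y, `|f y| <= D) ->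
  \int[mu]_y (rt t y * f y) @[t --> +oo] --> \int[mu]_y (Gauss y * f y).
Proof.
move=> hb.
have Gi (f : E -> R) (D : R) : measurable_fun setT f -> (forall y, `|f y| <= D) ->
    itg (fun y => Gauss y * f y).
  move=> mf fD; under eq_fun do rewrite mulrC.
  by apply: (@itg_bM _ _ _ _ _ _ _ D) => //; exact: itg_Gauss.
apply: (bounded_measurable_ind (P := fun f =>
  \int[mu]_y (rt t y * f y) @[t --> +oo] --> \int[mu]_y (Gauss y * f y))) => //.
- move=> f g c D mf fD mg gD cf cg.
  have -> : \int[mu]_y (Gauss y * (f y + c * g y)) =
      \int[mu]_y (Gauss y * f y) + c * \int[mu]_y (Gauss y * g y).
    under eq_Rintegral do rewrite mulrDr mulrCA.
    have i1 := Gi f D mf fD; have i2 := Gi g D mg gD.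
    by rewrite RintegralD//; [rewrite RintegralZl|exact: itgZ].
  have lim : \int[mu]_y (rt t y * f y) + c * \int[mu]_y (rt t y * g y) @[t --> +oo] -->
      \int[mu]_y (Gauss y * f y) + c * \int[mu]_y (Gauss y * g y).
    by apply: cvgD => //; apply: cvgMr.
  apply: cvg_trans lim; apply: near_eq_cvg.
  near=> t; have t0 : 0 <= t by near: t; exact: near_pinfty_ge0.
  under [RHS]eq_Rintegral do rewrite mulrDr mulrCA.
  have i1 := tight_bounded_itg (ht t0) mf fD.
  have i2 := tight_bounded_itg (ht t0) mg gD.
  by rewrite RintegralD//; [rewrite RintegralZl|exact: itgZ].
- move=> f_ f D mf fD cf Pf.
  have [||||_ cG] := @Rint_cvg _ _ _ mu setT (fun n y => Gauss y * f_ n y)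
    (fun y => Gauss y * f y) (fun y => D * Gauss y) measurableT.
  + by move=> n; apply: measurable_funM => //; exact: measurable_Gauss.
  + by move=> y _; apply: cvgMr; exact: cf.
  + by apply: itgZ => //; exact: itg_Gauss.
  + by move=> n y _; rewrite normrM mulrC (ger0_norm (Gauss_ge0 _)) ler_wpM2r// Gauss_ge0.
  apply/cvgrPdist_le => e e0.
  have e3 : 0 < e / 3 by rewrite divr_gt0.
  have [n [h1 h2]] : exists n,
      `|\int[mu]_y (Gauss y * f y) - \int[mu]_y (Gauss y * f_ n y)| <= e / 3 /\
      forall r, tight C r -> `|\int[mu]_y (r y * f_ n y) - \int[mu]_y (r y * f y)| <= e / 3.
    move/cvgrPdist_le : cG => /(_ _ e3) c1.
    have c2 := tight_unif_cvg C mf fD cf e3.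
    by near \oo => n; exists n; split; near: n; [exact: c1|exact: c2].
  move/cvgrPdist_le : (Pf n) => /(_ _ e3) h3.
  near=> t; have t0 : 0 <= t by near: t; exact: near_pinfty_ge0.
  have h4 : `|\int[mu]_y (Gauss y * f_ n y) - \int[mu]_y (rt t y * f_ n y)| <= e / 3.
    by near: t.
  have h5 := h2 _ (ht t0).
  rewrite (_ : _ - _ = (\int[mu]_y (Gauss y * f y) - \int[mu]_y (Gauss y * f_ n y)) +
    (\int[mu]_y (Gauss y * f_ n y) - \int[mu]_y (rt t y * f_ n y)) +
    (\int[mu]_y (rt t y * f_ n y) - \int[mu]_y (rt t y * f y))); last by ring.
  apply: le_trans (ler_normD _ _) _.
  have := ler_normD (\int[mu]_y (Gauss y * f y) - \int[mu]_y (Gauss y * f_ n y))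
    (\int[mu]_y (Gauss y * f_ n y) - \int[mu]_y (rt t y * f_ n y)).
  lra.
Unshelve. all: by end_near. Qed.

Lemma Lfun_oo_bounded (h : E -> R) : h \in Lfun mu +oo%E ->
  exists (g : E -> R) (D : R), [/\ measurable_fun setT g, forall y, `|g y| <= D &
    measurable_fun setT h /\ {ae mu, forall y, h y = g y}].
Proof.
move=> hL; have mh : measurable_fun setT h by move: hL => /sub_Lfun_mfun; rewrite inE.
move: hL => /andP[_]; rewrite inE /finite_norm/= unlock => hoo.
have [D hD] : exists D : R, {ae mu, forall y, `|h y| <= D}.
  (* The L^oo norm is defined by cases: if the whole space has measure zero, every pointwise bound
     holds almost everywhere. *)
  move: hoo; case: ifPn => [mu0 hoo|].
    have ae := @ess_sup_ge _ _ _ mu (abse \o (EFin \o h)).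
    have [S HS] : exists S : R, (ess_sup mu (abse \o (EFin \o h)) <= S%:E)%E.
      move: hoo; case: (ess_sup _ _) => [S| |] // _; first by exists S.
      by exists 0; rewrite leNye.
    exists S; move: ae; apply: filterS => y /= hy.
    by rewrite -lee_fin; exact: le_trans hy HS.
  rewrite -leNgt measure_le0 => /eqP mu0 _; exists 0.
  by exists setT; split => //.
exists (fun y => if `|h y| <= D then h y else 0), `|D|; split.
- apply: measurable_fun_ifT => //.
  by apply: measurable_fun_ler => //; apply: measurableT_comp.
- by move=> y; case: ifP => [/le_trans -> //|]; rewrite ?normr0// ler_norm.
- by split => //; move: hD; apply: filterS => y /= ->.
Qed.

Context (hweak : forall (f : E -> R) (D : R), measurable_fun setT f ->
  (forall y, `|f y| <= D) ->
  \int[mu]_y (rt t y * f y) @[t --> +oo] --> \int[mu]_y (Gauss y * f y)).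

Lemma weak_cvgL1_Gauss : weak_cvgL1 rt (@Gauss R d).
Proof.
split => [t t0| |h hoo].
- by apply/Lfun1_integrable; exact: tight_itg (ht t0).
- by apply/Lfun1_integrable; exact: itg_Gauss.
have [g [D [mg gD [mh hg]]]] := Lfun_oo_bounded hoo.
have e (r : E -> R) : itg r -> \int[mu]_y (r y * h y) = \int[mu]_y (r y * g y).
  move=> ir; apply: Rint_ae_eq => //; try by apply: measurable_funM => //; exact: itg_meas ir.
  by move: hg; apply: filterS => y /= -> _.
rewrite (e _ itg_Gauss); apply: cvg_trans (hweak mg gD).
apply: near_eq_cvg; near=> t; have t0 : 0 <= t by near: t; exact: near_pinfty_ge0.
by rewrite e//; exact: tight_itg (ht t0).
Unshelve. all: by end_near. Qed.

Lemma mass_cvg : \int[mu]_y rt t y @[t --> +oo] --> \int[mu]_y (Gauss y : R).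
Proof.
have h1 (y : E) : `|1 : R| <= 1 by rewrite normr1.
have e (r : E -> R) : \int[mu]_y (r y * 1) = \int[mu]_y r y.
  by apply: eq_Rintegral => y _; rewrite mulr1.
have := @hweak (fun=> 1) 1 (measurable_cst _) h1.
by rewrite e; under eq_fun do rewrite e.
Qed.

(* Uniformly bounded second moments make the truncation error O(1/n). *)
Lemma first_moment_cvg i :
  \int[mu]_y ((y : E) ord0 i * rt t y) @[t --> +oo] -->
  \int[mu]_y ((y : E) ord0 i * Gauss (y : E)).
Proof.
have [iG _] := @int_sqn_Gauss R d.
pose CG := \int[mu]_y (sqn (y : E) * Gauss (y : E)).
pose f n (y : E) : R := if `|y ord0 i| <= n.+1%:R then y ord0 i else 0.
have mc : measurable_fun setT (fun y : E => y ord0 i) by exact: measurable_coord.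
have mf n : measurable_fun setT (f n).
  apply: measurable_fun_ifT => //.
  by apply: measurable_fun_ler => //; apply: measurableT_comp.
have fD n y : `|f n y| <= n.+1%:R by rewrite /f; case: ifP => //; rewrite normr0.
have key n (r : E -> R) : (forall y, 0 <= r y) -> itg r -> itg (fun y => r y * sqn y) ->
    `|\int[mu]_y ((y : E) ord0 i * r y) - \int[mu]_y (r y * f n y)| <=
    n.+1%:R^-1 * \int[mu]_y (r y * sqn y).
  move=> r0 ir iq.
  have n0 : 0 < n.+1%:R :> R by rewrite ltr0n.
  have i1 : itg (fun y => r y * f n y).
    under eq_fun do rewrite mulrC.
    by apply: (@itg_bM _ _ _ _ _ _ _ n.+1%:R).
  have tail (y : E) : `|y ord0 i * r y - r y * f n y| <= n.+1%:R^-1 * (r y * sqn y).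
    rewrite [r y * _]mulrC -mulrBl normrM (ger0_norm (r0 y)) mulrC mulrCA ler_wpM2l// /f.
    case: ifPn => h; first by rewrite subrr normr0 mulr_ge0 ?invr_ge0 ?sqn_ge0// ltW.
    rewrite subr0 ler_pdivlMl// -ltNge in h *.
    apply: le_trans (coord_le_sqn y i).
    by rewrite -real_normK ?num_real// expr2 ler_wpM2r// ltW.
  have i2 : itg (fun y : E => y ord0 i * r y).
    apply: (itg_le measurableT _ _ (itgD measurableT (itg_abs i1) (itgZ n.+1%:R^-1 measurableT iq))).
      by apply: measurable_funM => //; exact: itg_meas ir.
    move=> y _; have := ler_normD (y ord0 i * r y - r y * f n y) (r y * f n y).
    by rewrite subrK => h; apply: le_trans h _; rewrite addrC lerD2l; exact: tail.
  rewrite -RintegralB// -RintegralZl//; apply: Rint_abs_le => //; first exact: itgB.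
  exact: itgZ.
have iG' : itg (fun y : E => Gauss y * sqn y) by under eq_fun do rewrite mulrC.
apply/cvgrPdist_le => e e0.
pose M := Num.max (2 * C) (\int[mu]_y (Gauss (y : E) * sqn (y : E))).
have e3 : 0 < e / 3 by rewrite divr_gt0.
have M1 : 0 < `|M| + 1 by rewrite ltr_pwDr.
have [n hn] : exists n : nat, n.+1%:R^-1 * (`|M| + 1) <= e / 3.
  near \oo => n; exists n; rewrite -ler_pdivlMr// ltW//; near: n.
  exact: near_infty_natSinv_lt (PosNum (divr_gt0 e3 M1)).
have bnd (x : R) : x <= M -> n.+1%:R^-1 * x <= e / 3.
  move=> xM; apply: le_trans hn; rewrite ler_pM2l ?invr_gt0 ?ltr0n//.
  by have := ler_norm M; lra.
move/cvgrPdist_le : (hweak (mf n) (fD n)) => /(_ _ e3) h3.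
near=> t; have t0 : 0 <= t by near: t; exact: near_pinfty_ge0.
have h4 : `|\int[mu]_y (Gauss y * f n y) - \int[mu]_y (rt t y * f n y)| <= e / 3.
  by near: t.
have tr := ht t0.
have h5 := key n _ (tight_ge0 tr) (tight_itg tr) (tight_sqn_itg tr).
have h6 := key n _ (@Gauss_ge0 R d) itg_Gauss iG'.
have b5 := bnd (\int[mu]_y (rt t y * sqn y)).
have b6 := bnd (\int[mu]_y (Gauss (y : E) * sqn (y : E))).
rewrite /M le_max tight_sqn_le//= in b5; rewrite /M le_max lexx orbT in b6.
have {}b5 := b5 isT; have {}b6 := b6 isT.
set A := \int[mu]_y (_ * Gauss _) in h6 *; set B := \int[mu]_y (Gauss y * f n y) in h4 h6 *.
set A' := \int[mu]_y (_ * rt t _) in h5 *; set B' := \int[mu]_y (rt t y * f n y) in h4 h5 *.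
have {}h5 := le_trans h5 b5; have {}h6 := le_trans h6 b6.
move: h4 h5 h6; rewrite !ler_norml => /andP[? ?] /andP[? ?] /andP[? ?].
by apply/andP; split; lra.
Unshelve. all: by end_near. Qed.

(** The truncations f_n <= |y|^2 and weak convergence give the lower bound. A little mass far out
    could still carry second moment, which is why the upper bound is a hypothesis. *)
Lemma second_moment_cvg :
  (forall e, 0 < e -> \forall t \near +oo,
     \int[mu]_y (rt t y * sqn y) <= \int[mu]_y (sqn (y : E) * Gauss (y : E)) + e) ->
  \int[mu]_y (sqn (y : E) * rt t y) @[t --> +oo] -->
  \int[mu]_y (sqn (y : E) * Gauss (y : E)).
Proof.
move=> up; have [iG _] := @int_sqn_Gauss R d.
pose f n (y : E) : R := if sqn y <= n%:R then sqn y else 0.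
have msq := @measurable_sqn R d.
have mf n : measurable_fun setT (f n).
  apply: measurable_fun_ifT => //.
  by apply: measurable_fun_ler.
have f0 n y : 0 <= f n y by rewrite /f; case: ifP => // _; exact: sqn_ge0.
have fD n y : `|f n y| <= n%:R by rewrite ger0_norm// /f; case: ifP.
have fle n y : f n y <= sqn y by rewrite /f; case: ifP => // _; exact: sqn_ge0.
have [||||_ cG] := @Rint_cvg _ _ _ mu setT (fun n y => Gauss y * f n y)
  (fun y => sqn y * Gauss y) (fun y => sqn y * Gauss y) measurableT.
- by move=> n; apply: measurable_funM => //; exact: measurable_Gauss.
- move=> y _; apply: cvg_near_cst; exists (Num.truncn (sqn y)).+1 => // n /= yn.
  rewrite /f ifT 1?mulrC// (le_trans (ltW (truncnS_gt _)))//.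
  by rewrite ler_nat.
- exact: iG.
- move=> n y _; rewrite ger0_norm ?mulr_ge0 ?Gauss_ge0// mulrC ler_wpM2r// Gauss_ge0//.
apply/cvgrPdist_le => e e0.
have e2 : 0 < e / 2 by rewrite divr_gt0.
move/cvgrPdist_le : cG => /(_ _ e2) /filter_ex[n hn].
move/cvgrPdist_le : (hweak (mf n) (fD n)) => /(_ _ e2) h3.
near=> t; have t0 : 0 <= t by near: t; exact: near_pinfty_ge0.
have h4 : `|\int[mu]_y (Gauss y * f n y) - \int[mu]_y (rt t y * f n y)| <= e / 2.
  by near: t.
have h5 : \int[mu]_y (rt t y * sqn y) <= \int[mu]_y (sqn (y : E) * Gauss (y : E)) + e.
  by near: t; exact: up.
have tr := ht t0.
have h6 : \int[mu]_y (rt t y * f n y) <= \int[mu]_y (rt t y * sqn y).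
  apply: le_Rintegral => //.
  - exact: tight_bounded_itg tr (mf n) (fD n).
  - exact: tight_sqn_itg tr.
  - by move=> y _; rewrite ler_wpM2l// (tight_ge0 tr).
have -> : \int[mu]_y (sqn (y : E) * rt t y) = \int[mu]_y (rt t y * sqn y).
  by apply: eq_Rintegral => y _; rewrite mulrC.
move: hn h4; rewrite !ler_norml => /andP[? ?] /andP[? ?].
by apply/andP; split; lra.
Unshelve. all: by end_near. Qed.

End weak_convergence.

(** * Wide cutoffs, Gaussian means and Stein's equation in one variable *)

Section cutoff.
Context {R : realType}.
Local Notation leb := (@lebesgue_measure R).

Lemma test1_derive (f : R -> R) : test1 f -> test1 ('D_1 f).
Proof.
move=> tf; have [B B0 hB] := test1_supp tf; have [sf _] := tf.
split; first exact: smooth_derive.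
exists (B + 1) => x Bx; apply: (derive_eq0_out (K := `[- B, B]%classic)).
- exact: interval_closed.
- move=> y nB; apply: hB; apply/negP => /andP[/ltW h1 /ltW h2].
  by apply: nB; rewrite /= in_itv/= h1.
- by rewrite /= in_itv/= -ler_norml; apply/negP; rewrite -ltNge; lra.
Qed.

Lemma test1_bounded (f : R -> R) : test1 f ->
  exists2 C : R, 0 <= C & forall x, `|f x| <= C.
Proof.
move=> tf; have [B B0 hB] := test1_supp tf; have [sf _] := tf.
have [C hC] := smooth_bounded_itv (- B) B sf.
exists `|C| => // x; have [/andP[/ltW h1 /ltW h2]|xB] := boolP (- B < x < B).
  by apply: le_trans (ler_norm C); apply: hC; rewrite h1.
by rewrite hB// normr0.
Qed.

Definition eta0 : R -> R := bump 0 (-1) 1.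

(** [eta0] is not normalised: its value at 0 is e^(-2). Hence [cutoff n] tends to [kap] rather than
    to 1, and the powers of [kap] cancel in the end. *)
Definition kap : R := eta0 0.

Lemma kap_gt0 : 0 < kap.
Proof. by apply: bump_gt0; rewrite oppr_lt0 ltr01. Qed.

(* Unlike that of [bump n (- n) n], the derivative is O(1/n). *)
Definition cutoff (n : nat) (x : R) : R := eta0 (n.+1%:R^-1 * x + 0).

Lemma smooth_cutoff n : smooth (cutoff n).
Proof. by apply: smooth_affineR; exact: smooth_bump. Qed.

Lemma cutoff01 n x : 0 <= cutoff n x <= 1.
Proof. by rewrite bump_ge0 bump_le1. Qed.

Lemma test1_cutoff n : test1 (cutoff n).
Proof.
split; first exact: smooth_cutoff.
exists n.+1%:R => x nx; apply: bump_out.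
have n0 : 0 < n.+1%:R :> R by rewrite ltr0n.
rewrite -ltr_norml -leNgt addr0 normrM ger0_norm; last by rewrite invr_ge0 ltW.
by rewrite ler_pdivlMl// mulr1.
Qed.

Lemma cvg_cutoff x : cutoff n x @[n --> \oo] --> kap.
Proof.
rewrite /cutoff /kap; apply: continuous_cvg.
  by apply: smooth_continuous; exact: smooth_bump.
under eq_fun do rewrite addr0.
by rewrite -(mul0r x); apply: cvgMl; exact: cvg_harmonic.
Qed.

Lemma derive_cutoff_le : exists2 C : R, 0 <= C &
  forall n x, `|'D_1 (cutoff n) x| <= C / n.+1%:R.
Proof.
have [C C0 hC] := test1_bounded (test1_derive (@test1_bump R 0 (-1) 1)).
exists C => // n x.
have n0 : 0 < n.+1%:R :> R by rewrite ltr0n.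
rewrite /cutoff (derive_comp_affine (f := eta0) _ (is_diff_affineR n.+1%:R^-1 0 x)); last first.
  by apply: smooth_differentiable; exact: smooth_bump.
have [_ ->] := is_derive1_derive (n.+1%:R^-1 * 1)
  (smooth_is_derive (n.+1%:R^-1 * x + 0) (@smooth_bump R 0 (-1) 1)).
rewrite mulr1 normrM ger0_norm; last by rewrite invr_ge0 ltW.
by rewrite mulrC ler_wpM2r// invr_ge0 ltW.
Qed.

Definition gmean (f : R -> R) : R := \int[leb]_x (f x * gaussc 1 x).

Lemma test1_gaussM (f : R -> R) : test1 f -> test1 (fun x => f x * gaussc 1 x).
Proof. by move=> tf; under eq_fun do rewrite mulrC; apply: test1M => //; exact: smooth_gaussc. Qed.

(* One-dimensional Stein equation for the Gaussian weight. *)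
Lemma stein1 (g : R -> R) : test1 g -> gmean g = 0 ->
  exists2 psi, test1 psi & forall x, g x = 'D_1 psi x - 2 * x * psi x.
Proof.
move=> tg g0; have [F tF dF] := test1_primitive (test1_gaussM tg) g0.
have sg := @smooth_gaussc R (-1).
(* psi = e^(x^2) F, where F is the primitive of g e^(-x^2); the zero mean makes F, hence psi,
   compactly supported. *)
exists (fun x => gaussc (-1) x * F x); first exact: test1M.
move=> x.
have dM : is_derive x (1 : R) (fun x => gaussc (-1) x * F x) _ :=
  @is_deriveM _ _ (gaussc (-1)) F x 1 _ _ (is_derive_gaussc (-1) x)
  (smooth_is_derive x (proj1 tF)).
have dFx : 'D_1 F x = g x * gaussc 1 x by have := congr1 (fun h => h x) dF.
have e1 := @derive_val _ _ _ _ _ _ _ dM; rewrite e1 dFx /GRing.scale/=.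
have e : gaussc (-1) x * gaussc 1 x = 1 :> R.
  by rewrite /gaussc -expRD mulN1r mul1r opprK subrr expR0.
rewrite mulrCA e mulr1; ring.
Qed.

Lemma gmean_cutoff : gmean (cutoff n) @[n --> \oo] --> kap * \int[leb]_x gaussc 1 x.
Proof.
have [||||_] := @Rint_cvg _ _ _ leb setT (fun n x => cutoff n x * gaussc 1 x)
  (fun x => kap * gaussc 1 x) (gaussc 1) measurableT.
- move=> n; apply: continuous_measurable_fun; apply: smooth_continuous.
  by apply: smoothM; [exact: smooth_cutoff|exact: smooth_gaussc].
- by move=> x _; apply: cvgMl; exact: cvg_cutoff.
- exact: itg1_gauss1.
- move=> n x _; have /andP[c0 c1] := cutoff01 n x.
  by rewrite normrM !ger0_norm ?expR_ge0// ler_piMl ?expR_ge0.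
by rewrite RintegralZl//; exact: itg1_gauss1.
Qed.

(** If the mean were 0, Stein's equation would give a compactly supported primitive F of [cutoff n]
    times the Gaussian. F would be nondecreasing, hence 0, against the positivity of [cutoff n] at
    0. *)
Lemma gmean_cutoff_gt0 n : 0 < gmean (cutoff n).
Proof.
have n0 : 0 < n.+1%:R :> R by rewrite ltr0n.
have ge0 : 0 <= gmean (cutoff n).
  by apply: Rintegral_ge0 => x _; rewrite mulr_ge0 ?expR_ge0//; case/andP: (cutoff01 n x).
rewrite lt_neqAle ge0 andbT; apply/eqP => /esym m0.
have [psi tpsi hpsi] := stein1 (test1_cutoff n) m0.
pose F x := psi x * gaussc 1 x.
have dF x : is_derive x (1 : R) F (cutoff n x * gaussc 1 x).
  have := @is_deriveM _ _ psi (gaussc 1) x 1 _ _ (smooth_is_derive x (proj1 tpsi)) (is_derive_gaussc 1 x).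
  by move/is_derive_eq; apply; rewrite /GRing.scale/= hpsi; ring.
have tF : test1 F by exact: test1_gaussM.
have [B B0 hB] := test1_supp tF.
have ndF : {homo F : x y / x <= y}.
  move=> x y xy; apply: (@ger0_derive1_ndecr _ F x y) => //.
  - move=> z _; rewrite derive1E (@derive_val _ _ _ _ _ _ _ (dF z)) mulr_ge0 ?expR_ge0//.
    by case/andP: (cutoff01 n z).
  - apply: continuous_subspaceT; exact: smooth_continuous (proj1 tF).
have F0 x : F x = 0.
  pose C := `|x| + B.
  have C0 := ler_norm x; have C1 := ler_norm (- x); rewrite normrN in C1.
  have h1 : F (- C) = 0 by apply: hB; rewrite negb_and -!leNgt /C; apply/orP; left; have := normr_ge0 x; lra.
  have h2 : F C = 0 by apply: hB; rewrite negb_and -!leNgt /C; apply/orP; right; have := normr_ge0 x; lra.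
  have : F (- C) <= F x by apply: ndF; rewrite /C; lra.
  have : F x <= F C by apply: ndF; rewrite /C; lra.
  by rewrite h1 h2 => ? ?; apply/eqP; rewrite eq_le; apply/andP.
have := @derive_val _ _ _ _ _ _ _ (dF 0).
rewrite (_ : F = cst 0) ?derive_cst; last exact/funext.
move/esym/eqP; rewrite mulf_eq0 => /orP[|]; last by rewrite gt_eqF// expR_gt0.
rewrite gt_eqF// /cutoff; apply: bump_gt0.
by rewrite mulr0 addr0 oppr_lt0 ltr01.
Qed.

End cutoff.

(** * Convergence against products of one-variable test functions *)

Section product_tests.
Context {R : realType} {d : nat}.
Local Notation E := 'rV[R]_d.
Local Notation mu := (lebesgue_rV d).
Local Notation leb := (@lebesgue_measure R).
Local Notation itg f := (mu.-integrable setT (fun x => (f x)%:E)).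
Context (C : R) (rt : R -> E -> R) (ht : forall t, 0 <= t -> tight C (rt t)).
Context (hmass : forall t, 0 <= t -> \int[mu]_y rt t y = \int[mu]_y (Gauss y : R)).
Context (hA : forall j (psi : 'I_d -> R -> R), (forall i, test1 (psi i)) ->
  \int[mu]_y (rt t y * (partial j (prodf psi) y - 2 * (y : E) ord0 j * prodf psi y))
    @[t --> +oo] --> (0 : R)).

Let A t (f : 'I_d -> R -> R) := \int[mu]_y (rt t y * prodf f y).

Lemma test1_upd (f : 'I_d -> R -> R) j g : (forall i, test1 (f i)) -> test1 g ->
  forall i, test1 (upd f j g i).
Proof. by move=> tf tg i; rewrite /upd; case: ifP. Qed.

Lemma stein_coord (f : 'I_d -> R -> R) j g : (forall i, test1 (f i)) -> test1 g ->
  gmean g = 0 -> A t (upd f j g) @[t --> +oo] --> (0 : R).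
Proof.
move=> tf tg g0; have [psi tpsi hpsi] := stein1 tg g0.
have := hA j (test1_upd j tf tpsi).
have e t : A t (upd f j g) = \int[mu]_y (rt t y *
    (partial j (prodf (upd f j psi)) y - 2 * (y : E) ord0 j * prodf (upd f j psi) y)).
  apply: eq_Rintegral => y _; congr (_ * _).
  rewrite partial_prodf; last by move=> i; case: (test1_upd j tf tpsi i).
  by rewrite upd_upd updE !prodf_upd hpsi; ring.
by under [in X in _ -> X]eq_fun do rewrite e.
Qed.

Lemma itg_test1_prodf t f : 0 <= t -> (forall i, test1 (f i)) ->
  itg (fun y => rt t y * prodf f y).
Proof.
move=> t0 tf; have [D D0 hD] := test_fun_bounded (test_prodf tf).
by apply: (tight_bounded_itg (ht t0) _ hD); apply: test_fun_measurable; exact: test_prodf.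
Qed.

(** Subtracting the multiple of [cutoff n] with the same Gaussian mean leaves a factor of mean zero,
    to which Stein's equation applies. [cutoff n] stands in for the constant 1, which has no compact
    support. *)
Lemma swap_coord (f : 'I_d -> R -> R) j n : (forall i, test1 (f i)) ->
  A t f - gmean (f j) / gmean (cutoff n) * A t (upd f j (cutoff n))
    @[t --> +oo] --> (0 : R).
Proof.
move=> tf; set c := gmean (f j) / _.
pose g x := f j x - c * cutoff n x.
have tg : test1 g.
  have [sf [B hB]] := tf j; have [sc [B' hB']] := @test1_cutoff R n.
  split; first by apply: smoothB => //; exact: smoothZ.
  by exists (Num.max B B') => x; rewrite ge_max => /andP[/hB e1 /hB' e2]; rewrite /g e1 e2 mulr0 subrr.
have g0 : gmean g = 0.
  rewrite /gmean; under eq_Rintegral do rewrite mulrBl -mulrA.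
  have i1 := itg1_test1 (test1_gaussM (tf j)).
  have i2 := itg1_test1 (test1_gaussM (test1_cutoff n)).
  rewrite RintegralB//; last exact: itgZ.
  by rewrite RintegralZl// -/(gmean (cutoff n)) /c divfK ?gt_eqF ?gmean_cutoff_gt0// subrr.
apply: cvg_trans (@stein_coord f j g tf tg g0); apply: near_eq_cvg.
near=> t; have t0 : 0 <= t by near: t; exact: near_pinfty_ge0.
have i2 := itg_test1_prodf t0 (test1_upd j tf (test1_cutoff n)).
have i1 := itg_test1_prodf t0 tf.
rewrite -RintegralZl// -RintegralB//; last exact: itgZ.
apply: eq_Rintegral => y _.
rewrite -[in prodf f y](upd_id f j) !prodf_upd /g; ring.
Unshelve. all: by end_near. Qed.

Lemma swap_all (f : 'I_d -> R -> R) n : (forall i, test1 (f i)) ->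
  A t f - (\prod_i gmean (f i)) / gmean (cutoff n) ^+ d * A t (fun=> cutoff n)
    @[t --> +oo] --> (0 : R).
Proof.
move=> tf; pose v : R := gmean (cutoff n).
(* In [fk k] the first k factors are already replaced; each further swap contributes gmean (f j) / v
   to the prefactor. *)
pose fk k : 'I_d -> R -> R := fun i => if (i < k)%N then cutoff n else f i.
have tfk k i : test1 (fk k i) by rewrite /fk; case: ifP => // _; exact: test1_cutoff.
have v0 : v != 0 by rewrite gt_eqF// gmean_cutoff_gt0.
have ind k : (k <= d)%N ->
    A t f - (\prod_(i < d | (i < k)%N) gmean (f i)) / v ^+ k * A t (fk k) @[t --> +oo] --> (0 : R).
  elim: k => [_|k ih kd].
    have e : fk 0 = f by apply/funext => i.
    rewrite e big_pred0// expr0 divr1; under eq_fun do rewrite mul1r subrr.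
    exact: cvg_cst.
  have {}ih := ih (ltnW kd).
  pose j : 'I_d := Ordinal kd.
  have fkS : fk k.+1 = upd (fk k) j (cutoff n).
    apply/funext => i; rewrite /fk /upd ltnS leq_eqVlt -val_eqE/=.
    by case: eqP.
  have fkj : fk k j = f j by rewrite /fk ltnn.
  have s := swap_coord j n (tfk k); rewrite fkj -fkS -/v in s.
  pose p := (\prod_(i < d | (i < k)%N) gmean (f i)) / v ^+ k.
  have s' : p * (A t (fk k) - gmean (f j) / v * A t (fk k.+1)) @[t --> +oo] --> p * 0.
    exact: (cvgM (cvg_cst p) s).
  have s2 := cvgD ih s'; rewrite mulr0 addr0 in s2.
  apply: cvg_trans (s2 _); apply: near_eq_cvg; apply: nearW => t /=.
  have -> : \prod_(i < d | (i < k.+1)%N) gmean (f i) =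
      gmean (f j) * \prod_(i < d | (i < k)%N) gmean (f i).
    rewrite (bigD1 j)//=; congr (_ * _); apply: eq_bigl => i.
    by rewrite ltnS leq_eqVlt -val_eqE/=; case: (ltngtP i k).
  transitivity (A t f - p * A t (fk k) + p * (A t (fk k) - gmean (f j) / v * A t (fk k.+1))) => //.
  by rewrite /p exprS invfM; ring.
have := ind d (leqnn _).
have -> : \prod_(i < d | (i < d)%N) gmean (f i) = \prod_i gmean (f i).
  by apply: eq_bigl => i; rewrite ltn_ord.
by have -> : fk d = (fun=> cutoff n) by apply/funext => i; rewrite /fk ltn_ord.
Qed.

(** Swapping all factors turns [A t f] into P / gmean(cutoff n)^d times the integral of the density
    against the product of cutoffs. For large n the prefactor is close to P / (kap^d M) and,
    uniformly in t, the integral is close to kap^d M by tightness and conservation of mass; so the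
    limit is P. *)
Lemma bump_cvg (f : 'I_d -> R -> R) : (forall i, test1 (f i)) -> (forall i x, 0 <= f i x) ->
  A t f @[t --> +oo] --> \int[mu]_y (Gauss y * prodf f y).
Proof.
move=> tf f0.
pose P := \prod_i gmean (f i).
have -> : \int[mu]_y (Gauss y * prodf f y) = P.
  rewrite /P /gmean; have [|||_ <-] := @itg_prodf_Gauss R d f.
  - by move=> i; apply: continuous_measurable_fun; apply: smooth_continuous; case: (tf i).
  - exact: f0.
  - by move=> i; exact: itg1_test1 (test1_gaussM (tf i)).
  by apply: eq_Rintegral => y _; rewrite mulrC.
pose M := \int[mu]_y (Gauss y : R).
have M0 : 0 < M by exact: int_Gauss_gt0.
pose q n := P / gmean (cutoff n) ^+ d.
pose kd : R := kap ^+ d.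
have kd0 : 0 < kd by rewrite exprn_gt0// kap_gt0.
have cq : q n @[n --> \oo] --> P / (kd * M).
  apply: cvgMr; apply: cvgV; first by rewrite mulf_neq0 ?gt_eqF.
  rewrite /M int_Gauss /kd -exprMn.
  elim: (d) => [|k ih]; first by under eq_fun do rewrite expr0; rewrite expr0; exact: cvg_cst.
  rewrite exprS; under eq_fun do rewrite exprS.
  by apply: cvgM => //; exact: gmean_cutoff.
apply/cvgrPdist_le => e e0.
have e3 : 0 < e / 3 by rewrite divr_gt0.
pose Q := `|P / (kd * M)| + 1.
have Q0 : 0 < Q by rewrite ltr_pwDr.
have [n [h1 h2 h3]] : exists n, [/\ `|q n * (kd * M) - P| <= e / 3, `|q n| <= Q &
    forall r, tight C r -> `|\int[mu]_y (r y * prodf (fun=> cutoff n) y) -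
      \int[mu]_y (r y * kd)| <= e / 3 / Q].
  have c1 : q n * (kd * M) @[n --> \oo] --> P.
    rewrite -[X in _ --> X](divfK (_ : kd * M != 0)) ?mulf_neq0 ?gt_eqF//.
    exact: cvgMl.
  have c3 : forall y : E, prodf (fun=> cutoff n) y @[n --> \oo] --> kd.
    move=> y; rewrite (_ : kd = prodf (fun=> cst kap) y); last first.
      by rewrite /prodf /= prodr_const card_ord.
    by apply: cvg_prodf => i; exact: cvg_cutoff.
  near \oo => n; exists n; split; near: n.
  - by move/cvgrPdist_le : c1 => /(_ _ e3); apply: filterS => n; rewrite distrC.
  - move/cvgrPdist_le : cq => /(_ _ ltr01); apply: filterS => n h.
    have := ler_normD (q n - P / (kd * M)) (P / (kd * M)); rewrite subrK; rewrite distrC in h.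
    by rewrite /Q; lra.
  - apply: (tight_unif_cvg C (f_ := fun n => prodf (fun=> cutoff n)) (f := fun=> kd) (D := 1)) => //.
    + by move=> n; apply: measurable_prodf => i; apply: continuous_measurable_fun; apply: smooth_continuous; exact: smooth_cutoff.
    + move=> n y; rewrite ger0_norm; first by apply: prodf_le1 => i x; exact: cutoff01.
      by apply: prodf_ge0 => i x; case/andP: (cutoff01 n x).
    + by rewrite divr_gt0.
move/cvgr0Pnorm_le : (swap_all n tf) => /(_ _ e3) h4.
near=> t; have t0 : 0 <= t by near: t; exact: near_pinfty_ge0.
have h5 : `|A t f - q n * A t (fun=> cutoff n)| <= e / 3 by near: t.
have h6 := h3 _ (ht t0).
rewrite -/(A t _) RintegralZr ?hmass// in h6; last exact: tight_itg (ht t0).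
have h7 : `|q n * A t (fun=> cutoff n) - q n * (kd * M)| <= e / 3.
  rewrite -mulrBr normrM [kd * _]mulrC.
  apply: (@le_trans _ _ (Q * (e / 3 / Q))); first exact: ler_pM.
  by rewrite mulrC divfK ?gt_eqF.
move: h1 h5 h7; rewrite !ler_norml => /andP[? ?] /andP[? ?] /andP[? ?].
by apply/andP; split; lra.
Unshelve. all: by end_near. Qed.

End product_tests.

(** * The scaling function tau *)

Section half_line_calculus.
Context {R : realType}.
Local Notation leb := (@lebesgue_measure R).

Lemma deriv_ge0_ball (f : R -> R) (t l e : R) : 0 < e -> deriv_ge0 f t l ->
  exists2 r : R, 0 < r & forall h, h != 0 -> `|h| < r -> 0 <= t + h ->
    `|l - h^-1 * (f (t + h) - f t)| <= e.
Proof.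
move=> e0 /cvgrPdist_le /(_ _ e0); rewrite near_withinE => /nbhs_ballP[r r0 hr].
exists r => // h h0 hlt th; apply: hr => //.
by rewrite /ball/= sub0r normrN.
Qed.

(** For t > 0 every increment with |h| < t stays in the half-line, so the restricted quotient is the
    ordinary one. *)
Lemma deriv_ge0_is_derive (f : R -> R) (t l : R) : 0 < t -> deriv_ge0 f t l ->
  is_derive t (1 : R) f l.
Proof.
move=> t0 fl.
have c : h^-1 *: (f (h *: (1 : R) + t) - f t) @[h --> 0^'] --> l.
  apply/cvgrPdist_le => e e0; have [r r0 hr] := deriv_ge0_ball e0 fl.
  have rt : 0 < Num.min r t by rewrite lt_min r0.
  apply/nbhs_ballP; exists (Num.min r t) => // h; rewrite /ball/= sub0r normrN lt_min.
  move=> /andP[h1 h2] hn.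
  have -> : h^-1 *: (f (h *: (1 : R) + t) - f t) = h^-1 * (f (t + h) - f t).
    by rewrite /GRing.scale/= mulr1 addrC [t + h]addrC addrC.
  apply: hr => //.
  by have := ler_norm (- (h : R)); rewrite normrN; lra.
apply: DeriveDef; first by apply/cvg_ex; exists l.
exact/cvg_lim.
Qed.

Lemma deriv_ge0_continuous (f g : R -> R) : (forall t, 0 <= t -> deriv_ge0 f t (g t)) ->
  {within `[0, +oo[, continuous f}.
Proof.
move=> fg; apply/subspace_continuousP => t; rewrite /= in_itv/= andbT => t0.
apply/cvgrPdist_le => e e0; rewrite near_withinE.
have [r r0 hr] := deriv_ge0_ball ltr01 (fg t t0).
pose K := `|g t| + 1.
have K0 : 0 < K by rewrite ltr_pwDr.
have r2 : 0 < Num.min r (e / K) by rewrite lt_min r0 divr_gt0.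
apply/nbhs_ballP; exists (Num.min r (e / K)) => // x.
rewrite /ball/= lt_min => /andP[h1 h2]; rewrite in_itv/= andbT => x0.
have [->|xt] := eqVneq x t; first by rewrite subrr normr0 ltW.
have h0 : x - t != 0 by rewrite subr_eq0.
rewrite distrC in h1; have := hr _ h0 h1; rewrite addrC subrK => /(_ x0) h3.
have h4 : `|(x - t)^-1 * (f x - f t)| <= K.
  have := ler_normB (g t) (g t - (x - t)^-1 * (f x - f t)); rewrite opprB addrC subrK.
  by rewrite /K; lra.
have -> : f t - f x = - ((x - t) * ((x - t)^-1 * (f x - f t))) by rewrite mulVKf//; ring.
rewrite normrN normrM.
move: h2; rewrite ltr_pdivlMr// distrC => /ltW; apply: le_trans.
by rewrite ler_wpM2l.
Qed.

Lemma within_ge0_sub (f : R -> R) (a b : R) : 0 <= a -> {within `[0, +oo[, continuous f} ->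
  {within `[a, b], continuous f}.
Proof.
move=> a0; apply: continuous_subspaceW => x; rewrite /= !in_itv/= andbT => /andP[ax _].
exact: le_trans ax.
Qed.

Lemma half_line_MVT (f g : R -> R) (a b : R) : {within `[0, +oo[, continuous f} ->
  (forall t : R, 0 < t -> is_derive t (1 : R) f (g t)) -> 0 <= a -> a < b ->
  exists2 c, a < c < b & f b - f a = g c * (b - a).
Proof.
move=> cf df a0 ab.
have [||c] := @MVT R f g a b ab.
- by move=> x; rewrite in_itv/= => /andP[ax _]; apply: df; exact: le_lt_trans ax.
- exact: within_ge0_sub.
by rewrite in_itv/= => cab e; exists c.
Qed.

Lemma half_line_ndecr (f g : R -> R) : {within `[0, +oo[, continuous f} ->
  (forall t : R, 0 < t -> is_derive t (1 : R) f (g t)) -> (forall t : R, 0 < t -> 0 <= g t) ->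
  forall a b : R, 0 <= a -> a <= b -> f a <= f b.
Proof.
move=> cf df g0 a b a0; rewrite le_eqVlt => /predU1P[-> //|ab].
have [c /andP[ac _] e] := half_line_MVT cf df a0 ab.
rewrite -subr_ge0 e mulr_ge0//; last by rewrite subr_ge0 ltW.
by apply: g0; exact: le_lt_trans ac.
Qed.

Lemma half_line_measurable (f : R -> R) : {within `[0, +oo[, continuous f} ->
  measurable_fun `[(0 : R), +oo[ f.
Proof. by move=> cf; apply: subspace_continuous_measurable_fun. Qed.

End half_line_calculus.

Section tau_theory.
Context {R : realType} (tau dtau : R -> R) (htau : tau_solution tau dtau).
Local Notation leb := (@lebesgue_measure R).

Let tau0 : tau 0 = 1. Proof. by case: htau. Qed.
Let dtau0 : dtau 0 = 0. Proof. by case: htau. Qed.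

Lemma tau_gt0 (t : R) : 0 <= t -> 0 < tau t.
Proof. by move=> t0; case: htau => _ _ /(_ t t0)[]. Qed.

Lemma tau_continuous : {within `[0, +oo[, continuous tau}.
Proof.
by apply: (@deriv_ge0_continuous _ _ dtau) => t t0; case: htau => _ _ /(_ t t0)[].
Qed.

Lemma dtau_continuous : {within `[0, +oo[, continuous dtau}.
Proof.
by apply: (@deriv_ge0_continuous _ _ (fun t => 2 / tau t)) => t t0; case: htau => _ _ /(_ t t0)[].
Qed.

Lemma is_derive_tau (t : R) : 0 < t -> is_derive t (1 : R) tau (dtau t).
Proof.
move=> t0; apply: deriv_ge0_is_derive => //.
by case: htau => _ _ /(_ t (ltW t0))[].
Qed.

Lemma is_derive_dtau (t : R) : 0 < t -> is_derive t (1 : R) dtau (2 / tau t).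
Proof.
move=> t0; apply: deriv_ge0_is_derive => //.
by case: htau => _ _ /(_ t (ltW t0))[].
Qed.

Lemma dtau_ndecr (a b : R) : 0 <= a -> a <= b -> dtau a <= dtau b.
Proof.
apply: (half_line_ndecr dtau_continuous is_derive_dtau) => t t0.
by rewrite divr_ge0// ltW// tau_gt0// ltW.
Qed.

Lemma dtau_ge0 (t : R) : 0 <= t -> 0 <= dtau t.
Proof. by move=> t0; rewrite -dtau0 dtau_ndecr. Qed.

Lemma dtau_gt0 (t : R) : 0 < t -> 0 < dtau t.
Proof.
move=> t0; have [c /andP[c0 ct]] := half_line_MVT dtau_continuous is_derive_dtau (lexx 0) t0.
rewrite dtau0 !subr0 => ->; rewrite mulr_gt0// divr_gt0// tau_gt0//; exact: ltW.
Qed.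

Lemma tau_ndecr (a b : R) : 0 <= a -> a <= b -> tau a <= tau b.
Proof.
by apply: (half_line_ndecr tau_continuous is_derive_tau) => t t0; rewrite dtau_ge0// ltW.
Qed.

Lemma tau_ge1 (t : R) : 0 <= t -> 1 <= tau t.
Proof. by move=> t0; rewrite -tau0 tau_ndecr. Qed.

(** First integral of the equation: both sides vanish at 0 and have derivative 4 tau' / tau. *)
Lemma dtau_sqr (t : R) : 0 <= t -> dtau t ^+ 2 = 4 * ln (tau t).
Proof.
rewrite le_eqVlt => /predU1P[<-|t0]; first by rewrite dtau0 tau0 ln1 expr0n mulr0.
pose f t := dtau t ^+ 2 - 4 * ln (tau t).
have cf : {within `[0, +oo[, continuous f}.
  apply/subspace_continuousP => x x0; apply: cvgB.
    have /subspace_continuousP/(_ x x0) c := dtau_continuous.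
    exact: (@cvg_comp _ _ _ dtau (fun y => y ^+ 2) _ _ _ c (@exprn_continuous _ 2 _)).
  apply: cvgM; first exact: cvg_cst.
  have /subspace_continuousP/(_ x x0) c := tau_continuous.
  apply: (@cvg_comp _ _ _ tau (@ln R) _ _ _ c); apply: continuous_ln.
  by apply: tau_gt0; move: x0; rewrite /= in_itv/= andbT.
have df (x : R) : 0 < x -> is_derive x (1 : R) f 0.
  move=> x0; have tx := tau_gt0 (ltW x0).
  have d1 := is_derive_dtau x0; have d2 := is_derive_tau x0.
  have d3 := is_derive1_comp (is_derive1_ln tx) d2.
  have := is_deriveB (is_deriveX 2 d1) (is_deriveZ 4 d3).
  move/is_derive_eq; apply; rewrite /GRing.scale/= expr1.
  by field; rewrite gt_eqF.
have [c _] := half_line_MVT cf df (lexx 0) t0.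
by rewrite mul0r /f dtau0 tau0 ln1 expr0n/= mulr0 subr0 subr0 => /eqP; rewrite subr_eq0 => /eqP.
Qed.

(** tau' is nondecreasing, so beyond time 1 the slope of tau is at least tau'(1). *)
Lemma tau_ge_linear (t : R) : 1 <= t -> 1 + (t - 1) * dtau 1 <= tau t.
Proof.
rewrite le_eqVlt => /predU1P[<-|t1]; first by rewrite subrr mul0r addr0 tau_ge1.
have [c /andP[c1 ct] e] := half_line_MVT tau_continuous is_derive_tau ler01 t1.
have := tau_ge1 (@ler01 R); have := dtau_ndecr (@ler01 R) (ltW c1).
move=> h1 h2; have : (t - 1) * dtau 1 <= dtau c * (t - 1) by rewrite mulrC ler_wpM2r// subr_ge0 ltW.
lra.
Qed.

Lemma tau_le_linear (t : R) : 0 <= t -> tau t <= 1 + t * dtau t.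
Proof.
rewrite le_eqVlt => /predU1P[<-|t0]; first by rewrite tau0 mul0r addr0.
have [c /andP[c0 ct] e] := half_line_MVT tau_continuous is_derive_tau (lexx 0) t0.
rewrite tau0 subr0 in e.
have : dtau c * t <= t * dtau t by rewrite mulrC ler_wpM2l// ?(ltW t0)// dtau_ndecr ?ltW.
lra.
Qed.

Lemma dtau_le (t : R) : 0 <= t -> dtau t <= 2 * t.
Proof.
rewrite le_eqVlt => /predU1P[<-|t0]; first by rewrite dtau0 mulr0.
have [c /andP[c0 ct]] := half_line_MVT dtau_continuous is_derive_dtau (lexx 0) t0.
rewrite dtau0 !subr0 => ->; rewrite ler_wpM2r ?(ltW t0)// ler_pdivrMr ?tau_gt0 ?(ltW c0)//.
by have := tau_ge1 (ltW c0); lra.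
Qed.

Lemma tau_cvg : tau t @[t --> +oo] --> +oo.
Proof.
apply/cvgryPge => A; near=> t.
have t1 : 1 <= t by near: t; exact: nbhs_pinfty_ge.
have d1 := dtau_gt0 (@ltr01 R).
apply: le_trans (tau_ge_linear t1).
have : A / dtau 1 + 1 <= t by near: t; apply: nbhs_pinfty_ge; exact: num_real.
rewrite -lerBrDr ler_pdivrMr//; lra.
Unshelve. all: by end_near. Qed.

Lemma ln_tau_cvg : ln (tau t) @[t --> +oo] --> +oo.
Proof.
apply/cvgryPge => A; near=> t.
have t0 : 0 <= t by near: t; exact: near_pinfty_ge0.
rewrite -ler_expR lnK ?posrE ?tau_gt0//.
by near: t; move/cvgryPge : tau_cvg; exact.
Unshelve. all: by end_near. Qed.

End tau_theory.

Lemma dist01 (R : realDomainType) (x y : R) : 0 <= x <= 1 -> 0 <= y <= 1 -> `|x - y| <= 1.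
Proof. by move=> /andP[? ?] /andP[? ?]; rewrite ler_norml; apply/andP; split; lra. Qed.

Lemma dist_le3 (R : realFieldType) (x y u v e c : R) : `|x - u| <= e / 2 ->
  `|y - v| <= e / 2 -> `|x - y| <= c -> `|v - u| <= c + e.
Proof.
rewrite !ler_norml => /andP[? ?] /andP[? ?] /andP[? ?]; apply/andP; split; lra.
Qed.

(** * Continuous functions of time whose weak derivative is bounded *)

Section slow_variation.
Context {R : realType}.
Local Notation leb := (@lebesgue_measure R).
Local Notation itg D f := (leb.-integrable D (fun x => (f x)%:E)).

Lemma is_derive_const_itv (F : R -> R) (a b : R) : a <= b ->
  (forall x, is_derive x (1 : R) F ('D_1 F x)) ->
  (forall x, a < x < b -> 'D_1 F x = 0) -> F a = F b.
Proof.
rewrite le_eqVlt => /predU1P[-> //|ab] dF d0.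
have [|c] := @MVT R F ('D_1 F) a b ab.
  apply: continuous_subspaceT => x; apply: differentiable_continuous.
  exact: (is_derive1_derive 1 (dF x)).1.
by rewrite in_itv/= => cab; rewrite d0// mul0r => /eqP; rewrite subr_eq0 => /eqP.
Qed.

(** [B] is a primitive of the bump on ]0, e[ divided by its total increase K. If K were 0, the
    monotone primitive would be constant on [0, e] and the bump would vanish at e / 2. *)
Lemma smooth_step (e : R) : 0 < e -> exists B b : R -> R,
  [/\ smooth B, smooth b, forall x, is_derive x (1 : R) B (b x),
      forall x, 0 <= b x & forall x, ~~ (0 < x < e) -> b x = 0] /\
  [/\ forall x, x <= 0 -> B x = 0, forall x, e <= x -> B x = 1 &
      forall x, 0 <= B x <= 1].
Proof.
move=> e0.
pose g : R -> R := bump 0 0 e.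
have sg : smooth g by exact: smooth_bump.
pose F x := \int[leb]_(t in `[0 - 1, x]) g t.
have dF x : is_derive x (1 : R) F (g x).
  apply: is_derive_primitive; first exact: smooth_continuous.
  by move=> y y0; apply: bump_out; rewrite ltNge y0.
have dF1 x : 'D_1 F x = g x by rewrite (@derive_val _ _ _ _ _ _ _ (dF x)).
have dF' x : is_derive x (1 : R) F ('D_1 F x) by rewrite dF1.
have sF : smooth F by exact: smooth_primitive dF.
have ndF : {homo F : x y / x <= y}.
  move=> x y xy; apply: (@ger0_derive1_ndecr _ F x y) => //.
  - by move=> z _; rewrite derive1E dF1 bump_ge0.
  - by apply: continuous_subspaceT; exact: smooth_continuous.
have F0 x : x <= 0 -> F x = F 0.
  move=> x0; apply: is_derive_const_itv => // y /andP[_ y0].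
  by rewrite dF1 /g bump_out// ltNge (ltW y0).
have Fe x : e <= x -> F x = F e.
  move=> ex; apply/esym; apply: is_derive_const_itv => // y /andP[y0 _].
  by rewrite dF1 /g bump_out// negb_and orbC -leNgt (ltW y0).
pose K := F e - F 0.
have K0 : 0 < K.
  rewrite subr_gt0 lt_neqAle ndF ?ltW// andbT; apply/eqP => Fe0.
  have FE x : 0 <= x <= e -> F x = F 0.
    by move=> /andP[x0 xe]; apply/eqP; rewrite eq_le [in X in X && _]Fe0 !ndF.
  have : 0 < g (e / 2) by apply: bump_gt0; apply/andP; split; lra.
  rewrite -dF1 (@near_eq_derive _ _ _ _ (cst (F 0))) ?derive_cst ?ltxx//.
  have h1 : 0 < e / 2 by lra.
  have h2 : e / 2 < e by lra.
  near=> y; apply: FE; apply/andP; split; apply: ltW.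
    by near: y; exact: lt_nbhsr.
  by near: y; exact: lt_nbhsl.
exists (fun x => K^-1 * (F x + - F 0)), (fun x => K^-1 * g x); split; split.
- by apply: smoothZ; apply: smoothD => //; exact: smooth_cst.
- exact: smoothZ.
- move=> x; have := is_deriveZ K^-1 (is_deriveD (dF x) (is_derive_cst (- F 0) x 1)).
  by move/is_derive_eq; apply; rewrite addr0.
- by move=> x; rewrite mulr_ge0 ?bump_ge0// invr_ge0 ltW.
- by move=> x h; rewrite /g bump_out// mulr0.
- by move=> x x0; rewrite F0// subrr mulr0.
- by move=> x xe; rewrite Fe// mulVf// gt_eqF.
- move=> x; have iK : 0 < K^-1 by rewrite invr_gt0.
  rewrite pmulr_rge0// ler_pdivrMl// mulr1 subr_ge0 lerD2r; apply/andP; split.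
    by have [x0|x0] := leP x 0; [rewrite F0|exact: ndF (ltW x0)].
  by have [x0|x0] := leP e x; [rewrite Fe|exact: ndF (ltW x0)].
Unshelve. all: by end_near. Qed.

Context (a g : R -> R) (a0 : R) (ca : {within `[0, +oo[, continuous a})
  (g0 : forall t, 0 <= t -> 0 <= g t) (ig : forall T, itg `[0, T] g).
(** This is the weak form of |a'| <= g with initial value [a0]. *)
Context (hw : forall T (th : R -> R) b, 0 < T -> b < T -> smooth th ->
  (forall t, b < t -> th t = 0) ->
  `|\int[leb]_(t in `]0, T[) ('D_1 th t * a t) + th 0 * a0| <=
    \int[leb]_(t in `]0, T[) (`|th t| * g t)).

Let ia (T : R) : itg `]0, T[ a.
Proof.
have h : itg `[0, T] a.
  apply: continuous_compact_integrable; first exact: segment_compact.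
  exact: within_ge0_sub ca.
by apply: integrableS h => //; exact: subset_itv_oo_cc.
Qed.

Let igo (T : R) : itg `]0, T[ g.
Proof. by apply: integrableS (ig T) => //; exact: subset_itv_oo_cc. Qed.

(* [p] is a mollified Dirac mass just after [t] and [P] its primitive. *)
Let mollifier (t e : R) : 0 <= t -> 0 < e -> exists P p : R -> R,
  [/\ smooth P, forall x, is_derive x (1 : R) P (p x), forall x, 0 <= P x <= 1,
      forall x, x <= t -> P x = 0 & forall x, t + 1 <= x -> P x = 1] /\
  forall T, t + 1 < T -> itg `]0, T[ (fun x => p x * a x) /\
    `|\int[leb]_(x in `]0, T[) (p x * a x) - a t| <= e.
Proof.
move=> t0 e0.
have tin : `[0, +oo[%classic t by rewrite /= in_itv/= t0.
have /subspace_continuousP/(_ t tin)/cvgrPdist_le/(_ e e0) := ca.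
rewrite near_withinE => /nbhs_ballP[r0 r00 hr].
(* The width is at most 1 whatever the radius of continuity, so the step is over by time t + 1. *)
have r_gt0 : 0 < Num.min r0 1 by rewrite lt_min r00 ltr01.
have [B [b [[sB sb dB b0 bs] [B0 B1 B01]]]] := smooth_step r_gt0.
have Pl x : x <= t -> B (1 * x + - t) = 0 by move=> xt; rewrite B0// mul1r subr_le0.
have Pr x : t + 1 <= x -> B (1 * x + - t) = 1.
  by move=> tx; rewrite B1// mul1r lerBrDl (le_trans _ tx)// lerD2l ge_min lexx orbT.
have dP x := is_derive_affineR 1 (- t) x dB.
exists (fun x => B (1 * x + - t)), (fun x => 1 * b (1 * x + - t)); split.
  by split => //; exact: smooth_affineR.
move=> T tT; have T0 : 0 < T by apply: lt_trans tT; rewrite ltr_wpDl.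
have cp : continuous (fun x : R => 1 * b (1 * x + - t)).
  by apply: smooth_continuous; apply: smoothZ; exact: smooth_affineR.
have ip : itg `]0, T[ (fun x : R => 1 * b (1 * x + - t)).
  by apply: integrableS (itg1_continuous 0 T cp) => //; exact: subset_itv_oo_cc.
have i1 : \int[leb]_(x in `]0, T[) (1 * b (1 * x + - t)) = 1.
  rewrite Rint_oo_cc; last exact: itg1_continuous.
  by rewrite (Rint_FTC T0 dP cp) Pr ?(ltW tT)// Pl// subr0.
have p0 x : 0 <= 1 * b (1 * x + - t) by rewrite mul1r.
have ib : itg `]0, T[ (fun x => 1 * b (1 * x + - t) * a x).
  have tb : test1 b.
    split => //; exists (Num.min r0 1) => x xr; apply: bs; apply/negP => /andP[x0 x1].
    by move: xr; rewrite gtr0_norm// leNgt x1.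
  have [C _ hC] := test1_bounded tb.
  apply: (itg_bM (C := C)) => //; last by move=> x _; rewrite mul1r.
  by apply: measurable_funTS; exact: continuous_measurable_fun.
split => //.
rewrite -[a t]mulr1 -[in X in a t * X]i1 -RintegralZl// -RintegralB//; last exact: itgZ.
rewrite -[leRHS]mulr1 -[in leRHS]i1 -RintegralZl//.
apply: Rint_abs_le => //; [by apply: itgB => //; exact: itgZ|exact: itgZ|].
move=> x; rewrite /= in_itv/= => /andP[x0 _].
rewrite [a t * _]mulrC -mulrBr normrM ger0_norm// [leRHS]mulrC.
have [xt|xt] := boolP (0 < 1 * x + - t < Num.min r0 1); last by rewrite bs// mulr0 !mul0r.
move: xt; rewrite mul1r lt_min => /andP[xt /andP[xr _]].
apply: ler_wpM2l; rewrite ?mul1r// distrC; apply: hr; last by rewrite /= in_itv/= ltW.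
by rewrite /ball/= distrC gtr0_norm.
Qed.

Let int_le (T u v : R) (th : R -> R) : 0 <= u -> (forall x, `|th x| <= 1) ->
  (forall x, 0 < x -> ~~ (u <= x <= v) -> th x = 0) ->
  \int[leb]_(x in `]0, T[) (`|th x| * g x) <= \int[leb]_(x in `[u, v]) g x.
Proof.
move=> u0 h1 hs; apply: Rint_le_supp => //.
- apply: integrableS (ig v) => //; move=> x; rewrite /= !in_itv/= => /andP[ux ->].
  by rewrite (le_trans u0 ux).
- by move=> x; rewrite /= in_itv/= => /andP[/ltW x0 _]; rewrite mulr_ge0// g0.
- by move=> x; rewrite /= in_itv/= => /andP[ux _]; rewrite g0//; exact: le_trans ux.
- by move=> x; rewrite /= in_itv/= => /andP[/ltW x0 _] _; rewrite ler_piMl// g0.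
- move=> x; rewrite /= !in_itv/= => /andP[x0 _] /negP h.
  by rewrite hs// normr0 mul0r.
Qed.

(** The test function P - Q steps up just after t1 and down just after t2. Its derivative picks out
    a t1 - a t2 up to e, and P - Q is at most 1 in size with support in [t1, t2 + 1]; the extra unit
    of time leaves room for the second step. *)
Lemma slow_variation (t1 t2 : R) : 0 <= t1 -> t1 <= t2 ->
  `|a t2 - a t1| <= \int[leb]_(t in `[t1, t2 + 1]) g t.
Proof.
move=> t10 t12; have t20 := le_trans t10 t12.
apply/ler_addgt0Pr => e e0; have e2 : 0 < e / 2 by rewrite divr_gt0.
have [P [p [[sP dP P01 Pl Pr] hP]]] := mollifier t10 e2.
have [Q [q [[sQ dQ Q01 Ql Qr] hQ]]] := mollifier t20 e2.
pose T := t2 + 1 + 1.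
have tT : t2 + 1 < T by rewrite ltrDl.
have T0 : 0 < T by rewrite (lt_trans _ tT)// ltr_wpDl.
have [i1 h1] := hP T (le_lt_trans (lerD t12 (lexx 1)) tT).
have [i2 h2] := hQ T tT.
pose th x := P x - Q x.
have dth x : 'D_1 th x = p x - q x := @derive_val _ _ _ _ _ _ _ (is_deriveB (dP x) (dQ x)).
have thr x : t2 + 1 < x -> th x = 0.
  by move=> /ltW xt; rewrite /th Qr// Pr ?subrr//; apply: le_trans xt; rewrite lerD2r.
have sth : smooth th by exact: smoothB.
have := hw T0 tT sth thr.
rewrite [th 0](_ : _ = 0); last by rewrite /th Pl// Ql// subrr.
rewrite mul0r addr0; under eq_Rintegral do rewrite dth mulrBl.
rewrite RintegralB// => h3; apply: dist_le3 h1 h2 (le_trans h3 _).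
apply: int_le => // x; first exact: dist01.
move=> _; rewrite negb_and -!ltNge => /orP[/ltW xt|]; last exact: thr.
by rewrite /th Pl// Ql ?subrr// (le_trans xt).
Qed.

(** The test function 1 - P equals 1 at time 0, which brings in the initial value [a0]. *)
Lemma slow_variation0 (t : R) : 0 <= t -> `|a t - a0| <= \int[leb]_(x in `[0, t + 1]) g x.
Proof.
move=> t0; apply/ler_addgt0Pr => e e0; have e2 : 0 < e / 2 by rewrite divr_gt0.
have [P [p [[sP dP P01 Pl Pr] hP]]] := mollifier t0 e2.
pose T := t + 1 + 1.
have tT : t + 1 < T by rewrite ltrDl.
have T0 : 0 < T by rewrite (lt_trans _ tT)// ltr_wpDl.
have [i1 h1] := hP T tT.
pose th x := 1 - P x.
have dth x : 'D_1 th x = - p x.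
  have := @derive_val _ _ _ _ _ _ _ (is_deriveB (is_derive_cst (1 : R) x 1) (dP x)).
  by rewrite sub0r.
have thr x : t + 1 < x -> th x = 0 by move=> /ltW xt; rewrite /th Pr// subrr.
have sth : smooth th by apply: smoothB => //; exact: smooth_cst.
have := hw T0 tT sth thr.
rewrite [th 0](_ : _ = 1); last by rewrite /th Pl// subr0.
rewrite mul1r; under eq_Rintegral do rewrite dth mulNr -mulN1r.
rewrite RintegralZl// mulN1r addrC => h3.
have h0 : `|a0 - a0| <= e / 2 by rewrite subrr normr0 ltW.
apply: dist_le3 h0 h1 (le_trans h3 _).
apply: int_le => // x; first by apply: dist01; rewrite ?ler01 ?lexx.
move=> /ltW x0; rewrite x0/= -ltNge; exact: thr.
Qed.

End slow_variation.

(** * Bounds from the energy identity and integrability of the kinetic term in time *)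

Section energy_bounds.
Context {R : realType} {d : nat}.
Local Notation E := 'rV[R]_d.
Local Notation mu := (lebesgue_rV d).
Local Notation leb := (@lebesgue_measure R).
Local Notation itg f := (mu.-integrable setT (fun x => (f x)%:E)).

Lemma L2v_sqr (w : E -> E) : L2v w ->
  (forall i, itg (fun x => w x ord0 i ^+ 2)) /\ itg (fun x => w x \dot w x).
Proof.
move=> hw; have h i : itg (fun x => w x ord0 i ^+ 2) by exact: Lfun2_sqr (hw i).
by split => //; exact: itg_sum.
Qed.

Lemma sum3_le (a b c k : R) : 0 <= a -> 0 <= c -> a + b + c <= k -> b <= k.
Proof. by lra. Qed.

Lemma dotv_sqr_ge0 (u : E) : 0 <= u \dot u.
Proof. exact: sqn_ge0. Qed.

Section fixed_time.
Context (eps : R) (s : R -> E -> R) (w : R -> E -> E) (t : R)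
  (hs : H1 (s t)) (hw : L2v (w t)).

Lemma itg_density : itg (density s t).
Proof. by apply: Lfun2_sqr; case: hs. Qed.

Lemma itg_dotv_wgrad : itg (fun x => wgrad (s t) x \dot wgrad (s t) x).
Proof.
have [_ h] := H1_wgrad hs; exact: itg_sum.
Qed.

Lemma kineticE : kinetic eps s w t =
  \int[mu]_x (w t x \dot w t x) + eps ^+ 2 * \int[mu]_x (wgrad (s t) x \dot wgrad (s t) x).
Proof.
have [_ h1] := L2v_sqr hw; have h2 := itg_dotv_wgrad.
rewrite /kinetic RintegralD//; first by rewrite RintegralZl.
exact: itgZ.
Qed.

Lemma kinetic_ge_w : \int[mu]_x (w t x \dot w t x) <= kinetic eps s w t.
Proof.
rewrite kineticE lerDl mulr_ge0 ?sqr_ge0//.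
by apply: Rintegral_ge0 => x _; exact: dotv_sqr_ge0.
Qed.

Lemma kinetic_ge_wgrad :
  eps ^+ 2 * \int[mu]_x (wgrad (s t) x \dot wgrad (s t) x) <= kinetic eps s w t.
Proof.
by rewrite kineticE lerDr; apply: Rintegral_ge0 => x _; exact: dotv_sqr_ge0.
Qed.

Lemma kinetic_ge0 : 0 <= kinetic eps s w t.
Proof.
apply: le_trans kinetic_ge_w.
by apply: Rintegral_ge0 => x _; exact: dotv_sqr_ge0.
Qed.

End fixed_time.

Lemma measurable_Rint_param (F : R * E -> R) : measurable_fun setT F ->
  measurable_fun setT (fun t => \int[mu]_y F (t, y)).
Proof.
move=> mF; rewrite /Rintegral.
have mE : measurable_fun setT (EFin \o F) by exact/measurable_EFinP.
apply: measurableT_comp; first exact: fine_measurable.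
under eq_fun do rewrite integralE.
apply: emeasurable_funB.
  rewrite (_ : (fun _ => _) = fubini_F mu ((EFin \o F)^\+)%E).
    exact: measurable_fun_fubini_tonelli_F (measurable_funepos mE) (fun x => funepos_ge0 _ x).
  by apply/funext => t; apply: eq_integral => y _; rewrite !funeposE.
rewrite (_ : (fun _ => _) = fubini_F mu ((EFin \o F)^\-)%E).
  exact: measurable_fun_fubini_tonelli_F (measurable_funeneg mE) (fun x => funeneg_ge0 _ x).
by apply/funext => t; apply: eq_integral => y _; rewrite !funenegE.
Qed.

Context (eps : R) (tau dtau : R -> R) (htau : tau_solution tau dtau)
  (S : R -> E -> R) (W : R -> E -> E)
  (hreg : sol_regular S W) (hED : energy_dissipation eps tau dtau S W).

Let kin (t : R) := kinetic eps S W t.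
Let ent (t : R) := \int[mu]_y (density S t y * (y \dot y) + density S t y * ln (density S t y)).
Let D (t : R) := dissipation eps tau dtau S W t.

(** The Gaussian integral pays for the negative part of R ln R, as in [entpos_le], so that this
    constant bounds a sum of nonnegative terms. *)
Definition energy_bound : R :=
  pseudo_energy eps tau S W 0 + \int[mu]_y expR (- (2^-1 * sqn (y : E))).

Local Notation C0 := energy_bound.

Lemma diss_ge0 t : 0 <= t -> 0 <= D t.
Proof.
move=> t0; have [hS hW _ _] := hED t0.
rewrite /D /dissipation mulr_ge0 ?kinetic_ge0// divr_ge0 ?(dtau_ge0 htau)//.
by rewrite exprn_ge0// ltW// (tau_gt0 htau).
Qed.

Lemma entropy_bound t : 0 <= t ->
  itg (entpos (density S t)) /\
  \int[mu]_y entpos (density S t) y + (2 * tau t ^+ 2)^-1 * kin t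
    + \int[leb]_(r in `[0, t]) D r <= C0.
Proof.
move=> t0; have [hS hW he id] := hED t0.
have ie : itg (fun y => density S t y * (y \dot y) + density S t y * ln (density S t y)).
  exact/Lfun1_integrable.
have h2 : 0 < 2^-1 :> R by rewrite invr_gt0.
have ig := itg_expR_sqn (d := d) h2.
have R0 y : 0 <= density S t y by exact: sqr_ge0.
have mS : measurable_fun setT (density S t) by exact: itg_meas (itg_density hS).
have ip : itg (entpos (density S t)).
  apply: (itg_le measurableT _ _ (itgD measurableT ie ig)).
    apply: measurable_funD.
      apply: measurable_maxr; last exact: measurable_cst.
      by apply: measurable_funM => //; by apply: measurableT_comp => //; exact: measurable_ln.
    by apply: measurable_funM => //; apply: measurable_funM => //; exact: measurable_sqn.
  by move=> y _; rewrite ger0_norm ?entpos_ge0// entpos_le.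
split => //; rewrite /C0 -id /pseudo_energy -/(kin t).
have : \int[mu]_y entpos (density S t) y <= ent t + \int[mu]_y expR (- (2^-1 * sqn (y : E))).
  rewrite /ent -RintegralD//; apply: le_Rintegral => //; first exact: itgD.
  by move=> y _; exact: entpos_le.
rewrite -/(ent t) -/D; lra.
Qed.

Lemma tight_density t : 0 <= t -> tight C0 (density S t).
Proof.
move=> t0; have [hS hW _ _] := hED t0; have [ie h] := entropy_bound t0.
split => //; [by move=> y; exact: sqr_ge0|exact: itg_density|].
have : 0 <= (2 * tau t ^+ 2)^-1 * kin t.
  by rewrite mulr_ge0 ?kinetic_ge0// invr_ge0 mulr_ge0// sqr_ge0.
have : 0 <= \int[leb]_(r in `[0, t]) D r.
  by apply: Rintegral_ge0 => r; rewrite /= in_itv/= => /andP[r0 _]; exact: diss_ge0.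
lra.
Qed.

Lemma entpos_int_ge0 t : 0 <= \int[mu]_y entpos (density S t) y.
Proof. by apply: Rintegral_ge0 => y _; rewrite entpos_ge0 ?sqr_ge0. Qed.

Lemma C0_ge0 : 0 <= C0.
Proof.
have := tight_le (tight_density (lexx 0)).
exact/le_trans/entpos_int_ge0.
Qed.

Lemma kinetic_le t : 0 <= t -> kin t <= 2 * C0 * tau t ^+ 2.
Proof.
move=> t0; have [ie h] := entropy_bound t0.
have h1 : 0 <= \int[leb]_(r in `[0, t]) D r.
  by apply: Rintegral_ge0 => r; rewrite /= in_itv/= => /andP[r0 _]; exact: diss_ge0.
have h2 := entpos_int_ge0 t.
have t2 : 0 < tau t ^+ 2 by rewrite exprn_gt0// (tau_gt0 htau).
have := sum3_le h2 h1 h.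
rewrite ler_pdivrMl; last exact: mulr_gt0.
by move=> h3; apply: le_trans h3 _; rewrite mulrAC.
Qed.

Lemma dissipation_int_le t : 0 <= t -> \int[leb]_(r in `[0, t]) D r <= C0.
Proof.
move=> t0; have [hS hW _ _] := hED t0; have [ie h] := entropy_bound t0.
have h1 : 0 <= (2 * tau t ^+ 2)^-1 * kin t.
  by rewrite mulr_ge0 ?kinetic_ge0// invr_ge0 mulr_ge0// sqr_ge0.
by have h2 := entpos_int_ge0 t; lra.
Qed.

Lemma dissipation_int_nd (t1 t2 : R) : t1 <= t2 ->
  \int[leb]_(r in `[0, t1]) D r <= \int[leb]_(r in `[0, t2]) D r.
Proof.
move=> t12; have [t10|t10] := leP 0 t1; last first.
  rewrite set_itv_ge ?Rintegral_set0; last by rewrite bnd_simp -ltNge.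
  by apply: Rintegral_ge0 => r; rewrite /= in_itv/= => /andP[r0 _]; exact: diss_ge0.
have t20 := le_trans t10 t12.
pose K := 2 * C0 * tau t2 ^+ 2 * dtau t2.
have DK r : 0 <= r <= t2 -> D r <= K.
  move=> /andP[r0 rt]; have [hS hW _ _] := hED r0.
  have k1 := kinetic_le r0.
  have tt := tau_ndecr htau r0 rt; have dd := dtau_ndecr htau r0 rt.
  have tr1 := tau_ge1 htau r0; have d0 := dtau_ge0 htau r0.
  rewrite /D /dissipation /K [leRHS]mulrC; apply: ler_pM => //.
  - by rewrite divr_ge0// exprn_ge0// (le_trans ler01 tr1).
  - exact: kinetic_ge0.
  - by rewrite (le_trans _ dd)// ler_pdivrMr ?exprn_gt0 ?(lt_le_trans ltr01 tr1)// ler_peMr// exprn_ege1.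
  - apply: le_trans k1 _; rewrite ler_wpM2l ?mulr_ge0 ?C0_ge0//.
    by rewrite lerXn2r ?nnegrE// (le_trans ler01)// (le_trans tr1).
have le12 : (\int[leb]_(r in `[0%R, t1]) (D r)%:E <= \int[leb]_(r in `[0%R, t2]) (D r)%:E)%E.
  rewrite integral_mkcond [leRHS]integral_mkcond; apply: ge0_le_integral_nonmeas => r _.
    by rewrite patchE; case: ifPn => //; rewrite inE/= in_itv/= lee_fin => /andP[r0 _]; exact: diss_ge0.
  rewrite !patchE; case: ifPn => [|_].
    by rewrite inE/= in_itv/= => /andP[r0 rt]; rewrite mem_set//= in_itv/= r0 (le_trans rt).
  case: ifPn => //; rewrite inE/= in_itv/= lee_fin => /andP[r0 _]; exact: diss_ge0.
have fin : (\int[leb]_(r in `[0%R, t2]) (D r)%:E < +oo)%E.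
  apply: le_lt_trans (_ : (\int[leb]_(r in `[0%R, t2]) K%:E < +oo)%E).
    apply: ge0_le_integral_nonmeas => r; rewrite /= in_itv/= lee_fin => /andP[r0 rt].
      exact: diss_ge0.
    by rewrite DK// r0.
  rewrite integral_cst//= lebesgue_measure_itv/= lte_fin; case: ifPn => _.
    by rewrite -EFinB -EFinM ltry.
  by rewrite mule0.
have ge0 t : (0 <= \int[leb]_(r in `[0%R, t]) (D r)%:E)%E.
  by apply: integral_ge0 => r; rewrite /= in_itv/= lee_fin => /andP[r0 _]; exact: diss_ge0.
(* [fine] sends +oo to 0, so comparing the real integrals requires finiteness. *)
rewrite /Rintegral fine_le// ge0_fin_numE//.
exact: le_lt_trans le12 fin.
Qed.

(** [kinetic] involves [wgrad], chosen separately at each time, so the energy identity is solved for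
    it. In the result the moment and entropy integral is measurable by Fubini, and the dissipation
    integral because it is monotone in its upper limit. *)
Lemma measurable_kinetic : measurable_fun `[(0 : R), +oo[ kin.
Proof.
have mI : measurable (`[(0 : R), +oo[ : set R) by exact: measurable_itv.
(* Joint measurability is given for t >= 0 only; extension by 0 makes the integrand measurable
   everywhere. *)
pose F (z : R * E) := (fun z : R * E => density S z.1 z.2 * (z.2 \dot z.2)
  + density S z.1 z.2 * ln (density S z.1 z.2)) \_ [set z : R * E | 0 <= z.1] z.
have [mS _ _ _] := hreg.
have mZ : measurable [set z : R * E | 0 <= z.1].
  rewrite (_ : [set _ | _] = `[(0 : R), +oo[%classic `*` setT); first exact: measurableX.
  by apply/seteqP; split => z /=; rewrite in_itv/= andbT => // -[].
have mF : measurable_fun setT F.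
  apply/(measurable_restrict _ _ _).1 => //; rewrite setTI.
  have mden : measurable_fun [set z : R * E | 0 <= z.1] (fun z : R * E => density S z.1 z.2).
    exact: measurable_funX.
  apply: measurable_funD.
    apply: measurable_funM => //; apply: measurable_funTS.
    exact: measurableT_comp measurable_sqn measurable_snd.
  by apply: measurable_funM => //; apply: measurableT_comp => //; exact: measurable_ln.
have mE := measurable_Rint_param mF.
pose k t := 2 * tau t ^+ 2 * (pseudo_energy eps tau S W 0 - \int[leb]_(r in `[0, t]) D r
   - \int[mu]_y F (t, y)).
have mk : measurable_fun `[(0 : R), +oo[ k.
  have mtau := half_line_measurable (tau_continuous htau).
  apply: measurable_funM.
    by apply: measurable_funM; [exact: measurable_cst|exact: measurable_funX].
  apply: measurable_funB; last exact: measurable_funTS.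
  apply: measurable_funB; first exact: measurable_cst.
  by apply: nondecreasing_measurable => // x y; exact: dissipation_int_nd.
apply: eq_measurable_fun mk => t; rewrite inE/= in_itv/= andbT => t0.
have [hS hW _ id] := hED t0.
rewrite /k (_ : \int[mu]_y F (t, y) = ent t); last first.
  by apply: eq_Rintegral => y _; rewrite /F patchE mem_set.
rewrite -id /pseudo_energy -/(kin t) -/(ent t) -/D.
have t2 : tau t ^+ 2 != 0 by rewrite gt_eqF// exprn_gt0// (tau_gt0 htau).
rewrite [X in _ * X](_ : _ = (2 * tau t ^+ 2)^-1 * kin t); last by ring.
by rewrite mulrA mulfV ?mul1r// mulf_neq0.
Qed.

Lemma itg_kinetic T : leb.-integrable `[0, T] (fun t => (kin t)%:E).
Proof.
have [T0|T0] := leP 0 T; last first.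
  by rewrite set_itv_ge; [exact: integrable_set0|rewrite bnd_simp -ltNge].
have cK : {within `[0, T], continuous (cst (2 * C0 * tau T ^+ 2) : R -> R)}.
  by apply: continuous_subspaceT => x; exact: cst_continuous.
have iK := continuous_compact_integrable (@segment_compact R 0 T) cK.
apply: (itg_le _ _ _ iK) => //.
  apply: measurable_funS measurable_kinetic => // x; rewrite /= !in_itv/= => /andP[-> _] //.
move=> t; rewrite /= in_itv/= => /andP[t0 tT]; have [hS hW _ _] := hED t0.
rewrite ger0_norm ?kinetic_ge0//; apply: le_trans (kinetic_le t0) _.
rewrite ler_wpM2l ?mulr_ge0 ?C0_ge0//.
have t1 := tau_ge1 htau t0; have tt := tau_ndecr htau t0 tT.
by rewrite lerXn2r ?nnegrE// (le_trans ler01)// (le_trans t1).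
Qed.

End energy_bounds.

(** * Estimates at a fixed time *)

Section spatial_estimates.
Context {R : realType} {d : nat}.
Local Notation E := 'rV[R]_d.
Local Notation mu := (lebesgue_rV d).
Local Notation itg f := (mu.-integrable setT (fun x => (f x)%:E)).

Lemma Rint_lin2 (f g : E -> R) (a b : R) : itg f -> itg g ->
  a * \int[mu]_x f x + b * \int[mu]_x g x = \int[mu]_x (a * f x + b * g x).
Proof.
move=> fi gi; rewrite [RHS]RintegralD//; [|exact: itgZ..].
by rewrite !RintegralZl.
Qed.

Lemma weight_le (r f : E -> R) (B : R) : itg r -> (forall x, 0 <= r x) ->
  measurable_fun setT f -> (forall x, `|f x| <= B) ->
  itg (fun x => r x * f x) /\ `|\int[mu]_x (r x * f x)| <= B * \int[mu]_x r x.
Proof.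
move=> ir r0 mf fB.
have i1 : itg (fun x => r x * f x).
  by under eq_fun do rewrite mulrC; apply: (itg_bM (C := B)).
split => //; rewrite -RintegralZl//; apply: Rint_abs_le => //; first exact: itgZ.
by move=> x _; rewrite normrM (ger0_norm (r0 x)) mulrC ler_wpM2r.
Qed.

Lemma young (l a b : R) : 0 < l -> 0 <= a -> 0 <= b ->
  a * b <= l * b ^+ 2 + l^-1 * a ^+ 2.
Proof.
move=> l0 a0 b0.
have : 0 <= l^-1 * (a - l * b) ^+ 2 by rewrite mulr_ge0 ?sqr_ge0// invr_ge0 ltW.
have -> : l^-1 * (a - l * b) ^+ 2 = l^-1 * a ^+ 2 - 2 * (a * b) + l * b ^+ 2.
  by field; rewrite gt_eqF.
have : 0 <= a * b by rewrite mulr_ge0.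
lra.
Qed.

(** Young's inequality with a free weight l, which balances the kinetic term against the mass and is
    chosen anew in each application. *)
Lemma flux_le (s : E -> R) (w : E -> E) (G : 'I_d -> E -> R) (B l : R) :
  s \in Lfun mu 2%:E -> L2v w -> (forall i, measurable_fun setT (G i)) ->
  (forall i x, `|G i x| <= B) -> 0 < l ->
  itg (fun x => \sum_i s x * w x ord0 i * G i x) /\
  `|\int[mu]_x (\sum_i s x * w x ord0 i * G i x)| <=
    B * (l * \int[mu]_x (w x \dot w x) + d%:R * l^-1 * \int[mu]_x (s x ^+ 2)).
Proof.
move=> hs hw mG GB l0; have [h1 h2] := L2v_sqr hw; have h3 := Lfun2_sqr hs.
have i1 : itg (fun x => \sum_i s x * w x ord0 i * G i x).
  apply: itg_sum => // i; under eq_fun do rewrite mulrC.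
  by apply: (itg_bM (C := B)) => //; exact: Lfun2_mul (hw i).
split => //.
have i2 := itgZ l measurableT h2; have i3 := itgZ (d%:R * l^-1) measurableT h3.
rewrite -RintegralZl// -RintegralZl// -RintegralD// -RintegralZl//; last exact: itgD.
apply: Rint_abs_le => //; first by apply: itgZ => //; exact: itgD.
move=> x _; apply: le_trans (ler_norm_sum _ _ _) _.
have B0 (i : 'I_d) : 0 <= B by apply: le_trans (GB i x).
apply: (@le_trans _ _ (\sum_(i < d) B * (l * w x ord0 i ^+ 2 + l^-1 * s x ^+ 2))).
  apply: ler_sum => i _; rewrite normrM mulrC ler_pM//.
  rewrite normrM -(real_normK (num_real (s x))) -(real_normK (num_real (w x ord0 i))).
  exact: young.
rewrite -mulr_sumr big_split/= -mulr_sumr sumr_const card_ord.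
by rewrite (_ : \sum_i _ = w x \dot w x)// -[X in _ + X]mulr_natl !mulrA.
Qed.

(** Use |a_i a_j| <= (a_i^2 + a_j^2) / 2 and sum over the d^2 pairs. *)
Lemma tens_le (a : E -> E) (P : 'I_d -> 'I_d -> E -> R) (B : R) :
  (forall i, measurable_fun setT (coordf a i)) -> itg (fun x => a x \dot a x) ->
  (forall i j, measurable_fun setT (P i j)) -> (forall i j x, `|P i j x| <= B) ->
  itg (fun x => \sum_i \sum_j a x ord0 i * a x ord0 j * P i j x) /\
  `|\int[mu]_x (\sum_i \sum_j a x ord0 i * a x ord0 j * P i j x)| <=
    B * d%:R * \int[mu]_x (a x \dot a x).
Proof.
move=> ma ia mP PB.
have le x : `|\sum_i \sum_j a x ord0 i * a x ord0 j * P i j x| <= B * d%:R * (a x \dot a x).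
  apply: le_trans (ler_norm_sum _ _ _) _.
  apply: (@le_trans _ _ (\sum_(i < d) \sum_(j < d) B * (2^-1 * (a x ord0 i ^+ 2 + a x ord0 j ^+ 2)))).
    apply: ler_sum => i _; apply: le_trans (ler_norm_sum _ _ _) _; apply: ler_sum => j _.
    rewrite normrM mulrC ler_pM// ler_norml.
    have := sqr_ge0 (a x ord0 i + a x ord0 j); have := sqr_ge0 (a x ord0 i - a x ord0 j).
    by rewrite !sqrrD sqrrN mulrN => ? ?; apply/andP; split; lra.
  under eq_bigr do rewrite -mulr_sumr -mulr_sumr big_split/= sumr_const card_ord.
  rewrite -mulr_sumr -mulr_sumr big_split/= sumr_const card_ord -mulrA.
  under eq_bigr do rewrite -mulr_natl.
  rewrite -mulr_sumr -mulr_natl (_ : \sum_i _ = a x \dot a x)//.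
  by rewrite le_eqVlt; apply/orP; left; apply/eqP; field.
have i2 := itgZ (B * d%:R) measurableT ia.
have i1 : itg (fun x => \sum_i \sum_j a x ord0 i * a x ord0 j * P i j x).
  apply: itg_le i2 => //.
  apply: measurable_sum => i; apply: measurable_sum => j.
  by apply: measurable_funM => //; apply: measurable_funM; exact: ma.
by split => //; rewrite -RintegralZl//; exact: Rint_abs_le.
Qed.

(** Three regions: r <= r |y|^2 where |y| >= 1; r <= e <= e^2 [Gauss] where |y| < 1 and r <= e; r <=
    r ln r where r > e. The bound is needed before conservation of mass, whose proof relies on
    it. *)
Lemma tight_mass_le C (r : E -> R) : tight C r ->
  \int[mu]_y r y <= 2 * C + expR 2 * \int[mu]_y (Gauss y : R).
Proof.
move=> [r0 ir ie le].
have ig := itgZ (expR 2) measurableT (@itg_Gauss R d).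
have i2 := itgZ 2 measurableT ie.
apply: (@le_trans _ _ (2 * \int[mu]_y entpos r y + expR 2 * \int[mu]_y (Gauss y : R))); last first.
  by rewrite lerD2r ler_wpM2l.
rewrite (_ : _ + _ = \int[mu]_y (2 * entpos r y + expR 2 * (Gauss y : R))); last first.
  rewrite [RHS]RintegralD//; congr (_ + _); rewrite RintegralZl//.
  exact: itg_Gauss.
apply: le_Rintegral => //; first exact: itgD.
move=> y _.
have g0 : 0 <= expR 2 * (Gauss y : R) by rewrite mulr_ge0 ?expR_ge0.
have q0 := sqn_ge0 y; have rq : 0 <= r y * sqn y by rewrite mulr_ge0.
have m0 : 0 <= Num.max (r y * ln (r y)) 0 by rewrite le_max lexx orbT.
have m1 : r y * ln (r y) <= Num.max (r y * ln (r y)) 0 by rewrite le_max lexx.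
rewrite /entpos mulrDr mulrCA mulfV// mulr1.
have [q1|q1] := leP 1 (sqn y).
  have : r y <= r y * sqn y by rewrite ler_peMr.
  lra.
have [re|re] := leP (r y) (expR 1).
  have : r y <= expR 2 * Gauss y.
    by apply: le_trans re _; rewrite /Gauss -expRD ler_expR -/(sqn y); lra.
  lra.
have : 1 <= ln (r y) by rewrite -ler_expR lnK ?ltW// posrE (lt_trans (expR_gt0 1) re).
move=> l1; have : r y <= r y * ln (r y) by rewrite ler_peMr.
lra.
Qed.

End spatial_estimates.

Section tau_weights.
Context {R : realType} (tau dtau : R -> R) (htau : tau_solution tau dtau).
Local Notation leb := (@lebesgue_measure R).
Local Notation itgt D f := (leb.-integrable D (fun x => (f x)%:E)).

Lemma tauV_continuous n : {within `[0, +oo[, continuous (fun t => (tau t ^+ n)^-1)}.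
Proof.
apply/subspace_continuousP => x x0.
have /subspace_continuousP/(_ x x0) c := tau_continuous htau.
apply: cvgV.
  rewrite expf_neq0// gt_eqF// (tau_gt0 htau)//.
  by move: x0; rewrite /= in_itv/= andbT.
exact: (@cvg_comp _ _ _ tau (fun y => y ^+ n) _ _ _ c (@exprn_continuous _ n _)).
Qed.

Lemma tauV_le1 n (t : R) : 0 <= t -> 0 <= (tau t ^+ n)^-1 <= 1.
Proof.
move=> t0; have t1 := tau_ge1 htau t0; have tp := lt_le_trans ltr01 t1.
by rewrite invr_ge0 exprn_ge0 ?(ltW tp)//= invf_le1 ?exprn_ege1// exprn_gt0.
Qed.

Lemma itg_tauV2 n (D : set R) (h : R -> R) : measurable D -> D `<=` `[0, +oo[ ->
  itgt D h -> itgt D (fun t => (tau t ^+ n)^-1 * h t).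
Proof.
move=> mD D0 ih; apply: (itg_bM (C := 1)) => //.
  have h0 := half_line_measurable (@tauV_continuous n).
  by apply: measurable_funS h0.
move=> t /D0; rewrite /= in_itv/= andbT => /(tauV_le1 n)/andP[h0 h1].
by rewrite ger0_norm.
Qed.

Lemma int_dtau_tau (a b : R) : 0 < a -> a < b ->
  itgt `[a, b] (fun t => dtau t / tau t) /\
  \int[leb]_(t in `[a, b]) (dtau t / tau t) = ln (tau b) - ln (tau a).
Proof.
move=> a0 ab; have b0 := lt_trans a0 ab.
have c0 : {within `[0, +oo[, continuous (fun t => dtau t / tau t)}.
  apply/subspace_continuousP => x x0; apply: cvgM.
    by have /subspace_continuousP/(_ x x0) := dtau_continuous htau.
  by have /subspace_continuousP/(_ x x0) := @tauV_continuous 1.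
have cab := within_ge0_sub (ltW a0) c0 (b := b).
split; first by apply: continuous_compact_integrable; [exact: segment_compact|].
have dF (x : R) : 0 < x -> is_derive x (1 : R) (@ln R \o tau) ((tau x)^-1 * dtau x).
  move=> x0; exact: is_derive1_comp (is_derive1_ln (tau_gt0 htau (ltW x0))) (is_derive_tau htau x0).
have cF (x : R) : 0 < x -> {for x, continuous (@ln R \o tau)}.
  by move=> x0; apply: differentiable_continuous; exact: (is_derive1_derive 1 (dF x x0)).1.
rewrite /Rintegral (continuous_FTC2 (F := @ln R \o tau) ab cab)//.
- split.
  + move=> x; rewrite in_itv/= => /andP[ax _]; have [] := dF x (lt_trans a0 ax); by [].
  + by apply: cvg_at_right_filter; exact: cF.
  + by apply: cvg_at_left_filter; exact: cF.
- move=> x; rewrite in_itv/= => /andP[ax _].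
  by rewrite derive1E (@derive_val _ _ _ _ _ _ _ (dF x (lt_trans a0 ax))) mulrC.
Qed.

Lemma near_ln_ge (A : R) : \forall t \near (+oo : set_system R), A <= ln t.
Proof.
near=> t; have t0 : 0 < t by near: t; apply: nbhs_pinfty_gt; exact: num_real.
rewrite -ler_expR lnK ?posrE//; near: t; apply: nbhs_pinfty_ge; exact: num_real.
Unshelve. all: by end_near. Qed.

(* [tau t] lies between two powers of [t], so [dtau] varies by a bounded factor on
   [T, T^2], which contains as many dyadic blocks as [dtau T ^+ 2]. *)
Lemma tau_window : \forall T \near (+oo : set_system R),
  [/\ 2 <= T, 1 <= dtau T, dtau (2 * T ^+ 2) <= 3 * dtau T &
      exists N, [/\ (0 < N)%N, 2 ^+ N <= T & dtau T ^+ 2 <= 32 * N%:R]].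
Proof.
have d1 := dtau_gt0 htau (@ltr01 R).
pose c := Num.min 1 (dtau 1).
have c0 : 0 < c by rewrite lt_min ltr01.
have c1 : c <= 1 by rewrite ge_min lexx.
have cd : c <= dtau 1 by rewrite ge_min lexx orbT.
near=> T.
have T2 : 2 <= T by near: T; apply: nbhs_pinfty_ge; exact: num_real.
have T0 : 0 < T by lra.
(* This is what tau'(2 T^2) <= 3 tau'(T) amounts to, by tau'^2 = 4 ln tau, tau(2 T^2) <= 9 T^4 and
   tau(T) >= c T. *)
have lT1 : ln 9 - 9 * ln c <= 5 * ln T.
  by rewrite -ler_pdivrMl//; near: T; exact: near_ln_ge.
have lT2 : 1 - ln c <= ln T by near: T; exact: near_ln_ge.
have lT3 : ln 2 <= ln T by rewrite ler_ln ?posrE.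
have dle t : 0 <= t -> tau t <= 1 + t * (2 * t).
  by move=> t0; apply: le_trans (tau_le_linear htau t0) _; rewrite lerD2l ler_wpM2l ?(dtau_le htau).
have lnX (x : R) n : 0 < x -> ln (x ^+ n) = n%:R * ln x.
  by move=> x0; rewrite lnXn// mulr_natl.
have low : ln c + ln T <= ln (tau T).
  have tT0 := tau_gt0 htau (ltW T0); rewrite -lnM ?posrE// ler_ln ?posrE ?mulr_gt0//.
  apply: le_trans (tau_ge_linear htau _); last by lra.
  have : (T - 1) * c <= (T - 1) * dtau 1 by rewrite ler_wpM2l//; lra.
  lra.
have dT0 : 0 <= dtau T by apply: (dtau_ge0 htau); lra.
have D2 := dtau_sqr htau (ltW T0).
have TT0 : 0 <= T ^+ 2 by exact: sqr_ge0.
have TT1 : 1 <= T ^+ 2 by rewrite exprn_ege1//; lra.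
have dT1 : 1 <= dtau T.
  by rewrite -(@expr_ge1 _ 2)// D2; lra.
split => //.
- have Z0 : 0 <= 2 * T ^+ 2 by rewrite mulr_ge0.
  rewrite -(@ler_pXn2r _ 2)// ?nnegrE ?(dtau_ge0 htau)// ?mulr_ge0// exprMn D2 (dtau_sqr htau Z0).
  have h : tau (2 * T ^+ 2) <= 9 * T ^+ 4.
    apply: le_trans (dle _ Z0) _.
    have -> : 9 * T ^+ 4 = T ^+ 2 * T ^+ 2 + 2 * T ^+ 2 * (2 * (2 * T ^+ 2)) :> R by ring.
    by rewrite lerD2r; apply: mulr_ege1.
  have : ln (tau (2 * T ^+ 2)) <= ln 9 + 4 * ln T.
    rewrite -lnX// -lnM ?posrE ?exprn_gt0// ler_ln ?posrE ?mulr_gt0 ?exprn_gt0//.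
    exact: (tau_gt0 htau).
  move: low lT1; lra.
- have l2 : 0 < ln 2 :> R by rewrite ln_gt0// ltr1n.
  have l21 : ln 2 <= 1 :> R.
    by rewrite (_ : 2 = 1 + 1 :> R)//; apply: le_ln1Dx; lra.
  pose x := ln T / ln 2.
  have x0 : 0 <= x by rewrite divr_ge0 ?(ltW l2)//; lra.
  have /andP[x1 x2] := truncn_itv x0.
  (* N is the integer part of the binary logarithm of T. As tau(T) <= T^4, tau'(T)^2 <= 16 ln T <=
     16 (N + 1) <= 32 N. *)
  exists (Num.truncn x); split.
  + by rewrite truncn_ge_nat// ler_pdivlMr// mul1r.
  + rewrite -ler_ln ?posrE ?exprn_gt0// lnX//.
    by move: x1; rewrite ler_pdivlMr.
  + have N1 : (1 <= Num.truncn x)%N by rewrite truncn_ge_nat// ler_pdivlMr// mul1r.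
    have h1 : tau T <= T ^+ 4.
      apply: le_trans (dle _ (ltW T0)) _.
      have T4 : 4 <= T ^+ 2 by have := mulr_ge0 (_ : 0 <= T - 2) (_ : 0 <= T - 2); rewrite -expr2; nra.
      have -> : T ^+ 4 = T ^+ 2 * T ^+ 2 by ring.
      nra.
    have h2 : ln (tau T) <= 4 * ln T.
      by rewrite -lnX// ler_ln ?posrE ?exprn_gt0// (tau_gt0 htau (ltW T0)).
    have h3 : ln T <= (Num.truncn x).+1%:R.
      have : ln T = x * ln 2 by rewrite divfK// gt_eqF.
      move=> ->; apply: le_trans (ltW x2); by rewrite ler_piMr.
    have h4 : (Num.truncn x).+1%:R <= 2 * (Num.truncn x)%:R :> R.
      by rewrite -natrM ler_nat mul2n -addnn -addn1 leq_add2l.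
    by rewrite D2; lra.
Unshelve. all: by end_near. Qed.

(** Insert t <= 2 L, tau'(t) <= 3 tau'(T) and 1 <= L tau'(T) into tau(t) <= 1 + t tau'(t); the
    constant 7 is 1 plus 2 times 3. The second bound follows from tau'(t) >= tau'(T). *)
Lemma tau_block (T L t : R) : 0 < T -> T <= L -> 1 <= dtau T ->
  dtau (2 * T ^+ 2) <= 3 * dtau T -> 2 <= T -> L <= t <= 2 * L -> t <= T ^+ 2 ->
  tau t <= 7 * L * dtau T /\ tau t / dtau t <= 7 * L.
Proof.
move=> T0 TL D1 D3 T2 /andP[Lt t2] tT.
have t0 : 0 <= t by lra.
have TT0 : 0 <= T ^+ 2 by exact: sqr_ge0.
have dd : dtau T <= dtau t by apply: (dtau_ndecr htau); lra.
have dle : dtau t <= 3 * dtau T by apply: le_trans D3; apply: (dtau_ndecr htau) => //; lra.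
have dp : 0 < dtau t by lra.
have tle : tau t <= 7 * L * dtau T.
  apply: le_trans (tau_le_linear htau t0) _.
  apply: (@le_trans _ _ (1 * 1 + 2 * L * (3 * dtau T))).
    by rewrite mulr1 lerD2l; apply: ler_pM => //; exact: ltW.
  have : 1 * 1 <= L * dtau T by apply: ler_pM => //; lra.
  lra.
split => //; rewrite ler_pdivrMr//; apply: le_trans tle _; rewrite ler_wpM2l//; lra.
Qed.

End tau_weights.

Lemma bound_add3 (R : realFieldType) (x y z u v a c : R) :
  x <= a -> y <= a -> z <= c -> u <= x + y -> v <= u + z -> v <= 2 * a + c.
Proof. lra. Qed.

Lemma bound_mul3 (R : realFieldType) (a b c k : R) : 0 <= a -> 0 <= b -> 0 <= c -> 0 <= k ->
  b * k + c <= (a + b + c) * (k + 1).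
Proof.
move=> a0 b0 c0 k0; have := mulr_ge0 a0 k0; have := mulr_ge0 c0 k0; lra.
Qed.

Lemma quarter3 (R : realFieldType) (e a b c : R) : 0 <= e -> a <= e / 4 -> b <= e / 4 ->
  c <= e / 4 -> a + b + c <= e.
Proof. lra. Qed.

(** Bookkeeping for [stein_decay]: u and v carry the bounds of the time cutoff and of the momentum
    equation, k that of [stein_slow], and x = m e, y = 1/m, q = tau(T)^(-2). The constants are 343 =
    7^3 from [tau_block] and 32 from [tau_window]. *)
Lemma stein_arith (R : realFieldType) (u v k x y e q Y : R) : 0 <= u -> 0 <= v -> 0 <= k ->
  0 <= x -> 0 <= y -> 0 <= e -> 0 <= q ->
  Y <= u * (343 * 32 * x + y) + v * (7 * e + q) ->
  2 * Y + k * (x + y) <= (2 * (u * (343 * 32 + 1) + v * 8) + k) * (x + y + e + q).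
Proof.
move=> u0 v0 k0 x0 y0 e0 q0 hY.
have p (a b : R) : 0 <= a -> 0 <= b -> 0 <= a * b by exact: mulr_ge0.
have := p _ _ u0 x0; have := p _ _ u0 y0; have := p _ _ u0 e0; have := p _ _ u0 q0.
have := p _ _ v0 x0; have := p _ _ v0 y0; have := p _ _ v0 e0; have := p _ _ v0 q0.
have := p _ _ k0 e0; have := p _ _ k0 q0.
lra.
Qed.

(** * Consequences of the rescaled system *)

Section rescaled_dynamics.
Context {R : realType} {d : nat}.
Local Notation E := 'rV[R]_d.
Local Notation mu := (lebesgue_rV d).
Local Notation leb := (@lebesgue_measure R).
Local Notation itg f := (mu.-integrable setT (fun x => (f x)%:E)).
Local Notation itgt D f := (leb.-integrable D (fun x => (f x)%:E)).
Context (eps : R) (tau dtau : R -> R) (htau : tau_solution tau dtau)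
  (R0 : E -> R) (J0 : E -> E) (S : R -> E -> R) (W : R -> E -> E)
  (iR0 : itg R0)
  (hRK : weak_solution_RK eps tau R0 J0 S W)
  (hED : energy_dissipation eps tau dtau S W)
  (hwc : weakly_continuous S).

Local Notation kin t := (kinetic eps S W t).
Local Notation C0 := (energy_bound eps tau S W).

Definition mass_bound : R := 2 * C0 + expR 2 * \int[mu]_y (Gauss y : R).
Local Notation M := mass_bound.

Lemma mass_le t : 0 <= t -> \int[mu]_y density S t y <= M.
Proof. by move=> t0; exact: tight_mass_le (tight_density htau hED t0). Qed.

Lemma mass_bound_ge0 : 0 <= M.
Proof.
apply: le_trans (mass_le (lexx 0)).
by apply: Rintegral_ge0 => y _; exact: sqr_ge0.
Qed.

Lemma itg_smooth_continuous (th f : R -> R) (T : R) : smooth th ->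
  {within `[0, +oo[, continuous f} -> itgt `]0, T[ (fun t => th t * f t).
Proof.
move=> st cf; apply: integrableS (_ : itgt `[0, T] (fun t => th t * f t)) => //.
  exact: subset_itv_oo_cc.
apply: continuous_compact_integrable; first exact: segment_compact.
have cf' := within_ge0_sub (lexx 0) cf (b := T).
move=> t; apply: cvgM; last exact: cf'.
exact: (continuous_subspaceT (smooth_continuous st)).
Qed.

Section continuity_equation.
Context (phi : E -> R) (tphi : test_fun phi) (B : R)
  (B0 : 0 <= B) (hB : forall i x, `|partial i phi x| <= B) (lam : R -> R)
  (lam0 : forall t, 0 <= t -> 0 < lam t).

(** Young's bound on the flux tau^(-2) J against grad phi, with a weight [lam] that may depend on
    time; the leading 2 is the loss in [Rint_sandwich]. *)
Definition mass_flux_bound (t : R) : R :=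
  2 * ((tau t ^+ 2)^-1 * (B * (lam t * kin t + d%:R * (lam t)^-1 * M))).
Local Notation g := mass_flux_bound.
Context (ig : forall T, itgt `[0, T] g).

Let a t := \int[mu]_y (density S t y * phi y).

(** The equation tested with th(t) phi(y), in the shape of the hypothesis of [slow_variation]; the
    flux is the only term to estimate. *)
Lemma continuity_equation T (th : R -> R) b : 0 < T -> b < T -> smooth th ->
  (forall t, b < t -> th t = 0) ->
  `|\int[leb]_(t in `]0, T[) ('D_1 th t * a t) + th 0 * \int[mu]_y (R0 y * phi y)| <=
    \int[leb]_(t in `]0, T[) (`|th t| * g t).
Proof.
move=> T0 bT st hb; have [sphi _] := tphi.
have [_ _ hc _ _] := hRK.
have := hc T (tensor th phi) T0 (test_fun_time_tensor st tphi bT hb).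
set F := fun t => \int[mu]_x (_ + _).
have [Cp _ hCp] := test_fun_bounded tphi; have mphi := test_fun_measurable tphi.
have -> : \int[mu]_y (R0 y * tensor th phi (0, y)) = th 0 * \int[mu]_y (R0 y * phi y).
  rewrite -RintegralZl//.
    by apply: eq_Rintegral => y _; rewrite /tensor/= mulrCA.
  by under eq_fun do rewrite mulrC; exact: (itg_bM (C := Cp)).
move=> hF.
have FE t : 0 < t -> `|F t - 'D_1 th t * a t| <= `|th t| * (2^-1 * g t).
  move=> /ltW t0; have [hS hW _ _] := hED t0.
  have iR := itg_density hS.
  have R0' x : 0 <= density S t x by exact: sqr_ge0.
  have [i1 _] := weight_le iR R0' mphi hCp.
  have mG i : measurable_fun setT (partial i phi).
    by apply: test_fun_measurable; exact: test_fun_partial.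
  have [i2 le2] := flux_le hS.1 hW mG hB (lam0 t0).
  have -> : F t = 'D_1 th t * a t + th t * (tau t ^+ 2)^-1 *
      \int[mu]_x (\sum_i S t x * W t x ord0 i * partial i phi x).
    rewrite Rint_lin2//; apply: eq_Rintegral => y _; rewrite partial_t_tensor// /tensor/=; congr (_ + _).
      by ring.
    rewrite /dotv !mulr_sumr; apply: eq_bigr => i _.
    by rewrite !mxE partial_x_tensor// /tensor/=; ring.
  rewrite [X in `|X|]addrC addKr normrM normrM -mulrA ler_wpM2l//.
  rewrite /g mulKf// ger0_norm; last by rewrite invr_ge0 sqr_ge0.
  rewrite ler_wpM2l ?invr_ge0 ?sqr_ge0//; apply: le_trans le2 _.
  rewrite ler_wpM2l// lerD// ler_wpM2l//.
  - exact: ltW (lam0 t0).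
  - exact: kinetic_ge_w.
  - by rewrite divr_ge0// ltW// lam0.
  - exact: mass_le.
have igo : itgt `]0, T[ g by apply: integrableS (ig T) => //; exact: subset_itv_oo_cc.
have ic : itgt `]0, T[ (fun t => 'D_1 th t * a t).
  by apply: itg_smooth_continuous; [exact: smooth_derive|exact: hwc].
have [Cth hCth] := smooth_bounded_itv 0 T st.
have it : itgt `]0, T[ (fun t => `|th t| * g t).
  apply: (itg_bM (C := Cth)) => //.
    by apply: measurableT_comp => //; apply: measurable_funTS; apply: continuous_measurable_fun; exact: smooth_continuous.
  by move=> x; rewrite /= in_itv/= normr_id => /andP[/ltW x0 /ltW xT]; apply: hCth; rewrite x0.
have ih : itgt `]0, T[ (fun t => `|th t| * (2^-1 * g t)).
  rewrite (_ : (fun _ => _) = (fun t => (2^-1 * (`|th t| * g t))%:E)); first exact: itgZ.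
  by apply/funext => t; rewrite mulrCA.
have sw : `|\int[leb]_(t in `]0, T[) F t - \int[leb]_(t in `]0, T[) ('D_1 th t * a t)| <=
    2 * \int[leb]_(t in `]0, T[) (`|th t| * (2^-1 * g t)).
  by apply: Rint_sandwich => // t; rewrite /= in_itv/= => /andP[t0 _]; exact: FE.
have e2 : 2 * \int[leb]_(t in `]0, T[) (`|th t| * (2^-1 * g t)) =
    \int[leb]_(t in `]0, T[) (`|th t| * g t).
  by rewrite -RintegralZl//; apply: eq_Rintegral => t _; field.
rewrite e2 in sw; apply: le_trans sw; rewrite distrC.
rewrite (_ : _ + _ = \int[leb]_(t in `]0, T[) ('D_1 th t * a t) - \int[leb]_(t in `]0, T[) F t)//.
have -> : \int[leb]_(t in `]0, T[) F t = - (th 0 * \int[mu]_y (R0 y * phi y)).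
  by apply/eqP; rewrite -addr_eq0 hF.
by rewrite opprK.
Qed.

Lemma mass_flux_bound_ge0 t : 0 <= t -> 0 <= g t.
Proof.
move=> t0; have [hS hW _ _] := hED t0; have l0 := lam0 t0.
rewrite mulr_ge0// mulr_ge0 ?invr_ge0 ?sqr_ge0// mulr_ge0// addr_ge0//.
  by rewrite mulr_ge0 ?kinetic_ge0// ltW.
by rewrite mulr_ge0 ?mass_bound_ge0// divr_ge0// ltW.
Qed.

Lemma density_slow (t1 t2 : R) : 0 <= t1 -> t1 <= t2 ->
  `|a t2 - a t1| <= \int[leb]_(t in `[t1, t2 + 1]) g t.
Proof.
exact: (slow_variation (hwc tphi) mass_flux_bound_ge0 ig continuity_equation).
Qed.

Lemma density_slow0 (t : R) : 0 <= t ->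
  `|a t - \int[mu]_y (R0 y * phi y)| <= \int[leb]_(t in `[0, t + 1]) g t.
Proof.
exact: (slow_variation0 (hwc tphi) mass_flux_bound_ge0 ig continuity_equation).
Qed.

End continuity_equation.

(** Products of wide cutoffs have gradients O(1/n), so the flux up to time t + 1 is O(1/n), while
    both masses are recovered in the limit up to the common factor kap^d. *)
Lemma mass_conservation t : 0 <= t ->
  \int[mu]_y density S t y = \int[mu]_y R0 y.
Proof.
move=> t0; have [C HC0 hC] := @derive_cutoff_le R.
pose phi n : E -> R := prodf (fun=> cutoff n).
have tphi n : test_fun (phi n) by apply: test_prodf => i; exact: test1_cutoff.
have phi1 n y : `|phi n y| <= 1.
  rewrite ger0_norm; first by apply: prodf_le1 => i x; exact: cutoff01.
  by apply: prodf_ge0 => i x; case/andP: (cutoff01 n x).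
have dphi n i y : `|partial i (phi n) y| <= C / n.+1%:R.
  rewrite partial_prodf => [|j]; last exact: smooth_cutoff.
  rewrite prodf_upd normrM -[leRHS]mulr1; apply: ler_pM => //.
  rewrite ger0_norm; last by apply: prodr_ge0 => j _; case/andP: (cutoff01 n (y ord0 j)).
  by apply: prodr_ile1 => j _; exact: cutoff01.
have B0 n : 0 <= C / n.+1%:R :> R by rewrite divr_ge0.
have [hreg _ _ _ _] := hRK.
have sub0 X : `[0, X] `<=` `[(0 : R), +oo[.
  by move=> x; rewrite /= !in_itv/= andbT => /andP[].
pose h t := 2 * ((tau t ^+ 2)^-1 * (1 * kin t + d%:R * 1^-1 * M)).
have ih X : itgt `[0, X] h.
  apply: itgZ => //; apply: (itg_tauV2 htau) => //; apply: itgD => //; last exact: itg1_cst.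
  by apply: itgZ => //; exact: (itg_kinetic htau hreg hED X).
have gE n : mass_flux_bound (C / n.+1%:R) (fun=> 1) = fun t => C / n.+1%:R * h t.
  by apply/funext => x; rewrite /mass_flux_bound /h; ring.
have ig n X : itgt `[0, X] (mass_flux_bound (C / n.+1%:R) (fun=> 1)).
  by rewrite gE; exact: itgZ.
have le n : `|\int[mu]_y (density S t y * phi n y) - \int[mu]_y (R0 y * phi n y)| <=
    C / n.+1%:R * \int[leb]_(r in `[0, t + 1]) h r.
  rewrite -RintegralZl// -gE.
  by apply: (density_slow0 (tphi n) (B0 n) (dphi n) _ (ig n)).
have cphi (y : E) : phi n y @[n --> \oo] --> (kap ^+ d : R).
  rewrite (_ : kap ^+ d = prodf (fun=> cst kap) y); last first.
    by rewrite /prodf /= prodr_const card_ord.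
  by apply: cvg_prodf => i; exact: cvg_cutoff.
have lim (r : E -> R) : itg r -> \int[mu]_y (r y * phi n y) @[n --> \oo] --> kap ^+ d * \int[mu]_y r y.
  move=> ir; rewrite -RintegralZl//.
  have [||||_] := @Rint_cvg _ _ _ mu setT (fun n y => r y * phi n y) (fun y => kap ^+ d * r y)
    (fun y => `|r y|) measurableT.
  - by move=> n; apply: measurable_funM; [exact: itg_meas ir|exact: test_fun_measurable].
  - by move=> y _; rewrite mulrC; apply: cvgMr; exact: cphi.
  - exact: itg_abs.
  - by move=> n y _; rewrite normrM ler_piMr.
  by [].
have [hS _ _ _] := hED t0.
have c0 : \int[mu]_y (density S t y * phi n y) - \int[mu]_y (R0 y * phi n y) @[n --> \oo] --> (0 : R).
  apply/cvgr0Pnorm_le => e e0.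
  have cz (c : R) : c * n.+1%:R^-1 @[n --> \oo] --> (0 : R).
    by rewrite -[X in _ --> X](mulr0 c); apply: cvgMr; exact: cvg_harmonic.
  move/cvgr0Pnorm_le : (cz (C * \int[leb]_(r in `[0, t + 1]) h r)) => /(_ e e0); apply: filterS => n hn.
  apply: le_trans (le n) _; rewrite mulrAC; apply: le_trans hn; exact: ler_norm.
have c1 : \int[mu]_y (density S t y * phi n y) - \int[mu]_y (R0 y * phi n y) @[n --> \oo]
    --> kap ^+ d * \int[mu]_y density S t y - kap ^+ d * \int[mu]_y R0 y.
  exact: (cvgB (lim _ (itg_density hS)) (lim _ iR0)).
have l0 := cvg_lim (@Rhausdorff R) c0; have l1 := cvg_lim (@Rhausdorff R) c1.
have e01 : kap ^+ d * \int[mu]_y density S t y - kap ^+ d * \int[mu]_y R0 y = 0.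
  by rewrite -(l1 _) (l0 _).
move/eqP : e01; rewrite -mulrBr mulf_eq0.
rewrite gt_eqF ?exprn_gt0 ?kap_gt0//= subr_eq0 => /eqP; exact.
Qed.

Section momentum_equation.
Context (psi : 'I_d -> E -> R) (tpsi : forall i, test_fun (psi i)).

Definition div_psi (y : E) : R := \sum_i partial i (psi i) y.

(** Integrating R against it is the weak form of -(grad R + 2 y R), the part of the momentum
    equation without tau^(-2); it vanishes when R is the Gaussian. *)
Definition stein_psi (y : E) : R := div_psi y - 2 * \sum_i y ord0 i * psi i y.

Lemma test_fun_sum n (f : 'I_n -> E -> R) : (forall i, test_fun (f i)) ->
  test_fun (fun y => \sum_i f i y).
Proof.
elim: n f => [|n ih] f tf.
  rewrite (_ : (fun _ => _) = cst 0); first exact: test_fun0.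
  by apply/funext => y; rewrite big_ord0.
rewrite (_ : (fun _ => _) = (fun y => f ord0 y + \sum_i f (lift ord0 i) y)).
  by apply: test_funD => //; exact: ih.
by apply/funext => y; rewrite big_ord_recl.
Qed.

Lemma test_fun_div : test_fun div_psi.
Proof. by apply: test_fun_sum => i; exact: test_fun_partial. Qed.

Lemma test_fun_stein : test_fun stein_psi.
Proof.
rewrite /stein_psi (_ : (fun _ => _) = (fun y => div_psi y + (-2) * \sum_i y ord0 i * psi i y)).
  apply: test_funD; first exact: test_fun_div.
  apply: test_funZ; apply: test_fun_sum => i; apply: test_funM => //.
  exact: (smooth_coord i (@smooth_id R)).
by apply/funext => y; rewrite mulNr.
Qed.

Definition tensor_vec (th : R -> R) (z : R * E) : E := \row_i tensor th (psi i) z.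

Lemma vcomp_tensor_vec th i : vcomp (tensor_vec th) i = tensor th (psi i).
Proof. by apply/funext => z; rewrite /vcomp mxE. Qed.

Lemma divx_tensor_vec th : smooth th -> divx (tensor_vec th) = tensor th div_psi.
Proof.
move=> st; apply/funext => z; rewrite /divx /tensor mulr_sumr; apply: eq_bigr => i _.
by rewrite vcomp_tensor_vec partial_x_tensor//; have [] := tpsi i.
Qed.

Definition lap_div (y : E) : R := \sum_i partial i (partial i div_psi) y.

Lemma test_fun_lap_div : test_fun lap_div.
Proof.
by apply: test_fun_sum => i; do 2 apply: test_fun_partial; exact: test_fun_div.
Qed.

Lemma lapx_divx_tensor_vec th : smooth th ->
  lapx (divx (tensor_vec th)) = tensor th lap_div.
Proof.
move=> st; rewrite divx_tensor_vec//; have [sd _] := test_fun_div.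
apply/funext => z; rewrite /lapx /tensor mulr_sumr; apply: eq_bigr => i _.
rewrite partial_x_tensor// partial_x_tensor//.
by have [] := test_fun_partial i test_fun_div.
Qed.

Lemma test_vec_bounded n (f : 'I_n -> E -> R) : (forall i, test_fun (f i)) ->
  exists2 B : R, 0 <= B & forall i x, `|f i x| <= B.
Proof.
move=> tf; have h i : {B : R | 0 <= B /\ forall x, `|f i x| <= B}.
  by apply: cid; have [B B0 hB] := test_fun_bounded (tf i); exists B.
exists (\sum_i sval (h i)); first by apply: sumr_ge0 => i _; case: (svalP (h i)).
move=> i x; apply: le_trans (_ : sval (h i) <= _); first by have [_] := svalP (h i).
by rewrite (bigD1 i)//= lerDl sumr_ge0// => j _; case: (svalP (h j)).
Qed.

Let a t := \int[mu]_y (density S t y * stein_psi y).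

(** The test field is th(t) psi(y). The time derivative falls on th and meets the momentum, split by
    Young's inequality with weight [lam]; the convective and quantum terms carry tau^(-2). The
    condition th 0 = 0 removes the initial momentum, and the factor 2 comes from [Rint_sandwich]. *)
Lemma momentum_equation : exists2 K : R, 0 <= K &
  forall T (th : R -> R) b (lam : R), 0 < T -> b < T -> smooth th ->
  (forall t, b < t -> th t = 0) -> th 0 = 0 -> 0 < lam ->
  `|\int[leb]_(t in `]0, T[) (th t * a t)| <=
    2 * \int[leb]_(t in `]0, T[)
      (`|'D_1 th t| * (K * (lam * kin t + lam^-1)) +
       `|th t| * (K * ((tau t ^+ 2)^-1 * (kin t + 1)))).
Proof.
have [B1 B10 hB1] := test_vec_bounded tpsi.
have [B2 B20 hB2] : exists2 B : R, 0 <= B & forall i j x, `|partial j (psi i) x| <= B.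
  have h i : {B : R | 0 <= B /\ forall j x, `|partial j (psi i) x| <= B}.
    apply: cid; have [B B0 hB] := test_vec_bounded (fun j => test_fun_partial j (tpsi i)).
    by exists B.
  exists (\sum_i sval (h i)); first by apply: sumr_ge0 => i _; case: (svalP (h i)).
  move=> i j x; apply: le_trans (_ : sval (h i) <= _); first by have [_] := svalP (h i).
  by rewrite (bigD1 i)//= lerDl sumr_ge0// => k _; case: (svalP (h k)).
have [B3 B30 hB3] := test_fun_bounded test_fun_lap_div.
have M0 := mass_bound_ge0.
(* B1 bounds psi in the momentum term, B2 its gradient in the two quadratic terms, and B3 the
   third-order derivatives paired with the density, whose mass is at most M. *)
pose K := B1 * (1 + d%:R * M) + 2 * (B2 * d%:R) + eps ^+ 2 / 4 * B3 * M.
have K1 : 0 <= B1 * (1 + d%:R * M) by rewrite mulr_ge0// addr_ge0// mulr_ge0.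
have K2 : 0 <= B2 * d%:R by rewrite mulr_ge0.
have K3 : 0 <= eps ^+ 2 / 4 * B3 * M by rewrite mulr_ge0// mulr_ge0// divr_ge0// sqr_ge0.
exists K; first by rewrite /K; lra.
move=> T th b lam T0 bT st hb th0 l0.
have [_ _ _ hm _] := hRK.
have tvec : test_vec_time T (tensor_vec th).
  by move=> i; rewrite vcomp_tensor_vec; exact: (test_fun_time_tensor st (tpsi i) bT hb).
have := hm T _ T0 tvec; set F := fun t => \int[mu]_x (_ - _).
have -> : \int[mu]_y (J0 y \dot tensor_vec th (0, y)) = 0.
  rewrite (_ : (fun y => _) = (fun=> 0)); first by rewrite /Rintegral integral0.
  apply/funext => y; rewrite /dotv big1// => i _; rewrite mxE /tensor/= th0 !mul0r mulr0//.
rewrite addr0 => F0.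
have mt (f : E -> R) : test_fun f -> measurable_fun setT f by exact: test_fun_measurable.
have FE t : 0 < t -> `|F t - th t * a t| <= `|'D_1 th t| * (K * (lam * kin t + lam^-1)) +
       `|th t| * (K * ((tau t ^+ 2)^-1 * (kin t + 1))).
  move=> /ltW t0; have [hS hW _ _] := hED t0.
  have iR := itg_density hS; have [_ iW] := L2v_sqr hW.
  have iG := itg_dotv_wgrad hS.
  have mW i : measurable_fun setT (coordf (W t) i) by exact: Lfun2_meas (hW i).
  have mG i : measurable_fun setT (coordf (wgrad (S t)) i).
    by have [[_ + _] _] := H1_wgrad hS => /(_ i)[].
  have R0' x : 0 <= density S t x by exact: sqr_ge0.
  have [Bs _ hBs] := test_fun_bounded test_fun_stein.
  have [i1 _] := weight_le iR R0' (mt _ test_fun_stein) hBs.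
  have [i2 le2] := flux_le hS.1 hW (fun i => mt _ (tpsi i)) hB1 l0.
  have mp i j : measurable_fun setT (partial j (psi i)).
    by apply: mt; exact: test_fun_partial.
  have [i3 le3] := tens_le mW iW mp hB2.
  have [i4 le4] := tens_le mG iG mp hB2.
  have [i5 le5] := weight_le iR R0' (mt _ test_fun_lap_div) hB3.
  pose I2 := \int[mu]_x (\sum_i S t x * W t x ord0 i * psi i x).
  pose I3 := \int[mu]_x (\sum_i \sum_j W t x ord0 i * W t x ord0 j * partial j (psi i) x).
  pose I4 := \int[mu]_x (\sum_i \sum_j wgrad (S t) x ord0 i * wgrad (S t) x ord0 j * partial j (psi i) x).
  pose I5 := \int[mu]_x (density S t x * lap_div x).
  pose q := (tau t ^+ 2)^-1.
  have q0 : 0 <= q by rewrite invr_ge0 sqr_ge0.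
  have FE : F t = 1 * (1 * (th t * a t + 'D_1 th t * I2) + (th t * q) * (1 * I3 + eps ^+ 2 * I4))
      + (- (th t * q * (eps ^+ 2 / 4))) * I5.
    rewrite /a /I2 /I3 /I4 /I5.
    rewrite Rint_lin2// Rint_lin2//.
    have j1 := itgD measurableT (itgZ (th t) measurableT i1) (itgZ ('D_1 th t) measurableT i2).
    have j2 := itgD measurableT (itgZ 1 measurableT i3) (itgZ (eps ^+ 2) measurableT i4).
    have j3 := itgD measurableT (itgZ 1 measurableT j1) (itgZ (th t * q) measurableT j2).
    rewrite Rint_lin2// Rint_lin2//.
    apply: eq_Rintegral => y _.
    rewrite lapx_divx_tensor_vec// divx_tensor_vec//.
    have -> : momentum S W t y \dot dt_vec (tensor_vec th) (t, y) =
        'D_1 th t * \sum_i S t y * W t y ord0 i * psi i y.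
      rewrite /dotv mulr_sumr; apply: eq_bigr => i _; rewrite !mxE vcomp_tensor_vec.
      by rewrite partial_t_tensor//; [rewrite /tensor/=; ring|have [] := tpsi i].
    have tE (u : E) : tens_grad u (tensor_vec th) (t, y) =
        th t * \sum_i \sum_j u ord0 i * u ord0 j * partial j (psi i) y.
      rewrite /tens_grad mulr_sumr; apply: eq_bigr => i _; rewrite mulr_sumr; apply: eq_bigr => j _.
      rewrite vcomp_tensor_vec partial_x_tensor//; first by rewrite /tensor/=; ring.
      by have [] := tpsi i.
    pose X2 := \sum_i y ord0 i * psi i y.
    have -> : stein_psi y = div_psi y - 2 * X2 by [].
    have -> : y \dot tensor_vec th (t, y) = th t * X2.
      by rewrite /dotv mulr_sumr; apply: eq_bigr => i _; rewrite mxE /tensor/=; ring.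
    have e4 : eps ^+ 2 / (4 * tau t ^+ 2) = eps ^+ 2 / 4 * q by rewrite invfM mulrA.
    rewrite !tE /tensor/= e4 -/q.
    ring.
  have kW : \int[mu]_x (W t x \dot W t x) <= kin t by exact: kinetic_ge_w.
  have kG : eps ^+ 2 * \int[mu]_x (wgrad (S t) x \dot wgrad (S t) x) <= kin t.
    exact: kinetic_ge_wgrad.
  have mM := mass_le t0.
  have k0 : 0 <= kin t by exact: kinetic_ge0.
  have x0 : 0 <= lam * kin t by rewrite mulr_ge0// ltW.
  have y0 : 0 <= lam^-1 by rewrite invr_ge0 ltW.
  have b2 : `|I2| <= K * (lam * kin t + lam^-1).
    apply: le_trans le2 _; apply: (@le_trans _ _ (B1 * (1 + d%:R * M) * (lam * kin t + lam^-1))).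
      rewrite -(mulrA B1); apply: ler_wpM2l => //.
      have h1 : lam * \int[mu]_x (W t x \dot W t x) <= lam * kin t.
        by rewrite ler_wpM2l// ltW.
      have h2 : d%:R * lam^-1 * \int[mu]_x (S t x ^+ 2) <= d%:R * lam^-1 * M.
        by rewrite ler_wpM2l// mulr_ge0.
      have h3 : 0 <= d%:R * M * (lam * kin t) by rewrite mulr_ge0// mulr_ge0.
      apply: le_trans (lerD h1 h2) _.
      rewrite (_ : (1 + _) * _ = lam * kin t + d%:R * lam^-1 * M + lam^-1 + d%:R * M * (lam * kin t)).
        by rewrite -addrA lerDl addr_ge0.
      by ring.
    by apply: ler_wpM2r; [exact: addr_ge0|rewrite /K -addrA lerDl addr_ge0// mulr_ge0].
  have b3 : `|I3 + eps ^+ 2 * I4 - eps ^+ 2 / 4 * I5| <= K * (kin t + 1).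
    apply: (@le_trans _ _ (2 * (B2 * d%:R) * kin t + eps ^+ 2 / 4 * B3 * M)).
      have h3 : `|I3| <= B2 * d%:R * kin t by apply: le_trans le3 _; rewrite ler_wpM2l.
      have h4 : `|eps ^+ 2 * I4| <= B2 * d%:R * kin t.
        rewrite normrM (ger0_norm (sqr_ge0 _)).
        apply: le_trans (ler_wpM2l (sqr_ge0 _) le4) _; rewrite mulrCA; exact: ler_wpM2l.
      have h5 : `|eps ^+ 2 / 4 * I5| <= eps ^+ 2 / 4 * B3 * M.
        have e4 : 0 <= eps ^+ 2 / 4 by rewrite divr_ge0// sqr_ge0.
        rewrite normrM (ger0_norm e4) -mulrA; apply: ler_wpM2l => //.
        by apply: le_trans le5 _; exact: ler_wpM2l.
      have h6 := ler_normB (I3 + eps ^+ 2 * I4) (eps ^+ 2 / 4 * I5).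
      have h7 := ler_normD I3 (eps ^+ 2 * I4).
      by rewrite -(mulrA 2); exact: bound_add3 h3 h4 h5 h7 h6.
    by apply: bound_mul3 => //; rewrite mulr_ge0.
  have -> : F t - th t * a t = 'D_1 th t * I2 + th t * (q * (I3 + eps ^+ 2 * I4 - eps ^+ 2 / 4 * I5)).
    by rewrite FE; ring.
  apply: le_trans (ler_normD _ _) _; rewrite !normrM (ger0_norm q0) lerD// ler_wpM2l//.
  by rewrite mulrCA ler_wpM2l.
have ik : itgt `]0, T[ (fun t => kin t).
  have [hreg _ _ _ _] := hRK; apply: integrableS (itg_kinetic htau hreg hED T) => //.
  exact: subset_itv_oo_cc.
have i1 : itgt `]0, T[ (fun _ => 1 : R).
  by apply: integrableS (itg1_cst 0 T 1) => //; exact: subset_itv_oo_cc.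
have ib (f h : R -> R) : smooth f -> itgt `]0, T[ h -> itgt `]0, T[ (fun t => `|f t| * h t).
  move=> sf ih; have [C hC] := smooth_bounded_itv 0 T sf; apply: (itg_bM (C := C)) => //.
    apply: measurableT_comp => //; apply: measurable_funTS; apply: continuous_measurable_fun.
    exact: smooth_continuous.
  by move=> x; rewrite /= in_itv/= normr_id => /andP[/ltW x0 /ltW xT]; apply: hC; rewrite x0.
have ia : itgt `]0, T[ (fun t => th t * a t).
  by apply: itg_smooth_continuous => //; apply: hwc; exact: test_fun_stein.
have ig : itgt `]0, T[ (fun t => `|'D_1 th t| * (K * (lam * kin t + lam^-1)) +
       `|th t| * (K * ((tau t ^+ 2)^-1 * (kin t + 1)))).
  apply: itgD => //; apply: ib; [exact: smooth_derive| |by []|].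
    apply: itgZ => //; apply: itgD => //; first exact: itgZ.
    by apply: integrableS (itg1_cst 0 T lam^-1) => //; exact: subset_itv_oo_cc.
  apply: itgZ => //; apply: (itg_tauV2 htau) => //; last exact: itgD.
  by move=> x; rewrite /= !in_itv/= andbT => /andP[/ltW].
have := @Rint_sandwich _ _ _ leb `]0, T[ F _ _ (measurable_itv _) ia ig.
rewrite F0 sub0r normrN; apply=> t; rewrite /= in_itv/= => /andP[t0 _]; exact: FE.
Qed.

End momentum_equation.
Local Notation D t := (dissipation eps tau dtau S W t).
Local Notation I t := (\int[leb]_(r in `[0, t]) D r).

Lemma itg_dissipation (T : R) : itgt `[0, T] (fun t => D t).
Proof.
have [hreg _ _ _ _] := hRK; have ik := itg_kinetic htau hreg hED T.
have sub0 : `[0, T] `<=` `[(0 : R), +oo[.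
  by move=> x; rewrite /= !in_itv/= andbT => /andP[].
have ik3 := itg_tauV2 htau 3 (measurable_itv _) sub0 ik.
apply: eq_integrable (_ : itgt `[0, T] (fun t => dtau t * ((tau t ^+ 3)^-1 * kin t))) => //.
  by move=> t _; rewrite /dissipation mulrA.
apply: (itg_bM (C := dtau T)) => //.
  have := half_line_measurable (dtau_continuous htau); exact: measurable_funS.
move=> t; rewrite /= in_itv/= => /andP[t0 tT].
by rewrite ger0_norm ?(dtau_ge0 htau)// (dtau_ndecr htau).
Qed.

Lemma itg_itv_sub (f : R -> R) (a b : R) : 0 <= a -> (forall T, itgt `[0, T] f) ->
  itgt `[a, b] f.
Proof.
move=> a0 h; apply: integrableS (h b) => //; move=> x; rewrite /= !in_itv/= => /andP[ax ->].
by rewrite (le_trans a0 ax).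
Qed.

Lemma dissipation_block (t1 t2 : R) : 0 <= t1 -> t1 <= t2 ->
  \int[leb]_(r in `[t1, t2]) D r = I t2 - I t1.
Proof.
move=> t10 t12; rewrite Rintegral_itvB ?bnd_simp//; last exact: itg_dissipation.
rewrite Rintegral_itv_obnd_cbnd//.
apply: integrableS (itg_dissipation t2) => //; move=> x; rewrite /= !in_itv/= => /andP[tx ->].
by rewrite (le_trans t10 (ltW tx)).
Qed.

(** The accumulated dissipation is nondecreasing and bounded by [C0]; once it is within e of its
    supremum it can grow by at most e. *)
Lemma dissipation_tail (e : R) : 0 < e ->
  \forall T \near (+oo : set_system R), forall t, T <= t -> I t - I T <= e.
Proof.
move=> e0; pose X := [set I t | t in [set t : R | 0 <= t]].
have hX : has_sup X.
  split; first by exists (I 0), 0 => //=.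
  by exists C0 => _ [t /= t0 <-]; have := dissipation_int_le hED t0.
have [_ [t0 t00 <-] h0] := sup_adherent e0 hX.
near=> T => t Tt.
have h1 : I t0 <= I T.
  apply: (dissipation_int_nd htau hED); near: T; apply: nbhs_pinfty_ge; exact: num_real.
have T0 : 0 <= T by near: T; exact: near_pinfty_ge0.
have h2 : I t <= sup X.
  by apply: ub_le_sup; [case: hX|exists t => //=; exact: le_trans Tt].
lra.
Unshelve. all: by end_near. Qed.

(** The increments over the N dyadic blocks telescope to at most e, so they cannot all exceed e /
    N. *)
Lemma dissipation_pigeonhole (T e : R) N : 0 <= T -> (0 < N)%N ->
  I (2 ^+ N * T) - I T <= e ->
  exists2 k, (k < N)%N & I (2 ^+ k.+1 * T) - I (2 ^+ k * T) <= e / N%:R.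
Proof.
move=> T0 N0 h; apply: contrapT => hn.
have : \sum_(0 <= k < N) (e / N%:R) < \sum_(0 <= k < N) (I (2 ^+ k.+1 * T) - I (2 ^+ k * T)).
  apply: ltr_sum_nat => // k /andP[_ kN].
  by rewrite ltNge; apply/negP => hk; apply: hn; exists k.
rewrite (telescope_sumr (fun k => I (2 ^+ k * T)))// expr0 mul1r sumr_const_nat subn0.
rewrite -[X in X < _]mulr_natr divfK ?pnatr_eq0 -?lt0n//.
by rewrite ltNge h.
Qed.

Section momentum_decay.
Context (psi : 'I_d -> E -> R) (tpsi : forall i, test_fun (psi i)).
Let a t := \int[mu]_y (density S t y * stein_psi psi y).

(** With the weight m tau'(T) / tau(t) the kinetic part of the flux is at most a multiple of m D(t),
    since tau' is nondecreasing, and the mass part is at most a multiple of (tau' / tau) / (m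
    tau'(T)^2), whose integral is bounded by a constant over m. *)
Lemma stein_slow : exists2 K : R, 0 <= K & forall (T m e : R), 0 < m ->
  2 <= T -> 0 < dtau T -> dtau (2 * T ^+ 2) <= 3 * dtau T ->
  (forall t, T <= t -> I t - I T <= e) ->
  forall r, T <= r <= T ^+ 2 -> `|a r - a T| <= K * (m * e + m^-1).
Proof.
have tst := test_fun_stein tpsi.
have [B B0 hB] := test_vec_bounded (fun i => test_fun_partial i tst).
have M0 := mass_bound_ge0.
exists (2 * B * (1 + d%:R * M * (9 / 4))).
  by rewrite mulr_ge0 ?mulr_ge0// addr_ge0// mulr_ge0// mulr_ge0.
move=> T m e m0 T2 D0 D3 he r /andP[Tr rT].
have T0 : 0 < T by lra.
pose lam t := m * dtau T / tau t.
have lam0 t : 0 <= t -> 0 < lam t.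
  by move=> t0; rewrite divr_gt0 ?(tau_gt0 htau)// mulr_gt0.
have [hreg _ _ _ _] := hRK.
have sub0 X : `[0, X] `<=` `[(0 : R), +oo[.
  by move=> x; rewrite /= !in_itv/= andbT => /andP[].
have ig X : itgt `[0, X] (mass_flux_bound B lam).
  apply: itgZ => //; apply: (itg_tauV2 htau) => //; apply: itgZ => //; apply: itgD => //.
    rewrite (_ : (fun t => _) = (fun t => (m * dtau T * ((tau t ^+ 1)^-1 * kin t))%:E)).
      apply: itgZ => //; apply: (itg_tauV2 htau) => //; exact: (itg_kinetic htau hreg hED X).
    by apply/funext => t; rewrite expr1 /lam mulrA.
  have ct : itgt `[0, X] (fun t => tau t).
    apply: continuous_compact_integrable; first exact: segment_compact.
    exact: within_ge0_sub (tau_continuous htau).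
  rewrite (_ : (fun t => _) = (fun t => (d%:R * (m * dtau T)^-1 * M * tau t)%:E)).
    exact: itgZ.
  by apply/funext => t; rewrite /lam invf_div; congr (_%:E); ring.
have h1 := density_slow tst B0 hB lam0 ig (ltW T0) Tr.
apply: le_trans h1 _.
(* Room for the extra unit of time in [density_slow]: r + 1 <= T^2 + 1 <= 2 T^2. *)
pose Z := 2 * T ^+ 2.
have TT1 : 1 <= T ^+ 2 by rewrite exprn_ege1//; lra.
have rZ : r + 1 <= Z by rewrite /Z; lra.
have TZ : T < Z by lra.
have Z0 : 0 < Z by lra.
have [il intl] := int_dtau_tau htau T0 TZ.
have iD : itgt `[T, Z] (fun t => D t) by apply: itg_itv_sub; [lra|exact: itg_dissipation].
pose h t := 2 * B * (m * D t + d%:R * M / (m * dtau T ^+ 2) * (dtau t / tau t)).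
have ih : itgt `[T, Z] h by apply: itgZ => //; apply: itgD => //; exact: itgZ.
apply: (@le_trans _ _ (\int[leb]_(t in `[T, Z]) mass_flux_bound B lam t)).
  apply: Rint_le_supp => //.
  - by apply: itg_itv_sub => //; lra.
  - move=> t; rewrite /= in_itv/= => /andP[Tt tr].
    by apply: mass_flux_bound_ge0 => //; lra.
  - move=> t; rewrite /= in_itv/= => /andP[Tt tZ].
    by apply: mass_flux_bound_ge0 => //; lra.
  - by move=> t; rewrite /= !in_itv/= => /andP[-> tr] []; lra.
apply: (@le_trans _ _ (\int[leb]_(t in `[T, Z]) h t)).
  apply: le_Rintegral => //; first by apply: itg_itv_sub => //; lra.
  move=> t; rewrite /= in_itv/= => /andP[Tt tZ].
  have t0 : 0 <= t by lra.
  have [hS hW _ _] := hED t0; have k0 : 0 <= kin t by exact: kinetic_ge0.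
  have dd := dtau_ndecr htau (ltW T0) Tt; have tp := tau_gt0 htau t0.
  rewrite /mass_flux_bound /h [leLHS](_ : _ = 2 * B * ((tau t ^+ 2)^-1 * (lam t * kin t) +
    (tau t ^+ 2)^-1 * (d%:R * (lam t)^-1 * M))); last by ring.
  apply: ler_wpM2l; [exact: mulr_ge0|apply: lerD].
    rewrite /dissipation /lam.
    rewrite [leLHS](_ : _ = m * (dtau T / tau t ^+ 3 * kin t)); last by field; rewrite gt_eqF.
    by rewrite ler_wpM2l ?(ltW m0)// ler_wpM2r// ler_wpM2r// invr_ge0 exprn_ge0// ltW.
  rewrite [leLHS](_ : _ = d%:R * M / (m * dtau T ^+ 2) * (dtau T / tau t)); last first.
    by rewrite /lam; field; rewrite !gt_eqF.
  apply: ler_wpM2l; first exact: divr_ge0 (mulr_ge0 (ler0n _ _) M0) (mulr_ge0 (ltW m0) (sqr_ge0 _)).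
  by rewrite ler_wpM2r// invr_ge0 ltW.
have e0 : 0 <= e by have := he T (lexx _); rewrite subrr.
have le1 : \int[leb]_(t in `[T, Z]) D t <= e.
  by rewrite dissipation_block; [apply: he; lra|lra|lra].
(* Since 4 ln tau = tau'^2 and tau'(Z) <= 3 tau'(T), this explains 9 / 4. *)
have le2 : ln (tau Z) - ln (tau T) <= 9 / 4 * dtau T ^+ 2.
  have h2 := dtau_sqr htau (ltW Z0); have h3 := dtau_sqr htau (ltW T0).
  have h4 := sqr_ge0 (dtau T).
  have h5 : dtau Z ^+ 2 <= 9 * dtau T ^+ 2.
    rewrite (_ : 9 * _ = (3 * dtau T) ^+ 2); last by ring.
    by rewrite lerXn2r ?nnegrE ?(dtau_ge0 htau (ltW Z0))// mulr_ge0// ltW.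
  lra.
rewrite /h RintegralZl//; last by apply: itgD => //; exact: itgZ.
rewrite RintegralD//; [|exact: itgZ..].
rewrite !RintegralZl// intl -[leRHS]mulrA; apply: ler_wpM2l; first by rewrite mulr_ge0.
have D2 : 0 < dtau T ^+ 2 by rewrite exprn_gt0.
have c0 : 0 <= d%:R * M / (m * dtau T ^+ 2).
  exact: divr_ge0 (mulr_ge0 (ler0n _ _) M0) (mulr_ge0 (ltW m0) (sqr_ge0 _)).
apply: le_trans (lerD (ler_wpM2l (ltW m0) le1) (ler_wpM2l c0 le2)) _.
rewrite (_ : d%:R * M / (m * dtau T ^+ 2) * (9 / 4 * dtau T ^+ 2) = d%:R * M * (9 / 4) * m^-1); last first.
  by field; rewrite !gt_eqF.
have x0 : 0 <= m * e by rewrite mulr_ge0// ltW.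
have y0 : 0 <= m^-1 by rewrite invr_ge0 ltW.
have z0 : 0 <= d%:R * M * (9 / 4) by rewrite mulr_ge0// mulr_ge0.
rewrite [leRHS](_ : _ = m * e + d%:R * M * (9 / 4) * m^-1 +
  (m^-1 + d%:R * M * (9 / 4) * (m * e))); last by ring.
by rewrite lerDl addr_ge0// mulr_ge0.
Qed.


(** On one block [L, 2 L] with little dissipation the momentum equation controls the average of [a],
    and [stein_slow] carries the bound back to the time T. *)
Lemma stein_decay : exists2 K : R, 0 <= K & forall (T m e : R), 0 < m ->
  2 <= T -> 1 <= dtau T -> dtau (2 * T ^+ 2) <= 3 * dtau T ->
  (exists N, [/\ (0 < N)%N, 2 ^+ N <= T & dtau T ^+ 2 <= 32 * N%:R]) ->
  (forall t, T <= t -> I t - I T <= e) ->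
  `|a T| <= K * (m * e + m^-1 + e + (tau T ^+ 2)^-1).
Proof.
have [K1 K10 hslow] := stein_slow.
have [K2 K20 hmom] := momentum_equation tpsi.
have [B [b [[sB sb dB b0 bs] [B0 B1 B01]]]] := smooth_step (@ltr01 R).
have tb : test1 b.
  split => //; exists 1 => x x1; apply: bs; apply/negP => /andP[x0 x1'].
  by move: x1; rewrite gtr0_norm// leNgt x1'.
have [Cb Cb0 hCb] := test1_bounded tb.
have [H H0 hH] := test1_bounded (test1_derive tb).
have db0 x : ~~ (0 <= x <= 1) -> 'D_1 b x = 0.
  move=> /negP h; apply: (derive_eq0_out (K := `[(0 : R), 1]%classic)); [exact: interval_closed| |by rewrite /= in_itv].
  move=> y; rewrite /= in_itv/= => /negP hy; apply: bs.
  by apply: contra hy => /andP[/ltW -> /ltW ->].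
pose Q := 2 * (H * K2 * (343 * 32 + 1) + Cb * K2 * 8) + K1.
have HK0 : 0 <= H * K2 by rewrite mulr_ge0.
have CK0 : 0 <= Cb * K2 by rewrite mulr_ge0.
exists Q; first by rewrite /Q; lra.
move=> T m e m0 T2 D1 D3 [N [N0 NT DN]] he.
have T0 : 0 < T by lra.
have D0 : 0 < dtau T by lra.
have e0 : 0 <= e by have := he T (lexx _); rewrite subrr.
have osc := hslow T m e m0 T2 D0 D3 he.
have [k kN hk] : exists2 k, (k < N)%N & I (2 ^+ k.+1 * T) - I (2 ^+ k * T) <= e / N%:R.
  apply: dissipation_pigeonhole => //; first exact: ltW.
  by apply: he; rewrite ler_peMl ?(ltW T0)// exprn_ege1// ler1n.
pose L := 2 ^+ k * T.
have L2 : 2 ^+ k.+1 * T = 2 * L by rewrite exprS mulrA.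
rewrite L2 -/L in hk.
have TL : T <= L by rewrite ler_peMl ?(ltW T0)// exprn_ege1// ler1n.
have LT2 : 2 * L <= T ^+ 2.
  rewrite -L2 expr2 ler_wpM2r ?(ltW T0)//; apply: le_trans NT.
  by rewrite ler_weXn2l// ler1n.
have L0 : 0 < L by lra.
pose dk := I (2 * L) - I L.
have L_le : L <= 2 * L by rewrite ler_peMl ?(ltW L0)// ler1n.
have dkE : \int[leb]_(t in `[L, 2 * L]) D t = dk by exact: dissipation_block (ltW L0) L_le.
have dk0 : 0 <= dk.
  rewrite -dkE; apply: Rintegral_ge0 => t; rewrite /= in_itv/= => /andP[Lt _].
  by apply: (diss_ge0 htau hED); apply: le_trans Lt; exact: ltW.
have NN : 1 <= N%:R :> R by rewrite ler1n.
have Npos : 0 < N%:R :> R by rewrite ltr0n.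
have dke : dk <= e by apply: le_trans hk _; rewrite ler_pdivrMr// ler_peMr.
(* The gain from the pigeonhole: the factor tau'(T)^2 <= 32 N meets a block dissipation of at most e
   / N. *)
have Ddk : dtau T ^+ 2 * dk <= 32 * e.
  apply: le_trans (_ : 32 * N%:R * (e / N%:R) <= _); first exact: ler_pM (sqr_ge0 _) dk0 DN hk.
  by rewrite le_eqVlt; apply/orP; left; apply/eqP; field; rewrite gt_eqF.
(* Supported in [L, 2 L], with integral L and derivative O(1/L), so that dividing by L at the end
   gives an average. *)
pose th r := b (L^-1 * r + -1).
have sth : smooth th by exact: smooth_affineR.
have Dth r : 'D_1 th r = L^-1 * 'D_1 b (L^-1 * r + -1).
  exact: (@derive_val _ _ _ _ _ _ _ (is_derive_affineR L^-1 (-1) r (fun y => smooth_is_derive y sb))).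
have iL0 : 0 < L^-1 by rewrite invr_gt0.
have thout r : ~~ (L <= r <= 2 * L) -> th r = 0 /\ 'D_1 th r = 0.
  move=> h; have h' : ~~ (0 <= L^-1 * r + -1 <= 1).
    apply: contra h; rewrite subr_ge0 lerBlDr ler_pdivlMl// mulr1 ler_pdivrMl//.
    by rewrite [L * _]mulrC.
  split; last by rewrite Dth db0// mulr0.
  by apply: bs; apply: contra h' => /andP[/ltW -> /ltW ->].
have th'le r : `|'D_1 th r| <= H / L.
  by rewrite Dth normrM gtr0_norm// mulrC ler_wpM2r// ltW.
pose X := 2 * L + 1.
have X0 : 0 < X by rewrite /X ltr_wpDl// mulr_ge0// ltW.
(* With this weight and kin = O(L^3 tau'(T)^2 D), the kinetic term integrates to O(m L tau'(T)^2 dk)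
   and the term in 1 / lam to O(L / m), both proportional to L. *)
pose lam := m / L.
have lam0 : 0 < lam by rewrite divr_gt0.
have := hmom X th (2 * L) lam X0 _ sth _ _ lam0.
have bX : 2 * L < X by rewrite /X ltrDl.
have thv t : 2 * L < t -> th t = 0.
  by move=> tL; apply: (thout _ _).1; rewrite negb_and -!ltNge tL orbT.
have th00 : th 0 = 0 by apply: (thout _ _).1; rewrite negb_and -!ltNge L0.
move=> /(_ bX thv th00); set G := fun t => _ + _ => hG.
pose q := (tau T ^+ 2)^-1.
pose cD := H / L * (K2 * (lam * (343 * L ^+ 3 * dtau T ^+ 2))) + Cb * (K2 * (7 * L)).
pose c1 := H / L * (K2 * lam^-1) + Cb * (K2 * q).
pose G2 r := cD * D r + c1.
have iD : itgt `[L, 2 * L] (fun t => D t).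
  by apply: itg_itv_sub; [exact: ltW|exact: itg_dissipation].
have iG2 : itgt `[L, 2 * L] G2 by apply: itgD => //; [exact: itgZ|exact: itg1_cst].
have LL : fine (leb `[L, 2 * L]) = L.
  rewrite lebesgue_measure_itv/= lte_fin ifT; last by rewrite ltr_pMl// ltr1n.
  by rewrite -EFinB/=; ring.
have G2E : \int[leb]_(r in `[L, 2 * L]) G2 r =
    L * (H * K2 * (343 * m * (dtau T ^+ 2 * dk) + m^-1) + Cb * K2 * (7 * dk + q)).
  rewrite /G2 RintegralD//; [|exact: itgZ|exact: itg1_cst].
  rewrite RintegralZl// Rintegral_cst// LL dkE /cD /c1 /lam; field.
  by rewrite !gt_eqF.
have lt2 t : L <= t <= 2 * L -> [/\ 0 <= t, T <= t & t <= T ^+ 2].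
  move=> /andP[Lt t2]; have Tt := le_trans TL Lt; split => //; last exact: le_trans LT2.
  exact: le_trans (ltW T0) Tt.
have GG2 : \int[leb]_(r in `]0, X[) G r <= \int[leb]_(r in `[L, 2 * L]) G2 r.
  apply: Rint_le_supp => //.
  - move=> t; rewrite /= in_itv/= => /andP[/ltW t0 _]; have [hS hW _ _] := hED t0.
    have k0 : 0 <= kin t by exact: kinetic_ge0.
    have /andP[q0 _] := tauV_le1 htau 2 t0.
    have l1 : 0 <= lam * kin t + lam^-1.
      by apply: addr_ge0; [exact: mulr_ge0 (ltW lam0) k0|rewrite invr_ge0 ltW].
    have l2 : 0 <= (tau t ^+ 2)^-1 * (kin t + 1) by rewrite mulr_ge0// addr_ge0.
    exact: addr_ge0 (mulr_ge0 (normr_ge0 _) (mulr_ge0 K20 l1))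
      (mulr_ge0 (normr_ge0 _) (mulr_ge0 K20 l2)).
  - move=> t; rewrite /= in_itv/= => /lt2[t0 _ _]; have d0 := diss_ge0 htau hED t0.
    have q0 : 0 <= q by rewrite invr_ge0 sqr_ge0.
    have HL0 : 0 <= H / L by exact: divr_ge0 H0 (ltW L0).
    have il0 : 0 <= lam^-1 by rewrite invr_ge0 ltW.
    have P0 : 0 <= 343 * L ^+ 3 * dtau T ^+ 2.
      exact: mulr_ge0 (mulr_ge0 (ler0n _ _) (exprn_ge0 3 (ltW L0))) (sqr_ge0 _).
    have h1 : 0 <= cD.
      exact: addr_ge0 (mulr_ge0 HL0 (mulr_ge0 K20 (mulr_ge0 (ltW lam0) P0)))
        (mulr_ge0 Cb0 (mulr_ge0 K20 (mulr_ge0 (ler0n _ _) (ltW L0)))).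
    have h2 : 0 <= c1.
      exact: addr_ge0 (mulr_ge0 HL0 (mulr_ge0 K20 il0)) (mulr_ge0 Cb0 (mulr_ge0 K20 q0)).
    exact: addr_ge0 (mulr_ge0 h1 d0) h2.
  - move=> t _; rewrite /= in_itv/= => Lt; have [t0 Tt tT2] := lt2 _ Lt.
    have [hS hW _ _] := hED t0; have k0 : 0 <= kin t by exact: kinetic_ge0.
    have d0 := diss_ge0 htau hED t0.
    have tp := tau_gt0 htau t0; have dd := dtau_ndecr htau (ltW T0) Tt.
    have dp : 0 < dtau t by exact: lt_le_trans dd.
    have [tle tdle] := tau_block htau T0 TL D1 D3 T2 Lt tT2.
    have kD : kin t = tau t ^+ 3 / dtau t * D t.
      by rewrite /dissipation; field; rewrite !gt_eqF.
    (* kin = (tau^3 / tau') D, with tau <= 7 L tau'(T) used twice and tau / tau' <= 7 L once. *)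
    have h1 : kin t <= 343 * L ^+ 3 * dtau T ^+ 2 * D t.
      rewrite kD; apply: ler_wpM2r => //.
      rewrite (_ : tau t ^+ 3 / dtau t = tau t ^+ 2 * (tau t / dtau t)); last by field; rewrite gt_eqF.
      rewrite (_ : 343 * _ * _ = (7 * L * dtau T) ^+ 2 * (7 * L)); last by ring.
      apply: ler_pM => //; first by rewrite sqr_ge0.
        by rewrite divr_ge0// ltW.
      by apply: lerXn2r => //; rewrite nnegrE; [exact: ltW|exact: le_trans (ltW tp) tle].
    have h2 : (tau t ^+ 2)^-1 * kin t <= 7 * L * D t.
      rewrite kD [leLHS](_ : _ = tau t / dtau t * D t); last by field; rewrite !gt_eqF.
      exact: ler_wpM2r.
    have h3 : (tau t ^+ 2)^-1 <= q.
      have tTp := tau_gt0 htau (ltW T0).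
      rewrite /q lef_pV2 ?posrE ?exprn_gt0//.
      apply: lerXn2r; [exact: ltW|exact: ltW|exact: (tau_ndecr htau (ltW T0) Tt)].
    have /andP[q0 _] := tauV_le1 htau 2 t0.
    rewrite [G2 t](_ : _ = H / L * (K2 * (lam * (343 * L ^+ 3 * dtau T ^+ 2 * D t) + lam^-1)) +
        Cb * (K2 * (7 * L * D t + q))); last by rewrite /G2 /cD /c1; ring.
    apply: lerD; apply: ler_pM => //.
    + apply: mulr_ge0 => //; apply: addr_ge0; first exact: mulr_ge0 (ltW lam0) k0.
      by rewrite invr_ge0 ltW.
    + by rewrite ler_wpM2l// lerD2r ler_wpM2l// ltW.
    + by rewrite mulr_ge0// mulr_ge0// addr_ge0.
    + exact: hCb.
    + by rewrite ler_wpM2l// mulrDr mulr1 lerD.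
  - move=> t _ /= /negP; rewrite in_itv/= => /thout[e1 e2].
    by rewrite /G e1 e2 normr0 !mul0r addr0.
have cth : continuous th by exact: smooth_continuous.
(* L B(r / L - 1) is a primitive of th and rises from 0 to L. *)
have thL : \int[leb]_(r in `]0, X[) th r = L.
  rewrite Rint_oo_cc; last exact: itg1_continuous.
  have dF r : is_derive r (1 : R) (fun r => L * B (L^-1 * r + -1)) (th r).
    have := is_deriveZ L (is_derive_affineR L^-1 (-1) r dB).
    by move/is_derive_eq; apply; rewrite /GRing.scale/= mulVKf// gt_eqF.
  rewrite (Rint_FTC X0 dF cth) B1; last first.
    by rewrite lerBrDl ler_pdivlMl// mulrDr mulr1 /X -mulr2n mulr_natl lerDl.
  by rewrite B0 ?mulr0 ?subr0 ?mulr1// mulr0 add0r lerN10.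
have tst := test_fun_stein tpsi.
have hosc : `|\int[leb]_(t in `]0, X[) (th t * a t) - a T * L| <= L * (K1 * (m * e + m^-1)).
  have i1 : itgt `]0, X[ (fun t => th t * a t).
    by apply: itg_smooth_continuous => //; exact: hwc.
  have i2 : itgt `]0, X[ th.
    by apply: integrableS (itg1_continuous 0 X cth) => //; exact: subset_itv_oo_cc.
  rewrite -thL -RintegralZl// -RintegralB//; last exact: itgZ.
  rewrite mulrC -RintegralZl//; apply: Rint_abs_le => //; [|exact: itgZ|].
    by apply: itgB => //; exact: itgZ.
  move=> t _; have -> : th t * a t - a T * th t = (a t - a T) * th t by ring.
  have th0' : 0 <= th t by exact: b0.
  rewrite normrM (ger0_norm th0').
  have [Lt|/thout[-> _]] := boolP (L <= t <= 2 * L); last by rewrite !mulr0.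
  by rewrite ler_wpM2r//; apply: osc; have [_ -> ->] := lt2 _ Lt.
rewrite G2E in GG2.
set Y := H * K2 * _ + _ in GG2.
have h1 : `|a T| * L <= L * (2 * Y + K1 * (m * e + m^-1)).
  have := ler_normB (\int[leb]_(t in `]0, X[) (th t * a t))
    (\int[leb]_(t in `]0, X[) (th t * a t) - a T * L).
  rewrite opprB addrC subrK normrM (gtr0_norm L0) => h.
  apply: le_trans h _; rewrite mulrDr lerD//; apply: le_trans hG _.
  by rewrite mulrCA ler_wpM2l.
have h2 : `|a T| <= 2 * Y + K1 * (m * e + m^-1) by rewrite mulrC ler_pM2l in h1.
apply: le_trans h2 _.
have hme : m * (dtau T ^+ 2 * dk) <= m * (32 * e) by rewrite ler_wpM2l// ltW.
have n1 : 0 <= m * e by rewrite mulr_ge0// ltW.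
have n2 : 0 <= m^-1 by rewrite invr_ge0 ltW.
have n3 : 0 <= q by rewrite invr_ge0 sqr_ge0.
have Yle : Y <= H * K2 * (343 * 32 * (m * e) + m^-1) + Cb * K2 * (7 * e + q).
  rewrite /Y; apply: lerD; apply: ler_wpM2l => //.
    rewrite lerD2r -!(mulrA 343); apply: ler_wpM2l; first exact: ler0n.
    by rewrite (mulrCA 32).
  by rewrite lerD2r ler_wpM2l.
exact: (stein_arith HK0 CK0 K10 n1 n2 e0 n3 Yle).
Qed.

Lemma stein_cvg : a t @[t --> +oo] --> (0 : R).
Proof.
have [K K0 hK] := stein_decay.
apply/cvgr0Pnorm_le => e e0.
have K1 : 0 < K + 1 by rewrite ltr_wpDl.
(* m is fixed first, to make K / m small; e' then depends on m and is reached by the tail of the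
   dissipation once T is large. *)
pose m := 4 * (K + 1) / e.
have m0 : 0 < m by rewrite divr_gt0// mulr_gt0.
pose e' := e / (4 * (K + 1) * (m + 1)).
have m1 : 0 < m + 1 by rewrite ltr_wpDl// ltW.
have e'0 : 0 < e' by rewrite divr_gt0// mulr_gt0// mulr_gt0.
pose e2 := e / (4 * (K + 1)).
have e20 : 0 < e2 by rewrite divr_gt0// mulr_gt0.
near=> T.
have [T2 D1 D3 hN] : [/\ 2 <= T, 1 <= dtau T, dtau (2 * T ^+ 2) <= 3 * dtau T &
      exists N, [/\ (0 < N)%N, 2 ^+ N <= T & dtau T ^+ 2 <= 32 * N%:R]].
  by near: T; exact: tau_window htau.
have hT : forall t, T <= t -> I t - I T <= e' by near: T; exact: dissipation_tail.
apply: le_trans (hK T m e' m0 T2 D1 D3 hN hT) _.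
have T0 : 0 <= T by exact: le_trans T2.
have t1 := tau_ge1 htau T0.
have tq : (tau T ^+ 2)^-1 <= e2.
  have : e2^-1 <= tau T by near: T; move/cvgryPge : (tau_cvg htau); exact.
  move=> h; rewrite invf_ple ?posrE ?exprn_gt0 ?(lt_le_trans ltr01 t1)//.
  by apply: le_trans h _; rewrite expr2 ler_peMr// (le_trans ler01 t1).
have Kle x : 0 <= x -> K * x <= (K + 1) * x by move=> x0; rewrite ler_wpM2r// lerDl.
have h1 : K * (m * e' + e') <= e / 4.
  apply: le_trans (Kle _ _) _; first exact: addr_ge0 (mulr_ge0 (ltW m0) (ltW e'0)) (ltW e'0).
  by rewrite le_eqVlt; apply/orP; left; apply/eqP; rewrite /e'; field; rewrite !gt_eqF.
have h2 : K * m^-1 <= e / 4.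
  apply: le_trans (Kle _ _) _; first by rewrite invr_ge0 ltW.
  by rewrite le_eqVlt; apply/orP; left; apply/eqP; rewrite /m; field; rewrite !gt_eqF.
have h3 : K * (tau T ^+ 2)^-1 <= e / 4.
  apply: le_trans (ler_wpM2l K0 tq) _; apply: le_trans (Kle _ (ltW e20)) _.
  by rewrite le_eqVlt; apply/orP; left; apply/eqP; rewrite /e2; field; rewrite gt_eqF.
rewrite (_ : K * _ = K * (m * e' + e') + K * m^-1 + K * (tau T ^+ 2)^-1); last by ring.
exact: quarter3 (ltW e0) h1 h2 h3.
Unshelve. all: by end_near. Qed.

End momentum_decay.

End rescaled_dynamics.

(** * The second moment *)

Section second_moment.
Context {R : realType} {d : nat}.
Local Notation E := 'rV[R]_d.
Local Notation mu := (lebesgue_rV d).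
Local Notation itg f := (mu.-integrable setT (fun x => (f x)%:E)).

Lemma measurable_scaled (c k : R) (g : E -> R) : measurable_fun setT g ->
  measurable_fun setT (fun x : E => k * g (c *: x)).
Proof.
move=> mg; apply: measurable_funM => //; apply: measurableT_comp => //.
exact: measurable_scale_rV.
Qed.

Lemma Rint_scale (c : R) (f : E -> R) : 0 < c -> itg f ->
  itg (fun x : E => (c ^+ d)^-1 * f (c^-1 *: x)) /\
  \int[mu]_x ((c ^+ d)^-1 * f (c^-1 *: x)) = \int[mu]_x f x.
Proof.
move=> c0 fi; have mf := itg_meas fi; have ic0 : 0 < c^-1 by rewrite invr_gt0.
have cd0 : 0 <= (c ^+ d)^-1 by rewrite invr_ge0 exprn_ge0// ltW.
have key (g : E -> R) : measurable_fun setT g -> (forall x, 0 <= g x) ->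
    (\int[mu]_x ((c ^+ d)^-1 * g (c^-1 *: x))%:E = \int[mu]_x (g x)%:E)%E.
  move=> mg g0.
  rewrite [RHS](ge0_integral_scale (f := fun x => (g x)%:E) ic0); last 2 first.
  - exact/measurable_EFinP.
  - by move=> x; rewrite lee_fin.
  rewrite exprVn -ge0_integralZl//.
  - apply/measurable_EFinP; under eq_fun do rewrite -[g _]mul1r; exact: measurable_scaled.
  - by move=> x _; rewrite lee_fin.
have key2 (g : E -> R) : itg g -> (forall x, 0 <= g x) ->
    itg (fun x : E => (c ^+ d)^-1 * g (c^-1 *: x)) /\
    \int[mu]_x ((c ^+ d)^-1 * g (c^-1 *: x)) = \int[mu]_x g x.
  move=> ig g0; have mg := itg_meas ig; have k := key _ mg g0.
  split; last by rewrite /Rintegral k.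
  apply/integrableP; split; first by apply/measurable_EFinP; exact: measurable_scaled.
  have /integrableP[_] := ig.
  rewrite (eq_integral (fun x => (g x)%:E)); last first.
    by move=> x _; rewrite abse_EFin ger0_norm.
  rewrite -k; have -> : (\int[mu]_x `|((c ^+ d)^-1 * g (c^-1 *: x))%:E| =
      \int[mu]_x ((c ^+ d)^-1 * g (c^-1 *: x))%:E)%E.
    by apply: eq_integral => x _; rewrite abse_EFin ger0_norm// mulr_ge0.
  by [].
pose p x := Num.max (f x) 0; pose q x := Num.max (- f x) 0.
have ip : itg p.
  apply: itg_le (itg_abs fi) => //; first exact: measurable_maxr.
  move=> x _; rewrite ger0_norm ?le_max ?lexx ?orbT// /p ge_max normr_ge0 andbT; exact: ler_norm.
have iq : itg q.
  apply: itg_le (itg_abs fi) => //; first by apply: measurable_maxr => //; exact: measurableT_comp.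
  move=> x _; rewrite ger0_norm ?le_max ?lexx ?orbT// /q ge_max normr_ge0 andbT -normrN; exact: ler_norm.
have fpq x : f x = p x - q x.
  rewrite /p /q; case: (leP (f x) 0) => h1; case: (leP (- f x) 0) => h2; lra.
have p0 x : 0 <= p x by rewrite le_max lexx orbT.
have q0 x : 0 <= q x by rewrite le_max lexx orbT.
have [p1 p2] := key2 p ip p0; have [q1 q2] := key2 q iq q0.
have -> : (fun x : E => ((c ^+ d)^-1 * f (c^-1 *: x))%:E) =
    (fun x : E => ((c ^+ d)^-1 * p (c^-1 *: x) - (c ^+ d)^-1 * q (c^-1 *: x))%:E).
  by apply/funext => x; rewrite fpq mulrBr.
split; first exact: itgB.
transitivity (\int[mu]_x ((c ^+ d)^-1 * p (c^-1 *: x) - (c ^+ d)^-1 * q (c^-1 *: x))).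
  by apply: eq_Rintegral => x _; rewrite fpq mulrBr.
rewrite RintegralB// p2 q2 -RintegralB//.
by apply: eq_Rintegral => x _; rewrite fpq.
Qed.

(** The difference of the two sides is |a + e b|^2 / e. *)
Lemma sqn_add_ge (a b : E) (e : R) : 0 < e ->
  (1 - e) * sqn b - (e^-1 - 1) * sqn a <= sqn (a + b).
Proof.
move=> e0; rewrite !sqnE !mulr_sumr -sumrB; apply: ler_sum => i _.
rewrite mxE; set x := a ord0 i; set y := b ord0 i.
rewrite -subr_ge0.
have -> : (x + y) ^+ 2 - ((1 - e) * y ^+ 2 - (e^-1 - 1) * x ^+ 2) = e^-1 * (x + e * y) ^+ 2.
  by field; rewrite gt_eqF.
by rewrite mulr_ge0 ?sqr_ge0// invr_ge0 ltW.
Qed.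

Lemma Rint_ae_le (f g : E -> R) : itg f -> itg g -> {ae mu, forall x, f x <= g x} ->
  \int[mu]_x f x <= \int[mu]_x g x.
Proof.
move=> fi gi fg; have mf := itg_meas fi; have mg := itg_meas gi.
pose h x := Num.max (f x) (g x).
have ih : itg h.
  apply: itg_le (itgD measurableT (itg_abs fi) (itg_abs gi)) => //; first exact: measurable_maxr.
  by move=> x _; rewrite /h; case: (leP (f x) (g x)) => _; [rewrite lerDr|rewrite lerDl].
rewrite (@Rint_ae_eq _ _ _ mu setT g h)//.
- by apply: le_Rintegral => // x _; rewrite /h le_max lexx.
- exact: measurable_maxr.
- by apply: filterS fg => x fgx _; rewrite /h max_r.
Qed.

Lemma lnM3 (x y z : R) : 0 < x -> 0 < y -> 0 < z -> ln (x * (y * z)) = ln x + (ln y + ln z).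
Proof. by move=> x0 y0 z0; rewrite lnM ?posrE ?mulr_gt0// lnM ?posrE. Qed.

Lemma powR_sqrV (t a : R) n : 0 <= t -> a * 2 = n%:R -> (t `^ a)^-1 ^+ 2 = (t ^+ n)^-1.
Proof.
move=> t0 h; rewrite exprVn; congr (_^-1).
by rewrite -[LHS]powR_mulrn ?powR_ge0// -powRrM h powR_mulrn.
Qed.

Section fixed_time.
Context (t m c : R) (m0 : 0 < m) (t1 : 0 < t) (S s : E -> R) (W w : E -> E)
  (hs : s \in Lfun mu 2%:E) (hw : L2v w) (hS : S \in Lfun mu 2%:E) (hW : L2v W)
  (hr : {ae mu, forall x : E,
    s x = (t `^ (d%:R / 2))^-1 * S (t^-1 *: x) * Num.sqrt m /\
    w x = ((t `^ (1 + d%:R / 2))^-1 * Num.sqrt m) *: W (t^-1 *: x) + (c / t * s x) *: x}).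

Let td0 : 0 < (t ^+ d)^-1. Proof. by rewrite invr_gt0 exprn_gt0. Qed.

Lemma scaled_density : {ae mu, forall x : E,
  s x ^+ 2 = m * ((t ^+ d)^-1 * S (t^-1 *: x) ^+ 2)}.
Proof.
apply: filterS hr => x [-> _].
rewrite !exprMn sqr_sqrtr ?(ltW m0)// (powR_sqrV (n := d)) ?(ltW t1) ?divfK//.
ring.
Qed.

(** Here t stands for tau and c for tau'. In w the drift (c / t) s x dominates, its square
    integrating to m c^2 times the second moment of S^2; [sqn_add_ge] keeps almost all of it, at the
    price of a multiple of the rescaled kinetic term. *)
Lemma kinetic_rescaled (e : R) : 0 < e -> itg (fun y => S y ^+ 2 * sqn y) ->
  m * ((1 - e) * c ^+ 2 * \int[mu]_y (S y ^+ 2 * sqn y)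
       - (e^-1 - 1) * (t ^+ 2)^-1 * \int[mu]_y sqn (W y)) <= \int[mu]_x sqn (w x).
Proof.
move=> e0 iq; have [_ iW] := L2v_sqr hW; have [_ iw] := L2v_sqr hw.
pose A := m * ((1 - e) * c ^+ 2); pose B := - (m * ((e^-1 - 1) * (t ^+ 2)^-1)).
have ih := itgD measurableT (itgZ A measurableT iq) (itgZ B measurableT iW).
have [i2 e2] := Rint_scale t1 ih.
rewrite [leLHS](_ : _ = A * \int[mu]_y (S y ^+ 2 * sqn y) + B * \int[mu]_y sqn (W y)); last first.
  by rewrite /A /B; ring.
rewrite Rint_lin2// -e2; apply: Rint_ae_le => //.
apply: filterS (filterI hr scaled_density) => x [[_ ->] sx].
have yx : sqn (t^-1 *: x) = (t ^+ 2)^-1 * sqn x.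
  by rewrite !sqnE mulr_sumr; apply: eq_bigr => i _; rewrite mxE exprMn exprVn.
move: sx yx; move: (t^-1 *: x) => y sx yx.
apply: le_trans (sqn_add_ge _ _ e0).
have sZ k (v : E) : sqn (k *: v) = k ^+ 2 * sqn v.
  by rewrite !sqnE mulr_sumr; apply: eq_bigr => i _; rewrite mxE exprMn.
rewrite !sZ !exprMn sqr_sqrtr ?(ltW m0)// sx yx.
have -> : (t `^ (1 + d%:R / 2))^-1 ^+ 2 = (t ^+ 2)^-1 * (t ^+ d)^-1.
  rewrite -invfM -exprD; apply: powR_sqrV; first exact: ltW.
  by rewrite natrD mulrDl mul1r divfK.
rewrite -/(sqn (W y)) le_eqVlt; apply/orP; left; apply/eqP; rewrite /A /B; field.
by rewrite !gt_eqF ?exprn_gt0.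
Qed.

(** Where S is nonzero, the logarithm of m t^(-d) S^2 splits into ln m - d ln t + ln S^2; where S
    vanishes, both integrands are 0. *)
Lemma entropy_rescaled : itg (fun y => S y ^+ 2 * ln (S y ^+ 2)) ->
  \int[mu]_x (s x ^+ 2 * ln (s x ^+ 2)) =
  m * (\int[mu]_y (S y ^+ 2 * ln (S y ^+ 2)) + (ln m - d%:R * ln t) * \int[mu]_y S y ^+ 2).
Proof.
move=> iE; have iS := Lfun2_sqr hS; have ms := itg_meas (Lfun2_sqr hs).
have ih := itgD measurableT (itgZ m measurableT iE)
  (itgZ (m * (ln m - d%:R * ln t)) measurableT iS).
have [i2 e2] := Rint_scale t1 ih.
rewrite mulrDr mulrA Rint_lin2// -e2; apply: Rint_ae_eq => //.
- by apply: measurable_funM => //; apply: measurableT_comp => //; exact: measurable_ln.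
- exact: itg_meas i2.
apply: filterS scaled_density => x sx _; rewrite sx; set y := t^-1 *: x.
have [->|Sy] := eqVneq (S y) 0; first by rewrite expr0n/= !(mulr0, mul0r, addr0).
have Sy0 : 0 < S y ^+ 2 by rewrite exprn_even_gt0.
have -> : ln (m * ((t ^+ d)^-1 * S y ^+ 2)) = ln m + (ln ((t ^+ d)^-1) + ln (S y ^+ 2)).
  exact: lnM3.
have -> : ln ((t ^+ d)^-1) = - (d%:R * ln t).
  by rewrite lnV ?posrE ?exprn_gt0// lnXn// mulr_natl.
ring.
Qed.

End fixed_time.

(** X is the second moment of R, RL its entropy, l = ln tau, A = tau^(-2) times the integral of
    |W|^2, C the energy bound and dl the parameter of [sqn_add_ge]. The conserved energy gives 2 (1
    - dl) l X <= n l M0 + e l; dividing by l and using 2 dl X <= e yields 2 X <= n M0 + 2 e. *)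
Lemma moment_arith (m kr RL lm n l M0 X A C Z dl idl E e : R) : 0 < m ->
  1 <= idl -> 0 < e -> 1 <= l -> E / m + idl * C + Z - lm * M0 <= e * l ->
  dl * (4 * C) <= e -> 0 <= dl ->
  E = 2^-1 * kr + m * (RL + (lm - n * l) * M0) ->
  m * ((1 - dl) * (4 * l) * X - (idl - 1) * A) <= kr ->
  A <= 2 * C -> - (2^-1 * X) - Z <= RL -> X <= 2 * C ->
  X <= n / 2 * M0 + e.
Proof.
move=> m0 i1 e0 l1 hK hdl dl0 hE hkr hA hRL hX.
have q1 : (1 - dl) * (4 * l) * X - (idl - 1) * A <= kr / m by rewrite ler_pdivlMr// mulrC.
have q2 : (idl - 1) * A <= (idl - 1) * (2 * C) by rewrite ler_wpM2l// subr_ge0.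
have hEm : E / m = 2^-1 * (kr / m) + (RL + (lm - n * l) * M0).
  by rewrite hE; field; rewrite gt_eqF.
have q3 : l * (2 * (1 - dl) * X) <= l * (e + n * M0).
  rewrite hEm in hK; move: (kr / m) q1 hK => k q1 hK; lra.
rewrite ler_pM2l in q3; last exact: lt_le_trans l1.
have q4 : dl * X <= dl * (2 * C) by rewrite ler_wpM2l.
lra.
Qed.

Lemma second_moment_limsup (eps m : R) (tau dtau : R -> R) (s S : R -> E -> R)
    (w W : R -> E -> E) : tau_solution tau dtau -> 0 < m ->
  energy_conserved eps s w -> rescaled tau dtau m s w S W ->
  energy_dissipation eps tau dtau S W ->
  (forall t, 0 <= t -> \int[mu]_y density S t y = \int[mu]_y (Gauss y : R)) ->
  forall e, 0 < e -> \forall t \near +oo,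
    \int[mu]_y (density S t y * sqn y) <= \int[mu]_y (sqn (y : E) * Gauss (y : E)) + e.
Proof.
move=> htau m0 hE hr hED hmass e e0.
pose C0 := energy_bound eps tau S W.
have C00 : 0 <= C0 by exact: (C0_ge0 htau hED).
(* Chosen so that dl <= 1 and 4 C0 dl <= e, which absorbs the loss dl X, as X <= 2 C0. *)
pose dl := e / (4 * C0 + e).
have D0 : 0 < 4 * C0 + e by rewrite ltr_wpDl// mulr_ge0.
have dl0 : 0 < dl by rewrite divr_gt0.
have dl1 : dl <= 1 by rewrite ler_pdivrMr// mul1r lerDr mulr_ge0.
have dl2 : dl * (4 * C0) <= e.
  rewrite /dl mulrAC ler_pdivrMr// ler_pM2l// lerDl; exact: ltW.
pose M0 := \int[mu]_y (Gauss y : R).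
pose Z := \int[mu]_y expR (- (2^-1 * sqn (y : E))).
have h2 : 0 < 2^-1 :> R by rewrite invr_gt0.
have iZ := itg_expR_sqn (d := d) h2.
pose E0 := energy eps s w 0.
(* The terms of the energy balance that stay bounded in t; ln tau(t) >= K / e makes them
   negligible. *)
pose K := E0 / m + dl^-1 * C0 + Z - ln m * M0.
have /cvgryPge hln := ln_tau_cvg htau.
near=> t.
have t0 : 0 <= t by near: t; exact: near_pinfty_ge0.
have l1 : 1 <= ln (tau t) by near: t; exact: hln.
have l2 : K / e <= ln (tau t) by near: t; exact: hln.
have tp := tau_gt0 htau t0.
have [h1s h1w he Eid] := hE t t0; have [h1S h1W he' _] := hED t t0.
have T := tight_density htau hED t0.
have iq : itg (fun y => S t y ^+ 2 * sqn y) by exact: tight_sqn_itg T.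
have iRl : itg (fun y => S t y ^+ 2 * ln (S t y ^+ 2)).
  have /Lfun1_integrable i1 := he'.
  apply: eq_integrable (itgB measurableT i1 iq) => // y _.
  by rewrite /density -/(sqn y) addrAC subrr add0r.
pose X := \int[mu]_y (S t y ^+ 2 * sqn y).
have X2 : X <= 2 * C0 by exact: tight_sqn_le T.
have kr := kinetic_rescaled m0 tp h1w h1W (hr t t0) dl0 iq.
have er := entropy_rescaled m0 tp h1s.1 h1S.1 (hr t t0) iRl.
have kw := kinetic_ge_w eps h1s h1w.
have kW : (tau t ^+ 2)^-1 * \int[mu]_y sqn (W t y) <= 2 * C0.
  rewrite ler_pdivrMl ?exprn_gt0// mulrC.
  exact: le_trans (kinetic_ge_w eps h1S h1W) (kinetic_le htau hED t0).
have low : - (2^-1 * X) - Z <= \int[mu]_y (S t y ^+ 2 * ln (S t y ^+ 2)).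
  have i3 := itgD measurableT (itgZ (- 2^-1) measurableT iq) (itgZ (-1) measurableT iZ).
  rewrite [leLHS](_ : _ = - 2^-1 * X + (-1) * Z); last by ring.
  rewrite Rint_lin2//; apply: le_Rintegral => // y _.
  by have := xlnx_ge (2^-1 * sqn y) (sqr_ge0 (S t y)); rewrite mulN1r mulNr mulrCA; lra.
have -> : \int[mu]_y (sqn (y : E) * Gauss (y : E)) = d%:R / 2 * M0 by case: (@int_sqn_Gauss R d).
have dt := dtau_sqr htau t0.
have Et : E0 = 2^-1 * kinetic eps s w t + \int[mu]_x (s t x ^+ 2 * ln (s t x ^+ 2)) by rewrite /E0 -Eid.
have mS : \int[mu]_y S t y ^+ 2 = M0 by exact: hmass.
rewrite er mS in Et; rewrite dt -/X in kr.
set A := (tau t ^+ 2)^-1 * _ in kW.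
rewrite -[_ * (tau t ^+ 2)^-1 * _]mulrA -/A in kr.
apply: (moment_arith m0 _ _ l1 _ _ _ Et (le_trans kr kw) kW low X2) => //.
- by rewrite invr_ge1// unitfE gt_eqF.
- by move: l2; rewrite ler_pdivrMr// [_ * e]mulrC.
- exact: ltW.
Unshelve. all: by end_near. Qed.

End second_moment.

Unset Implicit Arguments.

Theorem corollary1p8 (R : realType) (d : nat) (hd : (1 <= d)%N)
  (eps : R) (heps : 0 < eps)
  (tau dtau : R -> R) (htau : tau_solution tau dtau)
  (psi0 : 'rV[R]_d -> R[i]) (hH1 : cH1 psi0) (hFH1 : cFH1 psi0)
  (hpsi0 : ~ {ae lebesgue_rV d, forall x, psi0 x = 0})
  (sqrt_rho : R -> 'rV[R]_d -> R) (sqrt_rho_u : R -> 'rV[R]_d -> 'rV[R]_d)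
  (sqrt_R : R -> 'rV[R]_d -> R) (sqrt_RU : R -> 'rV[R]_d -> 'rV[R]_d) :
  let rho0 := absC2 psi0 in
  let j0 := current eps psi0 in
  let mass := normL1 rho0 / normL1 (@Gauss R d) in
  let R0 := fun y => rho0 y / mass in
  let J0 := fun y => mass^-1 *: j0 y in
  let Rt := density sqrt_R in
  weak_solution_K eps rho0 j0 sqrt_rho sqrt_rho_u ->
  energy_conserved eps sqrt_rho sqrt_rho_u ->
  rescaled tau dtau mass sqrt_rho sqrt_rho_u sqrt_R sqrt_RU ->
  weak_solution_RK eps tau R0 J0 sqrt_R sqrt_RU ->
  energy_dissipation eps tau dtau sqrt_R sqrt_RU ->
  weakly_continuous sqrt_R ->
  [/\ (\int[lebesgue_rV d]_y Rt t y) @[t --> +oo]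
        --> (\int[lebesgue_rV d]_y Gauss y),
      forall i : 'I_d,
        (\int[lebesgue_rV d]_y (y ord0 i * Rt t y)) @[t --> +oo]
        --> (\int[lebesgue_rV d]_y (y ord0 i * Gauss y)),
      (\int[lebesgue_rV d]_y ((y \dot y) * Rt t y)) @[t --> +oo]
        --> (\int[lebesgue_rV d]_y ((y \dot y) * Gauss y)) &
      weak_cvgL1 Rt (@Gauss R d)].
Proof.
move=> rho0 j0 mass R0 J0 Rt _ hE hr hRK hED hwc.
pose mu : {measure set 'rV[R]_d -> \bar R} := lebesgue_rV d.
have [hre him _] := hFH1.
have rhoE x : rho0 x = cRe psi0 x ^+ 2 + cIm psi0 x ^+ 2.
  rewrite /rho0 /absC2 /cRe /cIm; case: (psi0 x) => a b /=.
  by rewrite sqr_sqrtr// addr_ge0// sqr_ge0.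
have irho : mu.-integrable setT (fun x => (rho0 x)%:E).
  apply: eq_integrable (itgD measurableT (Lfun2_sqr hre) (Lfun2_sqr him)) => // x _.
  by rewrite rhoE.
have rho_ge0 x : 0 <= rho0 x by exact: sqr_ge0.
have normE (f : 'rV[R]_d -> R) : (forall x, 0 <= f x) -> normL1 f = \int[mu]_x f x.
  move=> f0; rewrite /normL1 Lnorm1 /Rintegral; congr fine.
  by apply: eq_integral => x _; rewrite /= ger0_norm.
(* As psi0 is not almost everywhere 0, the initial mass is positive and can be divided by. *)
have rho_int0 : 0 < \int[mu]_x rho0 x.
  rewrite lt_neqAle Rintegral_ge0// andbT; apply/eqP => h0; apply: hpsi0.
  have : (\int[mu]_(x in setT) `|(rho0 x)%:E| = 0)%E.
    rewrite (eq_integral (fun x => (rho0 x)%:E)); last by move=> x _; rewrite /= ger0_norm.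
    by rewrite -[LHS]fineK ?integrable_fin_num// [fine _](esym h0).
  move/(ae_eq_integral_abs mu measurableT (measurable_int mu irho)).
  apply: filterS => x /(_ I) [/eqP]; rewrite rhoE.
  rewrite paddr_eq0 ?sqr_ge0// !sqrf_eq0 /cRe /cIm; case: (psi0 x) => a b /=.
  by move=> /andP[/eqP -> /eqP ->].
have Gint0 := @int_Gauss_gt0 R d.
have massE : mass = (\int[mu]_x rho0 x) / \int[mu]_y (Gauss y : R).
  by rewrite /mass !normE// => x; exact: expR_ge0.
have mass0 : 0 < mass by rewrite massE divr_gt0.
have iR0 : mu.-integrable setT (fun x => (R0 x)%:E).
  apply: eq_integrable (itgZ mass^-1 measurableT irho) => // x _.
  by rewrite /R0 mulrC.
(* The normalisation gives [R0] the mass of the Gaussian; [mass_conservation] carries it to all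
   times. *)
have intR0 : \int[mu]_y R0 y = \int[mu]_y (Gauss y : R).
  transitivity (\int[mu]_x (mass^-1 * rho0 x)).
    by apply: eq_Rintegral => x _; rewrite mulrC.
  by rewrite RintegralZl// massE invf_div mulfVK// gt_eqF.
have hmass t : 0 <= t -> \int[mu]_y Rt t y = \int[mu]_y (Gauss y : R).
  by move=> t0; rewrite (mass_conservation htau iR0 hRK hED hwc t0).
have ht := tight_density htau hED.
have hA (j : 'I_d) (psi : 'I_d -> R -> R) : (forall i, test1 (psi i)) ->
    \int[mu]_y (Rt t y * (partial j (prodf psi) y - 2 * (y : 'rV[R]_d) ord0 j * prodf psi y))
      @[t --> +oo] --> (0 : R).
  (* The vector field has the product as its j-th component and 0 elsewhere, so [stein_psi] involves
     a single coordinate. *)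
  move=> tpsi; pose v (i : 'I_d) : 'rV[R]_d -> R := if i == j then prodf psi else fun=> 0.
  have tv i : test_fun (v i).
    by rewrite /v; case: ifP => _; [exact: test_prodf|exact: test_fun0].
  have := stein_cvg htau iR0 hRK hED hwc tv.
  rewrite (_ : stein_psi v = fun y => partial j (prodf psi) y - 2 * y ord0 j * prodf psi y)//.
  apply/funext => y; rewrite /stein_psi /div_psi (bigD1 j)//= big1 ?addr0; last first.
    by move=> i /negbTE ij; rewrite /v ij /partial derive_cst.
  rewrite (bigD1 j)//= big1 ?addr0; last by move=> i /negbTE ij; rewrite /v ij mulr0.
  by rewrite /v eqxx mulrA.
have hb n (a b : 'I_d -> R) := bump_cvg ht hmass hA (fun i => test1_bump n (a i) (b i))
  (fun i x => bump_ge0 n (a i) (b i) x).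
have hw := weak_cvg_bounded ht hb.
have hlim := second_moment_limsup htau mass0 hE hr hED hmass.
split.
- exact: mass_cvg hw.
- exact: first_moment_cvg ht hw.
- exact: second_moment_cvg ht hw hlim.
- exact: weak_cvgL1_Gauss ht hw.
Qed.
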